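(* Let $M$ be a compact (possibly disconnected) one-manifold. Then no finite index subgroup of the right-angled Artin group $A(P_4)$ admits an injective homomorphism into $\mathrm{Diff}_+^{1+\mathrm{bv}}(M)$.
   Context: $\mathrm{Diff}_+^{1+\mathrm{bv}}(M)$ denotes the group (under composition) of orientation-preserving $C^1$ diffeomorphisms $f$ of $M$ whose first derivative $f'$ has bounded total variation on $M$. For a finite simplicial graph $\Gamma$ with vertex set $V(\Gamma)$ and edge set $E(\Gamma)$, the right-angled Artin group $A(\Gamma)$ is the group generated by $V(\Gamma)$ with defining relations $[v_i,v_j]=1$ for each edge $\{v_i,v_j\}\in E(\Gamma)$ (and no others). $P_4$ is the path graph on $4$ vertices (with $3$ edges). *)

(* Defs.v *)
From HB Require Import structures.
From mathcomp Require Import all_boot all_order all_algebra generic_quotient.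
From mathcomp Require Import all_classical all_reals all_analysis.

Set Implicit Arguments.
Unset Strict Implicit.
Unset Printing Implicit Defensive.

Import Order.TTheory GRing.Theory Num.Theory.
Import numFieldNormedType.Exports.

Local Open Scope classical_set_scope.
Local Open Scope ring_scope.
Local Open Scope quotient_scope.

(* The letter (v, true) stands for the generator v and (v, false) for its
   inverse. *)
Definition word (V : choiceType) : Type := seq (V * bool).

HB.instance Definition _ (V : choiceType) := Choice.on (word V).

Inductive pres_eq (V : choiceType) (rels : set (word V)) :
    word V -> word V -> Prop :=
| pres_eq_refl w : pres_eq rels w w
| pres_eq_sym w1 w2 : pres_eq rels w1 w2 -> pres_eq rels w2 w1
| pres_eq_trans w1 w2 w3 :
    pres_eq rels w1 w2 -> pres_eq rels w2 w3 -> pres_eq rels w1 w3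
| pres_eq_cat w1 w1' w2 w2' :
    pres_eq rels w1 w1' -> pres_eq rels w2 w2' ->
    pres_eq rels (w1 ++ w2) (w1' ++ w2')
| pres_eq_free v b : pres_eq rels [:: (v, b); (v, ~~ b)] [::]
| pres_eq_rel r : rels r -> pres_eq rels r [::].

Section PresentedGroup.
Variables (V : choiceType) (rels : set (word V)).

Definition pres_eqb : rel (word V) := fun w1 w2 => `[< pres_eq rels w1 w2 >].

Lemma pres_eqb_equiv : equiv_class_of pres_eqb.
Proof.
split.
- by move=> w; apply/asboolP; exact: pres_eq_refl.
- by move=> w1 w2; apply/asboolP/asboolP; exact: pres_eq_sym.
- move=> w2 w1 w3 /asboolP h12 /asboolP h23; apply/asboolP.
  exact: pres_eq_trans h12 h23.
Qed.

Canonical pres_equiv_rel := EquivRelPack pres_eqb_equiv.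

Definition presented_group := {eq_quot pres_equiv_rel}.

HB.instance Definition _ := Choice.on presented_group.
HB.instance Definition _ := EqQuotient.on presented_group.

Definition word_inv (w : word V) : word V :=
  rev [seq (l.1, ~~ l.2) | l <- w].

Lemma pres_piP (w1 w2 : word V) :
  pres_eq rels w1 w2 <-> \pi_presented_group w1 = \pi_presented_group w2.
Proof.
split=> [h|]; first by apply/eqmodP/asboolP.
by move=> /eqmodP /asboolP.
Qed.

Lemma pres_reprK (w : word V) :
  pres_eq rels (repr (\pi_presented_group w)) w.
Proof. by apply/pres_piP; rewrite reprK. Qed.

Lemma word_invK : involutive word_inv.
Proof.
move=> w; rewrite /word_inv map_rev revK -map_comp -[RHS]map_id.
by apply: eq_map => -[v b] /=; rewrite negbK.
Qed.

Lemma pres_mulVw (w : word V) : pres_eq rels (word_inv w ++ w) [::].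
Proof.
elim: w => [|[v b] w IH]; first exact: pres_eq_refl.
rewrite /word_inv /= rev_cons -/(word_inv w) cat_rcons.
apply: pres_eq_trans IH; apply: pres_eq_cat; first exact: pres_eq_refl.
rewrite -[w in X in pres_eq _ _ X]cat0s -[in X in pres_eq _ X _]cat1s.
rewrite -[(v, b) :: w]cat1s catA; apply: pres_eq_cat; last exact: pres_eq_refl.
by rewrite -{2}[b]negbK; exact: pres_eq_free.
Qed.

Lemma pres_mulwV (w : word V) : pres_eq rels (w ++ word_inv w) [::].
Proof. by rewrite -{1}[w]word_invK; exact: pres_mulVw. Qed.

Lemma pres_inv_congr (w1 w2 : word V) :
  pres_eq rels w1 w2 -> pres_eq rels (word_inv w1) (word_inv w2).
Proof.
move=> h12; apply: (@pres_eq_trans _ _ _ (word_inv w1 ++ (w2 ++ word_inv w2))).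
  rewrite -{1}[word_inv w1]cats0; apply: pres_eq_cat; first exact: pres_eq_refl.
  exact/pres_eq_sym/pres_mulwV.
rewrite catA -[X in pres_eq _ _ X]cat0s; apply: pres_eq_cat; last first.
  exact: pres_eq_refl.
apply: pres_eq_trans (pres_mulVw w1); apply: pres_eq_cat.
  exact: pres_eq_refl.
exact: pres_eq_sym.
Qed.

Definition pres_one : presented_group := \pi_presented_group [::].
Definition pres_mul (x y : presented_group) : presented_group :=
  \pi_presented_group (repr x ++ repr y).
Definition pres_inv (x : presented_group) : presented_group :=
  \pi_presented_group (word_inv (repr x)).

Lemma pres_mulE (w1 w2 : word V) :
  pres_mul (\pi_presented_group w1) (\pi_presented_group w2) =
    \pi_presented_group (w1 ++ w2).
Proof. by apply/pres_piP; apply: pres_eq_cat; exact: pres_reprK. Qed.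

Lemma pres_invE (w : word V) :
  pres_inv (\pi_presented_group w) = \pi_presented_group (word_inv w).
Proof. by apply/pres_piP; apply: pres_inv_congr; exact: pres_reprK. Qed.

Lemma pres_mulA : associative pres_mul.
Proof.
move=> x y z; elim/quotW: x => x; elim/quotW: y => y; elim/quotW: z => z.
by rewrite (pres_mulE y z) (pres_mulE x y) !pres_mulE catA.
Qed.

Lemma pres_mul1g : left_id pres_one pres_mul.
Proof. by elim/quotW=> w; rewrite /pres_one pres_mulE. Qed.

Lemma pres_mulg1 : right_id pres_one pres_mul.
Proof. by elim/quotW=> w; rewrite /pres_one pres_mulE cats0. Qed.

Lemma pres_mulVg : left_inverse pres_one pres_inv pres_mul.
Proof.
elim/quotW=> w; rewrite pres_invE pres_mulE.
by apply/pres_piP; exact: pres_mulVw.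
Qed.

Lemma pres_mulgV : right_inverse pres_one pres_inv pres_mul.
Proof.
elim/quotW=> w; rewrite pres_invE pres_mulE.
by apply/pres_piP; exact: pres_mulwV.
Qed.

HB.instance Definition _ := isGroup.Build presented_group
  pres_mulA pres_mul1g pres_mulg1 pres_mulVg pres_mulgV.

End PresentedGroup.

Definition commutator_word (V : choiceType) (u v : V) : word V :=
  [:: (u, true); (v, true); (u, false); (v, false)].

Definition RAAG (V : finType) (e : rel V) : groupType :=
  presented_group [set r : word V | exists u v, e u v /\ r = commutator_word u v].

Definition P4 : rel 'I_4 := fun i j => (i.+1 == j :> nat) || (j.+1 == i :> nat).

Definition finite_index (G : groupType) (H : {pred G}) : Prop :=
  finite_set [set C : set G | exists g : G, C = [set (g * h)%g | h in [set` H]]].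

Section Within.
Variables (R : realType) (A : set R).

(* [A] is meant to have no isolated point: at such a point these limits would be
   taken along an improper filter. At an end point of [A] they are one-sided. *)
Definition diff_quotient (f : R -> R) (t s : R) : R := (f s - f t) / (s - t).

Definition derivable_within (f : R -> R) (t : R) : Prop :=
  cvg (diff_quotient f t s @[s --> within A t^']).

Definition derive_within (f : R -> R) (t : R) : R :=
  lim (diff_quotient f t s @[s --> within A t^']).

Definition C1_within (f : R -> R) : Prop :=
  (forall t, A t -> derivable_within f t) /\
  {within A, continuous (derive_within f)}.

Definition smooth_within (f : R -> R) : Prop :=
  forall (n : nat) t, A t -> derivable_within (iter n derive_within f) t.

Definition increasing_within (f : R -> R) : Prop :=
  forall t, A t -> 0 < derive_within f t.

Definition bv_derivative_within (f : R -> R) : Prop :=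
  forall a b, a <= b -> `[a, b] `<=` A ->
    bounded_variation a b (derive_within f).

End Within.

(* Only the restrictions of [chart_map] to [chart_dom] and of [chart_inv] to
   the image of [chart_dom] are meaningful. *)
Record chart (R : realType) (M : topologicalType) := Chart {
  chart_dom : set M ;
  chart_map : M -> R ;
  chart_inv : R -> M }.

Section Manifold.
Variables (R : realType) (M : topologicalType).
Implicit Types c d : chart R M.

Definition chart_img c : set R := chart_map c @` chart_dom c.

(* Both half-lines are needed as models: with [0, +oo[ alone, an interval with
   two end points has no oriented atlas. *)
Definition half_line (L : set R) : Prop :=
  L = [set x | 0 <= x] \/ L = [set x | x <= 0].

Definition is_chart c : Prop :=
  [/\ open (chart_dom c),
      exists L W, [/\ half_line L, open W & chart_img c = W `&` L],
      forall x, chart_dom c x -> chart_inv c (chart_map c x) = x,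
      {within chart_dom c, continuous (chart_map c)} &
      {within chart_img c, continuous (chart_inv c)}].

(* The expression of [f : M -> M] in the charts [c] (source) and [d] (target)
   and its domain of definition. *)
Definition local_dom c d (f : M -> M) : set R :=
  chart_map c @` (chart_dom c `&` f @^-1` chart_dom d).

Definition local_rep c d (f : M -> M) : R -> R :=
  chart_map d \o f \o chart_inv c.

(* The empty manifold and manifolds with boundary are allowed, and no
   connectedness is assumed. *)
Record compact_one_manifold (atlas : set (chart R M)) : Prop := {
  manifold_compact : compact [set: M] ;
  manifold_hausdorff : hausdorff_space M ;
  manifold_second_countable : @second_countable M ;
  atlas_chart : forall c, atlas c -> is_chart c ;
  atlas_cover : forall x : M, exists2 c, atlas c & chart_dom c x ;
  atlas_smooth : forall c d, atlas c -> atlas d ->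
    smooth_within (local_dom c d idfun) (local_rep c d idfun) ;
  atlas_oriented : forall c d, atlas c -> atlas d ->
    increasing_within (local_dom c d idfun) (local_rep c d idfun) }.

Variable atlas : set (chart R M).

Definition C1_map (f : M -> M) : Prop :=
  continuous f /\
  forall c d, atlas c -> atlas d ->
    C1_within (local_dom c d f) (local_rep c d f).

Definition C1_diffeo (f : M -> M) : Prop :=
  C1_map f /\ exists g : M -> M, [/\ C1_map g, cancel f g & cancel g f].

Definition orientation_preserving (f : M -> M) : Prop :=
  forall c d, atlas c -> atlas d ->
    increasing_within (local_dom c d f) (local_rep c d f).

(* On a compact manifold, finitely many compact arcs lying in charts cover
   everything, so bounding the variation of the derivative over each of these
   arcs amounts to bounding its total variation over M. *)
Definition bv_derivative (f : M -> M) : Prop :=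
  forall c d, atlas c -> atlas d ->
    bv_derivative_within (local_dom c d f) (local_rep c d f).

Definition Diff1bv : set (M -> M) :=
  [set f | [/\ C1_diffeo f, orientation_preserving f & bv_derivative f]].

End Manifold.

(** [rho] is only considered on [H]; the group law on [D] is composition. *)
Definition embedding (G : groupType) (H : {pred G}) (M : Type)
    (D : set (M -> M)) (rho : G -> M -> M) : Prop :=
  [/\ forall g, g \in H -> D (rho g),
      forall g h, g \in H -> h \in H -> rho (g * h)%g = rho g \o rho h &
      {in H &, injective rho}].

(* Main.v *)
(* Each component of M is a circle or an interval. Doubling the intervals, one
   gets on every component an action of a finite index subgroup by circle
   diffeomorphisms with derivative of bounded variation. Let a, b, c, d be powers
   of the generators along P_4. By Kopell's lemma the centralizer of b permutes
   the components of the support of b, up to powers fixes each of them, and acts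
   freely there modulo its kernel, hence, by Hoelder's theorem, through an abelian
   group. So some al = [a^n, c^m] and be = b^l have disjoint supports. A conjugate
   t = d al d^-1 or t = d be d^-1 fixes a common fixed point p of al and be. With
   ga = t al t^-1 and de = t be t^-1, two pairs of disjointly supported commuting
   maps meet at p, and comparing derivatives near p (the two jumps argument)
   shows that [[ga, be de be^-1], al] is trivial near p, and likewise near every
   global fixed point of the group S generated by al, be, t. Its support thus
   meets only finitely many gaps between global fixed points of S, and it can be
   made trivial on one gap after another: S displaces compact subsets of a gap,
   and suitable conjugates commute there.
   That the elements obtained remain nontrivial is read off a representation of
   A(P_4) in GL_3(Q), in which none of them is scalar: for x nonscalar, finitely
   many conjugates of x by elements of S have only scalar matrices as common
   commutant, so for every nonscalar z some commutator [z, g x g^-1] is again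
   nonscalar. The same remark combines the elements found on the various
   components into a nontrivial element acting trivially on all of M. *)

Require Import Defs.
From mathcomp Require Import all_boot all_order all_algebra generic_quotient.
From mathcomp Require Import all_classical all_reals all_analysis.
From mathcomp Require Import ring lra zify.

Set Implicit Arguments.
Unset Strict Implicit.
Unset Printing Implicit Defensive.

Import Order.TTheory GRing.Theory Num.Theory.
Import numFieldNormedType.Exports.

Local Open Scope classical_set_scope.
Local Open Scope ring_scope.
Local Open Scope quotient_scope.

(** * Differentiation on the line *)

(** The obstacle is an order of choices. When an element is killed on a gap, the displacing
    conjugator must be fixed before it is known which further conjugate keeps the commutator
    nontrivial; only a finite list of candidates has a common margin near the ends of the gap.
    Nontriviality must also survive an unbounded number of commutators, which is why it is replaced
    by having a nonscalar matrix. Size 3 over the rationals makes a scalar commutator equal to 1,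
    since determinants show that the cube of the scalar is 1. The matrix statements hold for all
    positive exponents of the generators, the last exponent being at least 2. Circles and intervals
    are treated alike through 1-periodic maps from the line, even ones for intervals. An element
    then lifts only up to integer translations; these vanish once a lift has a fixed point, because
    such a lift moves every point by less than 1. Bounded variation enters through the logarithm of
    the derivative, written as a difference of monotone functions. *)

Section Calculus.
Variable R : realType.
Implicit Types (I A : set R) (f g : R -> R).

Definition cont_at I f x := forall e, 0 < e ->
  exists2 d, 0 < d & forall y, I y -> `|y - x| < d -> `|f y - f x| < e.

(** The quotient is multiplied out, so that [y = x] needs no exclusion. [I] restricts only the
    points [y], which covers one-sided derivatives at the ends of a segment. *)
Definition der_at I f x l := forall e, 0 < e ->
  exists2 d, 0 < d &
  forall y, I y -> `|y - x| < d -> `|f y - f x - l * (y - x)| <= e * `|y - x|.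

Lemma cont_atW I J f x : J `<=` I -> cont_at I f x -> cont_at J f x.
Proof.
by move=> JI fx e /fx[d d0 H]; exists d => // y /JI Iy; exact: H.
Qed.

Lemma der_atW I J f x l : J `<=` I -> der_at I f x l -> der_at J f x l.
Proof.
by move=> JI fx e /fx[d d0 H]; exists d => // y /JI Iy; exact: H.
Qed.

Lemma der_cont I f x l : der_at I f x l -> cont_at I f x.
Proof.
move=> fx e e0; have [d d0 H] := fx 1 ltr01.
have K0 : 0 < 1 + `|l| by rewrite ltr_pwDl.
exists (Num.min d (e / (1 + `|l|))); first by rewrite lt_min d0 divr_gt0.
move=> y Iy; rewrite lt_min => /andP[yd ye]; rewrite ltr_pdivlMr // in ye.
apply: le_lt_trans ye; have := H y Iy yd; rewrite mul1r => {}H.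
have -> : f y - f x = (f y - f x - l * (y - x)) + l * (y - x) by ring.
rewrite (le_trans (ler_normD _ _)) // [leRHS]mulrDr mulr1 lerD // normrM.
by rewrite mulrC.
Qed.

Lemma cont_comp I J f g x : (forall y, I y -> J (g y)) ->
  cont_at I g x -> cont_at J f (g x) -> cont_at I (f \o g) x.
Proof.
move=> IJ gx fx e /fx[d d0 Hd]; have [d' d'0 Hd'] := gx _ d0.
by exists d' => // y Iy /(Hd' _ Iy); apply: Hd; exact: IJ.
Qed.

Lemma der_comp I J f g x l m : (forall y, I y -> J (g y)) ->
  der_at I g x l -> der_at J f (g x) m -> der_at I (f \o g) x (m * l).
Proof.
move=> IJ gx fx e e0.
have K0 : 0 < 1 + `|l| by rewrite ltr_pwDl.
have M0 : 0 < 1 + `|m| by rewrite ltr_pwDl.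
have e1 : 0 < e / 2 / (1 + `|l|) by rewrite !divr_gt0.
have e2 : 0 < Num.min 1 (e / 2 / (1 + `|m|)).
  by rewrite lt_min ltr01 !divr_gt0.
have [d1 d10 H1] := fx _ e1; have [d2 d20 H2] := gx _ e2.
have [d3 d30 H3] := der_cont gx d10.
exists (Num.min d2 d3); first by rewrite lt_min d20.
move=> y Iy; rewrite lt_min => /andP[yd2 yd3] /=.
have := H1 _ (IJ _ Iy) (H3 _ Iy yd3); have := H2 _ Iy yd2.
set u := f _ - f _ - _; set v := g y - g x - _ => Hv Hu.
have -> : f (g y) - f (g x) - m * l * (y - x) = u + m * v.
  by rewrite /u /v; ring.
have gb : `|g y - g x| <= (1 + `|l|) * `|y - x|.
  have -> : g y - g x = v + l * (y - x) by rewrite /v; ring.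
  rewrite (le_trans (ler_normD _ _)) // mulrDl mul1r normrM lerD //.
  by rewrite (le_trans Hv) // ler_piMl // ge_min lexx.
rewrite (le_trans (ler_normD _ _)) // normrM.
have -> : e * `|y - x| = e / 2 * `|y - x| + e / 2 * `|y - x| by field.
apply: lerD.
  rewrite (le_trans Hu) //.
  have -> : e / 2 * `|y - x| =
      e / 2 / (1 + `|l|) * ((1 + `|l|) * `|y - x|) by field; lra.
  by rewrite ler_pM2l.
have : `|v| <= e / 2 / (1 + `|m|) * `|y - x|.
  by rewrite (le_trans Hv) // ler_wpM2r // ge_min lexx orbT.
move=> Hv'; rewrite (le_trans (ler_wpM2l (normr_ge0 m) Hv')) //.
have -> : `|m| * (e / 2 / (1 + `|m|) * `|y - x|) =
   (`|m| / (1 + `|m|)) * (e / 2 * `|y - x|) by field; lra.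
rewrite ler_piMl ?mulr_ge0 ?divr_ge0 // ?(ltW e0) //.
by rewrite ler_pdivrMr // mul1r lerDr.
Qed.

Lemma der_affine I (a b x : R) : der_at I (fun y => a * y + b) x a.
Proof.
move=> e e0; exists 1 => // y _ _.
have -> : a * y + b - (a * x + b) - a * (y - x) = 0 by ring.
by rewrite normr0 mulr_ge0 // ltW.
Qed.

Lemma der_id I (x : R) : der_at I id x 1.
Proof.
move=> e e0; exists 1 => // y _ _ /=.
by rewrite mul1r subrr normr0 mulr_ge0 // ltW.
Qed.

Lemma der_shift I (k x : R) : der_at I (fun y => y + k) x 1.
Proof.
move=> e e0; exists 1 => // y _ _.
have -> : y + k - (x + k) - 1 * (y - x) = 0 by ring.
by rewrite normr0 mulr_ge0 // ltW.
Qed.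

Lemma der_local I J f g x l r : 0 < r ->
  (forall y, J y -> `|y - x| < r -> I y /\ f y = g y) -> f x = g x ->
  der_at I f x l -> der_at J g x l.
Proof.
move=> r0 H fgx fx e /fx[d d0 Hd]; exists (Num.min d r).
  by rewrite lt_min d0.
move=> y Jy; rewrite lt_min => /andP[yd /(H _ Jy)[Iy <-]]; rewrite -fgx.
exact: Hd.
Qed.

Lemma cont_local I J f g x r : 0 < r ->
  (forall y, J y -> `|y - x| < r -> I y /\ f y = g y) -> f x = g x ->
  cont_at I f x -> cont_at J g x.
Proof.
move=> r0 H fgx fx e /fx[d d0 Hd]; exists (Num.min d r).
  by rewrite lt_min d0.
move=> y Jy; rewrite lt_min => /andP[yd /(H _ Jy)[Iy <-]]; rewrite -fgx.
exact: Hd.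
Qed.

Lemma der_is_derive f x l : der_at setT f x l -> is_derive x 1 f l.
Proof.
move=> fx; have H : h^-1 *: (f (h + x) - f x) @[h --> 0^'] --> l.
  apply/cvgrPdist_le => e e0; have [d d0 Hd] := fx _ e0.
  near=> h; have h0 : h != 0 by near: h; exact: nbhs_dnbhs_neq.
  have hd : `|h + x - x| < d.
    rewrite addrK; near: h; apply: dnbhs0_lt => //.
  have := Hd (h + x) I hd; rewrite addrK => {}Hd.
  rewrite distrC -(ler_pM2r (x := `|h|)) ?normr_gt0 // -normrM.
  suff -> : (h^-1 *: (f (h + x) - f x) - l) * h = f (h + x) - f x - l * h by [].
  by rewrite mulrBl -[_ *: _]/(_ * _) [_^-1 * _]mulrC mulfVK.
have H' : h^-1 *: (f (h *: 1 + x) - f x) @[h --> 0^'] --> l.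
  by apply: cvg_trans H; apply: near_eq_cvg; near=> h; rewrite -[h *: 1]/(h * 1) mulr1.
by split; [exact: cvgP H'|exact/cvg_lim].
Unshelve. all: by end_near. Qed.

Lemma cont_within a b f : (forall x, a <= x <= b -> cont_at `[a, b] f x) ->
  {within `[a, b], continuous f}.
Proof.
move=> fc; apply/subspace_continuousP => x; rewrite /= in_itv /= => xab.
apply/cvgrPdist_lt => e e0; have [d d0 Hd] := fc _ xab _ e0.
rewrite near_withinE; near=> y => yab.
rewrite distrC; apply: Hd => //.

Unshelve. all: by end_near. Qed.

Lemma mvt f df a b : a < b ->
  (forall x, a <= x <= b -> der_at `[a, b] f x (df x)) ->
  exists2 c, a < c < b & f b - f a = df c * (b - a).
Proof.
move=> ab fd; have [||c] := @MVT R f df a b ab; last 1 first.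
- by rewrite in_itv /=; exists c.
- move=> x; rewrite in_itv /= => /andP[ax xb].
  apply: der_is_derive.
  apply: (@der_local `[a, b] _ f f x _ (Num.min (x - a) (b - x))) => //.
  + by rewrite lt_min !subr_gt0 ax.
  + move=> y _; rewrite lt_min => /andP[/ltr_normlP[h1 _] /ltr_normlP[_ h2]].
    by split=> //; rewrite /= in_itv /=; lra.
  + by apply: fd; lra.
- by apply: cont_within => x xab; apply: der_cont (fd _ xab).
Qed.

Lemma ivt f a b v : a <= b -> (forall x, a <= x <= b -> cont_at `[a, b] f x) ->
  f a <= v <= f b -> exists2 c, a <= c <= b & f c = v.
Proof.
move=> ab fc /andP[av vb].
have [||c] := @IVT R f a b v ab; last 1 first.
- by rewrite in_itv /=; exists c.
- exact: cont_within.
- by rewrite ge_min av /= le_max vb orbT.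
Qed.

Lemma cont_bounded_gt0 a b f : a <= b ->
  (forall x, a <= x <= b -> cont_at `[a, b] f x) ->
  (forall x, a <= x <= b -> 0 < f x) ->
  exists2 m, 0 < m & forall x, a <= x <= b -> m <= f x.
Proof.
move=> ab fc f0; have [c] := EVT_min ab (cont_within fc).
rewrite in_itv /= => cab H; exists (f c); first exact: f0.
by move=> x xab; apply: H; rewrite in_itv.
Qed.

End Calculus.

(** * Circle diffeomorphisms *)

Lemma int_part (R : realType) (t : R) : exists k : int, k%:~R <= t < k%:~R + 1.
Proof.
by exists (Num.floor t); rewrite floor_le /= -[1]/(1%:~R) -intrD; exact: floorD1_gt.
Qed.

Lemma int_lt1 (R : realType) (k : int) : - 1 < k%:~R :> R -> k%:~R < 1 :> R -> k = 0.
Proof.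
move=> h1 h2; have k1 : (-1)%:~R < k%:~R :> R by rewrite rmorphN.
have k2 : k%:~R < 1%:~R :> R by [].
by rewrite !ltr_int in k1 k2; lia.
Qed.

Section Circle.
Variable R : realType.
Implicit Types (F G P : R -> R) (x y p q : R).

(** Bounded variation in Jordan form. [P] and [N] are monotone on the whole line, so their
    increments can be summed over arcs without checking domains. *)
Definition dmono (a b : R) (f : R -> R) : Prop := exists P N : R -> R,
  [/\ {homo P : x y / x <= y}, {homo N : x y / x <= y} &
      forall x, a <= x <= b -> f x = P x - N x].

Definition circle_diffeo F F' : Prop :=
  [/\ forall x, der_at setT F x (F' x), forall x, cont_at setT F' x,
      forall x, 0 < F' x & forall x, F (x + 1) = F x + 1].

(** The window [[0, 2]] contains every arc of length at most 1 whose left end has been translated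
    into [[0, 1)]. *)
Definition circle_bv F : Prop :=
  exists2 F', circle_diffeo F F' & dmono 0 2 (@ln R \o F').

Lemma seq_argmax (T : eqType) (u : T -> R) (s : seq T) : s != [::] ->
  exists2 i, i \in s & forall j, j \in s -> u j <= u i.
Proof.
elim: s => // i s IH _; have [->|s0] := eqVneq s [::].
  by exists i; rewrite ?mem_head // => j; rewrite inE => /eqP->.
have [k ks kmax] := IH s0; have [h|h] := leP (u k) (u i).
  exists i; rewrite ?mem_head // => l; rewrite inE => /predU1P[->//|/kmax].
  by move/le_trans; exact.
exists k; first by rewrite inE ks orbT.
by move=> l; rewrite inE => /predU1P[->|/kmax//]; exact: ltW.
Qed.

(** The interval whose left end is rightmost has all others to its left, so these fit into
    [[lo, u i]] and the induction lowers [hi] to [u i]. *)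
Lemma sum_increments P (s : seq nat) (u v : nat -> R) lo hi :
  {homo P : x y / x <= y} -> uniq s -> lo <= hi ->
  (forall i, i \in s -> [/\ lo <= u i, u i < v i & v i <= hi]) ->
  (forall i j, i \in s -> j \in s -> i != j -> v i <= u j \/ v j <= u i) ->
  \sum_(i <- s) (P (v i) - P (u i)) <= P hi - P lo.
Proof.
move=> Pm; have [n] := ubnP (size s); elim: n s hi => // n IH s hi.
have [->|s0] := eqVneq s [::].
  by move=> _ _ lohi _ _; rewrite big_nil subr_ge0 Pm.
move=> sn us lohi uv dis; have [i si imax] := seq_argmax u s0.
rewrite (big_rem i) //=.
have [loi uvi vhi] := uv i si.
have ltu j : j \in rem i s -> j \in s /\ v j <= u i.
  rewrite mem_rem_uniq // !inE => /andP[ji js]; split => //.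
  have [_ uvj _] := uv j js.
  have ij : i != j by rewrite eq_sym.
  have [h|//] := dis i j si js ij.
  by have := imax _ js; lra.
have -> : P hi - P lo = (P hi - P (u i)) + (P (u i) - P lo) by ring.
apply: lerD; first by rewrite lerD2r Pm.
apply: IH => //.
- by rewrite size_rem //; move: sn s0; case: (s) => //= *; lia.
- exact: rem_uniq.
- by move=> j /ltu[js vj]; have [] := uv j js.
- by move=> j k /ltu[js _] /ltu[ks _]; exact: dis.
Qed.

Lemma cont_unif f a b e : (forall x, cont_at setT f x) -> 0 < e ->
  exists2 d, 0 < d & forall x y, a <= x <= b -> `|y - x| < d ->
    `|f y - f x| < e.
Proof.
move=> cf e0; have /compact_near_coveringP H := @segment_compact R a b.
have := H R (0^'+) (fun d x => forall y, `|y - x| < d -> `|f y - f x| < e) _.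
case.
  move=> x _; have [d d0 Hd] := cf x (e / 2) (divr_gt0 e0 (ltr0n _ 2)).
  exists (ball x (d / 2), [set t | t < d / 2]) => /=; first split.
  - by apply: nbhsx_ballx; rewrite divr_gt0.
  - by apply: nbhs_right_lt; rewrite divr_gt0.
  move=> [z t] /= [xz td] y yz.
  have {}xz : `|z - x| < d / 2 by rewrite distrC.
  have : `|y - x| < d.
    have -> : y - x = (y - z) + (z - x) by ring.
    by rewrite (le_lt_trans (ler_normD _ _)) //; lra.
  move=> /(Hd _ I) h1; have /(Hd _ I) h2 : `|z - x| < d by lra.
  have -> : f y - f z = (f y - f x) - (f z - f x) by ring.
  by rewrite (le_lt_trans (ler_normB _ _)) //; lra.
move=> d /= d0 Hd; exists (d / 2); first by rewrite divr_gt0.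
move=> x y xab yx; apply: (Hd (d / 2)) => //=.
- by rewrite sub0r normrN gtr0_norm; lra.
- by lra.
Qed.

Section Diffeo.
Variables (F F' : R -> R).
Hypothesis dF : circle_diffeo F F'.

Lemma cd_mvt x y : x < y -> exists2 c, x < c < y & F y - F x = F' c * (y - x).
Proof.
move=> xy; apply: mvt => // z _; have [dFz _ _ _] := dF.
by apply: der_atW (dFz z).
Qed.

Lemma cd_lt : {mono F : x y / x < y}.
Proof.
have [_ _ F0 _] := dF.
apply: leW_mono; apply: le_mono => x y xy.
have [c _ e] := cd_mvt xy; rewrite -subr_gt0 e mulr_gt0 // subr_gt0 //.
Qed.

Lemma cd_le : {mono F : x y / x <= y}.
Proof. by apply: le_mono => x y; rewrite cd_lt. Qed.

Lemma cd_inj : injective F.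
Proof. exact: inc_inj cd_le. Qed.

Lemma cd_int (k : int) x : F (x + k%:~R) = F x + k%:~R.
Proof.
have [_ _ _ F1] := dF.
have Fn (n : nat) z : F (z + n%:R) = F z + n%:R.
  elim: n z => [|n IH] z; first by rewrite !addr0.
  by rewrite -natr1 !addrA F1 IH.
case: k => n; first exact: Fn.
rewrite NegzE rmorphN /=; apply: (addIr n.+1%:R).
by rewrite -Fn !subrK.
Qed.

Lemma cd_per x : F' (x + 1) = F' x.
Proof.
have [dFx _ _ F1] := dF.
have h1 : der_at setT (F \o (fun y => y + 1)) x (F' (x + 1) * 1).
  apply: (der_comp (J := setT)) => //; exact: der_shift.
have h2 : der_at setT (F \o (fun y => y + 1)) x (1 * F' x).
  have -> : F \o (fun y => y + 1) = (fun y => y + 1) \o F.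
    by apply/funext => y /=; rewrite F1.
  apply: (der_comp (J := setT)) => //; exact: der_shift.
have := der_is_derive h1; have := der_is_derive h2.
rewrite mulr1 mul1r => -[_ <-] [_ <-] //.
Qed.

Lemma cd_cont I x : cont_at I F x.
Proof.
have [dFx _ _ _] := dF; apply: der_cont (F' x) _.
exact: der_atW (dFx x).
Qed.

(** The derivative is 1-periodic, so uniform continuity on [[0, 1]] gives it on the line. *)
Lemma cd_unif e : 0 < e -> exists2 d, 0 < d &
  forall x y, `|x - y| < d -> `|ln (F' x) - ln (F' y)| < e.
Proof.
move=> e0; have [_ cF' F'0 _] := dF.
have cl x : cont_at setT (@ln R \o F') x.
  apply: (@cont_comp _ _ setT) => //.
  move=> e' e'0; have := @continuous_ln R (F' x) (F'0 x).
  move/cvgrPdist_lt => /(_ _ e'0) /nbhs_ballP[d /= d0 Hd].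
  by exists d => // y _ yd; rewrite distrC; apply: Hd; rewrite /ball /= distrC.
have [d d0 Hd] := cont_unif 0 1 cl e0; exists d => // x y xy.
have per (k : int) z : F' (z + k%:~R) = F' z.
  have pern (n : nat) w : F' (w + n%:R) = F' w.
    by elim: n w => [|n IH] w; rewrite ?addr0 // -natr1 addrA cd_per.
  case: k => n; first exact: pern.
  by rewrite NegzE rmorphN /= -(pern n.+1) subrK.
have := Hd (y - (Num.floor y)%:~R) (x - (Num.floor y)%:~R).
have -> : x - (Num.floor y)%:~R - (y - (Num.floor y)%:~R) = x - y by ring.
rewrite /= -!rmorphN !per; apply => //.
have := floor_le y; have := floorD1_gt y; rewrite rmorphN intrD; lra.
Qed.

End Diffeo.
End Circle.

(** * Bounded distortion and Kopell's lemma *)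

Section Kopell.
Variable R : realType.
Implicit Types (f g F G P : R -> R) (x y p q : R).

Lemma cont_atP f x : cont_at setT f x <-> {for x, continuous f}.
Proof.
split=> [fx|/cvgrPdist_lt fx e /fx /nbhs_ballP[d /= d0 Hd]].
  apply/cvgrPdist_lt => e /fx[d d0 Hd]; apply/nbhs_ballP; exists d => //= y yd.
  by rewrite distrC; apply: Hd => //; rewrite distrC.
by exists d => // y _ yd; rewrite distrC; apply: Hd; rewrite /ball /= distrC.
Qed.

Lemma circle_diffeo_comp F F' G G' : circle_diffeo F F' -> circle_diffeo G G' ->
  circle_diffeo (F \o G) (fun x => F' (G x) * G' x).
Proof.
move=> dF dG; have [Fd Fc F0 F1] := dF; have [Gd Gc G0 G1] := dG; split=> x.
- by apply: (@der_comp _ _ setT) => //.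
- apply/cont_atP; apply: continuousM; last exact/cont_atP.
  by apply/cont_atP; apply: (@cont_comp _ _ setT) => //; exact: cd_cont dG _ _.
- by rewrite mulr_gt0.
- by rewrite /= G1 F1.
Qed.

Lemma circle_diffeo_iter F F' n : circle_diffeo F F' ->
  circle_diffeo (iter n F) (fun x => \prod_(i < n) F' (iter i F x)).
Proof.
move=> dF; elim: n => [|n IH].
  split=> x /=; rewrite ?big_ord0 //; first exact: der_id.
  by move=> e e0; exists 1 => // y _ _; rewrite !big_ord0 subrr normr0.
have := circle_diffeo_comp dF IH; congr circle_diffeo.
by apply/funext => x; rewrite big_ord_recr mulrC.
Qed.

Lemma der_unique f x l m : der_at setT f x l -> der_at setT f x m -> l = m.
Proof. by move=> /der_is_derive[_ <-] /der_is_derive[_ <-]. Qed.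

Lemma iter_commute f g : (forall x, f (g x) = g (f x)) ->
  forall n m x, iter n f (iter m g x) = iter m g (iter n f x).
Proof.
move=> fg n m x; elim: n => // n /= ->; elim: m => //= m IH.
by rewrite fg IH.
Qed.

Section Disjoint.
Variables (f f' : R -> R) (p q : R).
Hypotheses (df : circle_diffeo f f') (pq : p < q) (qp : q <= p + 1).
(** The translations by [k] express disjointness on the circle: up to its end points, [[p, q]] is a
    wandering arc of [f]. *)
Hypothesis dis : forall n m (k : int), (n < m)%N ->
  iter n f q <= iter m f p + k%:~R \/ iter m f q + k%:~R <= iter n f p.

Let fn n := circle_diffeo_iter n df.

(** Subtracting the integer part of its left end puts each arc into [[0, 2]]. The translated arcs
    still do not overlap, so the increments of [P] over them add up to at most its increment over
    [[0, 2]]. *)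
Lemma disjoint_increments P n : {homo P : x y / x <= y} ->
  \sum_(i < n) (P (iter i f q - (Num.floor (iter i f p))%:~R) -
                P (iter i f p - (Num.floor (iter i f p))%:~R)) <= P 2 - P 0.
Proof.
move=> Pm; rewrite -(big_mkord xpredT (fun i =>
  P (iter i f q - (Num.floor (iter i f p))%:~R) -
  P (iter i f p - (Num.floor (iter i f p))%:~R))).
apply: (sum_increments (u := fun i => iter i f p - (Num.floor (iter i f p))%:~R)
   (v := fun i => iter i f q - (Num.floor (iter i f p))%:~R)) => //.
- exact: iota_uniq.
- move=> i _; have := floor_le (iter i f p).
  have := floorD1_gt (iter i f p); rewrite intrD => h1 h2.
  have h3 : iter i f p < iter i f q by rewrite (cd_lt (fn i)).
  have h4 : iter i f q <= iter i f p + 1.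
    by have [_ _ _ <-] := fn i; rewrite (cd_le (fn i)).
  by split; lra.
have D (i j : nat) : (i < j)%N ->
    iter i f q - (Num.floor (iter i f p))%:~R <=
      iter j f p - (Num.floor (iter j f p))%:~R \/
    iter j f q - (Num.floor (iter j f p))%:~R <=
      iter i f p - (Num.floor (iter i f p))%:~R.
  move=> ij; have := dis (Num.floor (iter i f p) - Num.floor (iter j f p)) ij.
  by rewrite rmorphB /= => -[h|h]; [left|right]; lra.
move=> i j _ _; rewrite neq_lt => /orP[] /D //.
by case=> h; [right|left].
Qed.

(** For [P := id] the lengths of the arcs sum to at most 2. *)
Lemma disjoint_small e : 0 < e -> exists n, iter n f q - iter n f p < e.
Proof.
move=> e0; apply: contrapT => /forallNP H.
have H' n : e <= iter n f q - iter n f p by rewrite leNgt; apply/negP/H.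
pose n := (Num.truncn (2 / e)).+1.
have := @disjoint_increments id n (fun _ _ => id); rewrite subr0 leNgt => /negP.
apply; apply: (@lt_le_trans _ _ (n%:R * e)).
  by rewrite -ltr_pdivrMr // truncnS_gt.
rewrite -[n in n%:R]card_ord mulr_natl -sumr_const ler_sum // => i _ /=.
by have := H' i; lra.
Qed.

(** On each arc the oscillation of [ln f'] is at most the increment of [P] plus that of [N], and
    both are summable over the arcs, uniformly in [n]. *)
Lemma disjoint_var : dmono 0 2 (@ln R \o f') ->
  exists V, forall n x y, p <= x <= q -> p <= y <= q ->
  `|\sum_(i < n) (ln (f' (iter i f x)) - ln (f' (iter i f y)))| <= V.
Proof.
move=> [P [N [Pm Nm PN]]]; exists ((P 2 - P 0) + (N 2 - N 0)).
move=> n x y /andP[px xq] /andP[py yq].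
have := lerD (disjoint_increments n Pm) (disjoint_increments n Nm).
rewrite -big_split /=; apply: le_trans.
apply: (le_trans (ler_norm_sum _ _ _)); apply: ler_sum => i _.
have per (k : int) z : f' (z - k%:~R) = f' z.
  have pern (m : nat) w : f' (w + m%:R) = f' w.
    by elim: m w => [|m IH] w; rewrite ?addr0 // -natr1 addrA (cd_per df).
  case: k => m; first by rewrite -(pern m) subrK.
  by rewrite NegzE rmorphN /= opprK pern.
set k := Num.floor _.
have b z : p <= z -> z <= q ->
    iter i f p - k%:~R <= iter i f z - k%:~R <= iter i f q - k%:~R.
  by move=> pz zq; rewrite !lerD2r !(cd_le (fn i)) pz.
have /andP[b0 b2] : (0 <= iter i f p - k%:~R) && (iter i f q - k%:~R <= 2).
  have := floor_le (iter i f p); have := floorD1_gt (iter i f p).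
  rewrite intrD -/k => h1 h2.
  have h4 : iter i f q <= iter i f p + 1.
    by have [_ _ _ <-] := fn i; rewrite (cd_le (fn i)).
  lra.
have /andP[x1 x2] := b _ px xq; have /andP[y1 y2] := b _ py yq.
rewrite -(per k (iter i f x)) -(per k (iter i f y)).
have /= -> := PN (iter i f x - k%:~R); last by lra.
have /= -> := PN (iter i f y - k%:~R); last by lra.
have := Pm _ _ x1; have := Pm _ _ x2; have := Pm _ _ y1; have := Pm _ _ y2.
have := Nm _ _ x1; have := Nm _ _ x2; have := Nm _ _ y1; have := Nm _ _ y2.
move=> *; rewrite ler_norml; lra.
Qed.

(* Kopell's argument: since [f^n] contracts the interval, the derivative of
   [g^k] at [f^n x] is close to 1, so up to the bounded distortion of [f^n] the
   derivative of [g^k] at [x] stays bounded below, uniformly in [k]. *)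
Lemma kopell g g' : dmono 0 2 (@ln R \o f') -> circle_diffeo g g' ->
  (forall x, f (g x) = g (f x)) -> g p = p -> g q = q ->
  forall x, p <= x <= q -> g x = x.
Proof.
move=> f'v dg fg gp gq; have [V HV] := disjoint_var f'v.
have gn k := circle_diffeo_iter k dg.
set Gd := fun k x => \prod_(i < k) g' (iter i g x).
have fixn z k : g z = z -> iter k g z = z by move=> gz; elim: k => //= k ->.
have gin k x : p <= x <= q -> p <= iter k g x <= q.
  by rewrite -{2}(fixn p k gp) -{2}(fixn q k gq) !(cd_le (gn k)).
have low k x : p <= x <= q -> - (V + 1) <= ln (Gd k x).
  move=> xpq; have [d d0 Hd] := cd_unif (gn k) ltr01.
  have [n Hn] := disjoint_small d0.
  have npq : iter n f p < iter n f q by rewrite (cd_lt (fn n)).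
  (* [g^k] fixes both ends of [f^n [p, q]], so its derivative is 1 somewhere inside; by uniform
     continuity it is close to 1 on the whole of this short interval. *)
  have [c /andP[c1 c2]] := cd_mvt (gn k) npq.
  rewrite -!(iter_commute fg) !fixn // => /esym/eqP.
  rewrite -subr_eq0 -[X in _ - X]mul1r -mulrBl mulf_eq0 !subr_eq0.
  rewrite (gt_eqF npq) orbF => /eqP c'1.
  have xn : iter n f p <= iter n f x <= iter n f q.
    by rewrite !(cd_le (fn n)).
  have := Hd (iter n f x) c; rewrite c'1 ln1 subr0 => /(_ _)/wrap[].
    by rewrite ltr_norml; move: xn => /andP[]; lra.
  have [_ _ f'0 _] := df; have [_ _ g'0 _] := dg.
  have Gd0 z : 0 < Gd k z by apply: prodr_gt0.
  (* The chain rule on both sides of [g^k f^n = f^n g^k]. *)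
  have e : Gd k (iter n f x) * \prod_(i < n) f' (iter i f x) =
           \prod_(i < n) f' (iter i f (iter k g x)) * Gd k x.
    have [h1 _ _ _] := circle_diffeo_comp (gn k) (fn n).
    have [h2 _ _ _] := circle_diffeo_comp (fn n) (gn k).
    apply: der_unique (h1 x) _; have := h2 x; congr der_at.
    by apply/funext => z /=; rewrite iter_commute.
  have {e} := congr1 (@ln R) e.
  rewrite !lnM ?posrE ?prodr_gt0 // => e.
  have lnp z : ln (\prod_(i < n) f' (iter i f z)) =
      \sum_(i < n) ln (f' (iter i f z)).
    elim: (n) => [|m IH]; first by rewrite !big_ord0 ln1.
    by rewrite !big_ord_recr /= lnM ?IH // posrE ?prodr_gt0.
  rewrite !lnp in e; have := HV n _ _ xpq (gin k x xpq).
  rewrite sumrB ler_norml ltr_norml -/(Gd k _); lra.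
have Gdlow k x : p <= x <= q -> expR (- (V + 1)) <= Gd k x.
  move=> /(low k) h; have [_ _ g'0 _] := dg.
  by rewrite -(@lnK _ (Gd k x)) ?posrE ?prodr_gt0 // ler_expR.
set m := expR _ in Gdlow; have m0 : 0 < m := expR_gt0 _.
(* The lower bound on the derivatives of all [g^k] keeps every displacement of the monotone orbit of
   [x] above one positive constant, so the orbit would leave [[p, q]]. *)
have step x k : p <= x <= q -> g x != x ->
    m * `|g x - x| <= `|iter k.+1 g x - iter k g x|.
  move=> xpq; rewrite iterSr neq_lt.
  have gx : p <= g x <= q by exact: (gin 1%N).
  case/orP => h.
    have [c cx e] := cd_mvt (gn k) h; have cpq : p <= c <= q by lra.
    rewrite distrC [leRHS]distrC e normrM ler_wpM2r //.
    by rewrite (le_trans (Gdlow k c cpq)) // ler_norm.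
  have [c cx e] := cd_mvt (gn k) h; have cpq : p <= c <= q by lra.
  rewrite e normrM ler_wpM2r //.
  by rewrite (le_trans (Gdlow k c cpq)) // ler_norm.
move=> x xpq; apply/eqP; apply: contrapT => /negP gx.
pose u := m * `|g x - x|; pose K := (Num.truncn ((q - p) / u)).+1.
have big0 : 0 < u by rewrite mulr_gt0 // normr_gt0 subr_eq0.
have {}step k : u <= `|iter k.+1 g x - iter k g x| := step x k xpq gx.
have tot : K%:R * u <= `|iter K g x - x|.
  move: gx; rewrite neq_lt => /orP[] h.
    have dec k : iter k.+1 g x < iter k g x by rewrite iterSr (cd_lt (gn k)).
    rewrite [leRHS]distrC ger0_norm; last first.
      by rewrite subr_ge0; elim: (K) => // k IH; exact: le_trans (ltW (dec k)) IH.
    elim: (K) => [|k IH]; first by rewrite mul0r subrr.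
    have := step k; rewrite [leRHS]distrC gtr0_norm ?subr_gt0 //.
    by rewrite -natr1 mulrDl mul1r; lra.
  have inc k : iter k g x < iter k.+1 g x by rewrite iterSr (cd_lt (gn k)).
  rewrite ger0_norm; last first.
    by rewrite subr_ge0; elim: (K) => // k IH; exact: le_trans IH (ltW (inc k)).
  elim: (K) => [|k IH]; first by rewrite mul0r subrr.
  have := step k; rewrite gtr0_norm ?subr_gt0 //.
  by rewrite -natr1 mulrDl mul1r; lra.
have : q - p < K%:R * u by rewrite -ltr_pdivrMr // truncnS_gt.
have := gin K x xpq; move: tot; rewrite ler_normr => /orP[]; lra.
Qed.

End Disjoint.
End Kopell.

(** * Hoelder's theorem *)

Section FreeAction.
Variables (R : realType) (X : set R) (S : set (R -> R)).
Hypothesis X_itv : forall x y z, X x -> X y -> x <= z <= y -> X z.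
Hypothesis S_lt : forall f, S f -> {mono f : x y / x < y}.
Hypothesis S_cont : forall f x, S f -> cont_at setT f x.
Hypothesis S_X : forall f x, S f -> X x -> X (f x).
Hypothesis S_comp : forall f g, S f -> S g -> S (f \o g).
Hypothesis S_inv : forall f, S f ->
  exists g, [/\ S g, cancel f g & cancel g f].
Hypothesis S_free : forall f z, S f -> X z -> f z = z ->
  forall w, X w -> f w = w.
Implicit Types (f g h : R -> R).

Let S_le f (Sf : S f) : {mono f : x y / x <= y}.
Proof. by apply: le_mono => x y; rewrite S_lt. Qed.

Let S_iter f n : S f -> S (iter n.+1 f).
Proof. by move=> Sf; elim: n => [|n IH] //; exact: S_comp Sf IH. Qed.

Let fix_between f x y : S f -> x <= y ->
  (x <= f x /\ f y <= y) \/ (f x <= x /\ y <= f y) ->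
  exists2 z, x <= z <= y & f z = z.
Proof.
move=> Sf xy.
have cB s z : cont_at `[x, y] (fun t => s * (f t - t)) z.
  apply: (@cont_atW _ setT) => //; apply/cont_atP; apply: continuousM.
    exact: cst_continuous.
  apply: continuousB; last exact: cvg_id.
  by apply/cont_atP; exact: S_cont.
case=> -[h1 h2].
  have [||c cxy] := @ivt _ (fun t => -1 * (f t - t)) x y 0 xy.
  - by move=> z _; exact: cB.
  - by lra.
  - by exists c => //; lra.
have [||c cxy] := @ivt _ (fun t => 1 * (f t - t)) x y 0 xy.
- by move=> z _; exact: cB.
- by lra.
- by exists c => //; lra.
Qed.

(** An element that moves one point to the right and another point not to the right has a fixed
    point between them, and freeness makes it trivial on [X]. Hence comparing values at a single
    point orders the restrictions of [S] to [X]. *)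
Let sgn f x w : S f -> X x -> X w -> x < f x -> w < f w.
Proof.
move=> Sf Xx Xw xf; rewrite ltNge; apply/negP => fw.
have [z Xz fz] : exists2 z, X z & f z = z.
  have [xw|/ltW wx] := leP x w.
    have [|z xz fz] := fix_between Sf xw.
      by left; rewrite ltW.
    by exists z => //; exact: X_itv xz.
  have [|z xz fz] := fix_between Sf wx.
    by right; split=> //; exact: ltW.
  by exists z => //; exact: X_itv xz.
by move: xf; rewrite (S_free Sf Xz fz Xx) ltxx.
Qed.

Let cmp f g x w : S f -> S g -> X x -> X w -> f x < g x -> f w < g w.
Proof.
move=> Sf Sg Xx Xw fg; have [f' [Sf' fK f'K]] := S_inv Sf.
rewrite -[g w]f'K S_lt //; apply: (@sgn (f' \o g) x) => //; first exact: S_comp.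
by rewrite /= -(S_lt Sf) f'K.
Qed.

Let cmp_le f g x w : S f -> S g -> X x -> X w -> f x <= g x -> f w <= g w.
Proof.
move=> Sf Sg Xx Xw; rewrite !leNgt; apply: contra; exact: cmp.
Qed.

Let arch h x y : S h -> X x -> X y -> x < h x ->
  exists n, y < iter n h x.
Proof.
move=> Sh Xx Xy xh; apply: contrapT => /forallNP H.
have {}H n : iter n h x <= y by rewrite leNgt; apply/negP/H.
pose E := range (fun n => iter n h x).
have supE : has_sup E.
  by split; [exists x, 0%N|exists y => _ [n _ <-]; exact: H].
have xs : x <= sup E by apply: sup_upper_bound => //; exists 0%N.
have sy : sup E <= y by apply: ge_sup; [exists x, 0%N|move=> _ [n _ <-]].
have Xs : X (sup E) by apply: X_itv Xx Xy _; rewrite xs.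
have [h' [Sh' hK h'K]] := S_inv Sh.
have := sgn Sh Xx Xs xh; rewrite -(S_lt Sh') hK -subr_gt0 => s0.
have [_ [n _ <-]] := sup_adherent s0 supE.
rewrite opprB addrC subrK -(S_lt Sh) h'K ltNge => /negP; apply.
by apply: sup_upper_bound => //; exists n.+1.
Qed.

Let id_S f : S f -> S id.
Proof.
move=> Sf; have [g [Sg fK gK]] := S_inv Sf.
by rewrite -(_ : g \o f = id); [exact: S_comp|apply/funext => x; exact: fK].
Qed.

Let S_iter0 f n : S f -> S (iter n f).
Proof. by case: n => [/id_S//|n]; exact: S_iter. Qed.

Let floor h f x : S h -> S f -> X x -> x < h x -> x <= f x -> exists n,
  forall w, X w -> iter n h w <= f w < iter n.+1 h w.
Proof.
move=> Sh Sf Xx xh xf; have [m Hm] := arch Sh Xx (S_X Sf Xx) xh.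
have ex : exists n, f x < iter n h x by exists m.
have := ex_minnP ex; case=> -[|n] hn nmin; first by move: hn => /=; lra.
exists n => w Xw; apply/andP; split.
  apply: (cmp_le (S_iter0 n Sh) Sf Xx Xw).
  by rewrite leNgt; apply/negP => /nmin; rewrite ltnn.
exact: (cmp Sf (S_iter n Sh) Xx Xw).
Qed.

(** The commutator [c] with [g f = c f g] would be positive, and comparing [f] and [g] with the
    powers of any positive [h] gives [c < h h]. Then no positive [u] lies below [c]: otherwise
    [v = u^-1 c] is positive, [v < u] because [c < u u], and [c < v v <= u v = c]. So [c] is a least
    positive element; all positive elements are powers of it and commute. *)
Let pos_commute f g x : S f -> S g -> X x -> x <= f x -> x <= g x ->
  f (g x) < g (f x) -> False.
Proof.
move=> Sf Sg Xx xf xg fg.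
have [f' [Sf' fK f'K]] := S_inv Sf; have [g' [Sg' gK g'K]] := S_inv Sg.
pose c := g \o f \o g' \o f'.
have Sc : S c by rewrite /c; do 3![apply: S_comp => //].
have cE w : c (f (g w)) = g (f w) by rewrite /c /= fK gK.
have c0 w : X w -> w < c w.
  move=> Xw; apply: (sgn (x := f (g x))) => //; last by rewrite cE.
  by do 2![apply: S_X => //].
(* From [h^m <= f < h^(m+1)] and [h^n <= g < h^(n+1)] one gets [g f < h^(m+n+2)], while
   [f g >= h^(m+n)]. *)
have A h w : S h -> X w -> w < h w -> c w < h (h w).
  move=> Sh Xw wh.
  have h0 z : X z -> z < h z by move=> Xz; exact: sgn wh.
  have [m Hm] := floor Sh Sf Xx (h0 _ Xx) xf.
  have [n Hn] := floor Sh Sg Xx (h0 _ Xx) xg.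
  rewrite -(f'K w) -(g'K (f' w)) cE; set z := g' (f' w).
  have Xz : X z by do 2![apply: S_X => //].
  have /andP[_ h1] := Hn _ (S_X Sf Xz).
  have /andP[_ h2] := Hm _ Xz.
  have /andP[h3 _] := Hm _ (S_X Sg Xz).
  have /andP[h4 _] := Hn _ Xz.
  apply: lt_le_trans h1 _; rewrite -(S_lt (S_iter n Sh)) in h2.
  apply: (le_trans (ltW h2)); rewrite -iterD.
  rewrite addSn addnS -[iter _ _ _]/(h (h (iter (n + m) h z))) !S_le //.
  by apply: le_trans h3; rewrite addnC iterD S_le //; exact: S_iter0.
have cmin u w : S u -> X w -> w < u w -> c w <= u w.
  move=> Su Xw wu; rewrite leNgt; apply/negP => uc.
  have [u' [Su' uK u'K]] := S_inv Su.
  pose v := u' \o c; have Sv : S v by exact: S_comp.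
  have wv : w < v w by rewrite -(S_lt Su) u'K.
  have := A v w Sv Xw wv; rewrite ltNge => /negP; apply.
  rewrite -(u'K (c w)) -/(v w) /=.
  have : v w < u w by rewrite -(S_lt Su) u'K A.
  move/(cmp Sv Su Xw (S_X Sv Xw)); exact: ltW.
have pow h : S h -> x <= h x -> exists n, forall w, X w -> h w = iter n c w.
  move=> Sh xh; have [n Hn] := floor Sc Sh Xx (c0 _ Xx) xh; exists n => w Xw.
  have [k [Sk cK kK]] := S_inv (S_iter0 n Sc).
  have Skh : S (k \o h) by exact: S_comp.
  apply: (can_inj kK); rewrite cK.
  have /andP[h1 h2] := Hn w Xw.
  apply: (S_free Skh Xw) => //; apply/eqP; rewrite eq_le leNgt.
  have h3 : w <= k (h w) by rewrite -(S_le (S_iter0 n Sc)) kK.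
  rewrite [w <= _]h3 andbT; apply/negP => /(cmin _ _ Skh Xw).
  rewrite leNgt => /negP; apply.
  by rewrite /= -(S_lt (S_iter0 n Sc)) kK -iterSr.
have [m Hm] := pow f Sf xf; have [n Hn] := pow g Sg xg.
move: fg; rewrite (Hm _ (S_X Sg Xx)) (Hn _ (S_X Sf Xx)) (Hm _ Xx) (Hn _ Xx).
by rewrite -!iterD addnC ltxx.
Qed.

Let semi_commute f g x : S f -> S g -> X x -> x <= f x -> x <= g x ->
  f (g x) = g (f x).
Proof.
move=> Sf Sg Xx xf xg; apply/eqP; rewrite eq_le !leNgt.
apply/andP; split; apply/negP => h.
  exact: pos_commute Sg Sf Xx xg xf h.
exact: pos_commute Sf Sg Xx xf xg h.
Qed.

Lemma free_action_abelian f g x : S f -> S g -> X x -> f (g x) = g (f x).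
Proof.
move=> Sf Sg Xx.
have [f' [Sf' fK f'K]] := S_inv Sf; have [g' [Sg' gK g'K]] := S_inv Sg.
have inv h h' y : S h -> S h' -> cancel h h' -> h y <= y -> X y -> h' y >= y.
  by move=> Sh Sh' hK hy Xy; rewrite -[in leLHS](hK y) S_le.
have pos k h : S k -> S h -> x <= k x -> x <= h x ->
    forall z, X z -> k (h z) = h (k z).
  move=> Sk Sh xk xh z Xz; apply: (semi_commute Sk Sh Xz).
    exact: (cmp_le (id_S Sk) Sk Xx Xz xk).
  exact: (cmp_le (id_S Sk) Sh Xx Xz xh).
have half k : S k -> x <= k x -> forall z, X z -> f (k z) = k (f z).
  move=> Sk xk z Xz; have [xf|/ltW fx] := leP x (f x).
    exact: (pos f k Sf Sk xf xk z Xz).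
  have xf' := inv f f' x Sf Sf' fK fx Xx.
  by rewrite -[in LHS](fK z) -(pos _ _ Sf' Sk xf' xk) ?f'K //; exact: S_X.
have [xg|/ltW gx] := leP x (g x).
  exact: (half g Sg xg x Xx).
have xg' := inv g g' x Sg Sg' gK gx Xx.
by rewrite -[in RHS](gK x) (half _ Sg' xg') ?g'K //; exact: S_X.
Qed.

End FreeAction.

(** * Components of supports *)

Section Components.
Variable R : realType.
Implicit Types (f g F G : R -> R) (x y z p q : R).

Definition component G p q : Prop :=
  [/\ G p = p, G q = q, p < q & forall z, p < z < q -> G z <> z].

Lemma fix_open G x : cont_at setT G x -> G x <> x ->
  exists2 d, 0 < d & forall y, `|y - x| < d -> G y <> y.
Proof.
move=> Gc Gx; have e0 : 0 < `|G x - x| / 2.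
  by rewrite divr_gt0 // normr_gt0 subr_eq0; exact/eqP.
have [d d0 Hd] := Gc _ e0; exists (Num.min d (`|G x - x| / 2)).
  by rewrite lt_min d0.
move=> y; rewrite lt_min => /andP[yd ye] Gy.
have := Hd y I yd; rewrite Gy => h.
have : `|G x - x| < `|G x - x|; last by rewrite ltxx.
have {1}-> : G x - x = (y - x) - (y - G x) by ring.
by rewrite (le_lt_trans (ler_normB _ _)) //; lra.
Qed.

Section OneMap.
Variables (G G' : R -> R).
Hypothesis dG : circle_diffeo G G'.

Lemma int_above x z : exists k : int, x < z + k%:~R.
Proof.
by exists (Num.floor (x - z) + 1); have := floorD1_gt (x - z); lra.
Qed.

Lemma left_fix z0 x : G z0 = z0 -> exists p,
  [/\ p <= x, G p = p & forall z, p < z <= x -> G z <> z].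
Proof.
move=> Gz0; pose E := [set z | z <= x /\ G z = z].
have supE : has_sup E.
  split; last by exists x => z [].
  have [k hk] := int_above (- x) (- z0); exists (z0 + (- k)%:~R); split.
    by rewrite rmorphN /=; lra.
  by rewrite (cd_int dG) Gz0.
have sx : sup E <= x by apply: ge_sup; [case: supE|move=> z []].
exists (sup E); split=> //.
  apply: contrapT => Gs.
  have [d d0 Hd] := fix_open (cd_cont dG _ _) Gs.
  have [z [zx Gz] zs] := sup_adherent d0 supE; apply: (Hd z) => //.
  have : z <= sup E by apply: sup_upper_bound.
  by move=> zE; rewrite ltr_norml; lra.
move=> z /andP[sz zx] Gz; have : z <= sup E by apply: sup_upper_bound.
lra.
Qed.

Lemma right_fix z0 x : G z0 = z0 -> exists q,
  [/\ x <= q, G q = q & forall z, x <= z < q -> G z <> z].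
Proof.
move=> Gz0; pose E := [set z | x <= z /\ G z = z].
have infE : has_inf E.
  split; last by exists x => z [].
  have [k hk] := int_above x z0; exists (z0 + k%:~R); split; first exact: ltW.
  by rewrite (cd_int dG) Gz0.
have sx : x <= inf E by apply: lb_le_inf; [case: infE|move=> z []].
exists (inf E); split=> //.
  apply: contrapT => Gs.
  have [d d0 Hd] := fix_open (cd_cont dG _ _) Gs.
  have [z [zx Gz] zs] := inf_adherent d0 infE; apply: (Hd z) => //.
  have : inf E <= z by apply: ge_inf => //; case: infE.
  by move=> zE; rewrite ltr_norml; lra.
move=> z /andP[sz zx] Gz.
have : inf E <= z by apply: ge_inf => //; case: infE.
lra.
Qed.

Lemma component_ex z0 x : G z0 = z0 -> G x <> x ->
  exists p q, [/\ component G p q, p < x < q & q <= p + 1].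
Proof.
move=> Gz0 Gx; have [p [px Gp Hp]] := left_fix x Gz0.
have [q [xq Gq Hq]] := right_fix x Gz0; exists p, q.
have {}px : p < x.
  by rewrite lt_neqAle px andbT; apply/eqP => e; apply: Gx; rewrite -e.
have {}xq : x < q.
  by rewrite lt_neqAle xq andbT; apply/eqP => e; apply: Gx; rewrite e.
split; [split=> //; first lra| by rewrite px|].
  move=> z /andP[pz zq]; have [zx|xz] := leP z x; first by apply: Hp; rewrite pz.
  by apply: Hq; rewrite zq ltW.
have Gp1 : G (p + 1) = p + 1 by have [_ _ _ ->] := dG; rewrite Gp.
rewrite leNgt; apply/negP => pq.
have [h|h] := leP (p + 1) x; first by apply: (Hp (p + 1)) => //; lra.
by apply: (Hq (p + 1)) => //; lra.
Qed.

(** The translates of the fixed point [z] are fixed and trap [x] in an interval of length 1. For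
    this reason, an integer by which such a map shifts some point must vanish. *)
Lemma displacement z x : G z = z -> x - 1 < G x < x + 1.
Proof.
move=> Gz; set k := Num.floor (x - z).
have := floor_le (x - z); have := floorD1_gt (x - z).
rewrite -/k intrD => h1 h2.
have : z + k%:~R <= x by lra.
rewrite -(cd_le dG) (cd_int dG) Gz => h3.
have : x < z + (k + 1)%:~R by rewrite intrD; lra.
rewrite -(cd_lt dG) (cd_int dG) Gz intrD => h4; lra.
Qed.

Lemma iter_fix n p : (0 < n)%N -> iter n G p = p -> G p = p.
Proof.
case: n => // n _; have [h|h|//] := ltgtP (G p) p => e.
  suff: iter n.+1 G p < p by rewrite e ltxx.
  elim: n {e} => // n IH; rewrite (lt_trans _ h) // -[iter _ _ _]/(G (iter n.+1 G p)).
  by rewrite (cd_lt dG).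
suff: p < iter n.+1 G p by rewrite e ltxx.
elim: n {e} => // n IH; rewrite (lt_trans h) // -[iter _ _ _]/(G (iter n.+1 G p)).
by rewrite (cd_lt dG).
Qed.

Lemma component_shift p q (k : int) :
  component G p q -> component G (p + k%:~R) (q + k%:~R).
Proof.
move=> [Gp Gq pq H]; split; rewrite ?(cd_int dG) ?Gp ?Gq ?ltrD2r //.
move=> z zpq Gz; apply: (H (z + (- k)%:~R)); first by rewrite rmorphN /=; lra.
by rewrite (cd_int dG) Gz.
Qed.

End OneMap.

Lemma component_eq G p q p' q' z : component G p q -> component G p' q' ->
  p < z < q -> p' < z < q' -> p = p' /\ q = q'.
Proof.
move=> [Gp Gq pq H] [Gp' Gq' pq' H'] z1 z2; split.
  have [h|h|//] := ltgtP p p'.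
    by case: (H p') => //; lra.
  by case: (H' p) => //; lra.
have [h|h|//] := ltgtP q q'.
  by case: (H' q) => //; lra.
by case: (H q') => //; lra.
Qed.

Lemma component_map f f' fi G p q : circle_diffeo f f' -> cancel f fi ->
  cancel fi f -> (forall x, f (G x) = G (f x)) ->
  component G p q -> component G (f p) (f q).
Proof.
move=> df fK fiK fG [Gp Gq pq H]; split; rewrite -?fG ?Gp ?Gq ?(cd_lt df) //.
move=> z zpq Gz; apply: (H (fi z)).
  by move: zpq; rewrite -{1 2}(fiK z) !(cd_lt df).
by apply: (can_inj fK); rewrite fG fiK.
Qed.

Lemma component_iter f f' fi G p q n : circle_diffeo f f' -> cancel f fi ->
  cancel fi f -> (forall x, f (G x) = G (f x)) ->
  component G p q -> component G (iter n f p) (iter n f q).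
Proof.
move=> df fK fiK fG H; elim: n => //= n IH.
exact: component_map df fK fiK fG IH.
Qed.

(** If the images of the component [(p, q)] of [g] under the powers of [f] were disjoint on the
    circle, Kopell's lemma would make [g] trivial on it. So two images meet up to an integer, and
    components that meet coincide. *)
Lemma component_periodic f f' fi g g' p q : circle_diffeo f f' ->
  dmono 0 2 (@ln R \o f') -> cancel f fi -> cancel fi f ->
  circle_diffeo g g' -> (forall x, f (g x) = g (f x)) ->
  component g p q -> q <= p + 1 ->
  exists n (k : int),
    [/\ (0 < n)%N, iter n f p = p + k%:~R & iter n f q = q + k%:~R].
Proof.
move=> df f'v fK fiK dg fg cpq qp1; apply: contrapT => H.
have [gp gq pq no] := cpq; apply: (no ((p + q) / 2)); first lra.
apply: (kopell df pq qp1 _ f'v dg fg gp gq); last lra.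
move=> n m k nm.
have cn := component_iter n df fK fiK fg cpq.
have cm := component_shift dg k (component_iter m df fK fiK fg cpq).
have [?|h1] := leP (iter n f q) (iter m f p + k%:~R); first by left.
have [?|h2] := leP (iter m f q + k%:~R) (iter n f p); first by right.
case: H; have [_ _ c1 _] := cn; have [_ _ c2 _] := cm.
pose a := Num.max (iter n f p) (iter m f p + k%:~R).
pose b := Num.min (iter n f q) (iter m f q + k%:~R).
have ab : a < b by rewrite /a /b lt_min !gt_max c1 c2 h1 h2.
have a1 : iter n f p <= a by rewrite /a le_max lexx.
have a2 : iter m f p + k%:~R <= a by rewrite /a le_max lexx orbT.
have b1 : b <= iter n f q by rewrite /b ge_min lexx.
have b2 : b <= iter m f q + k%:~R by rewrite /b ge_min lexx orbT.
have [||e1 e2] := component_eq (z := (a + b) / 2) cn cm; try lra.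
exists (m - n)%N, (- k); rewrite subn_gt0 nm rmorphN /=.
have dfn := circle_diffeo_iter n df.
split=> //; apply: (cd_inj dfn); rewrite -rmorphN (cd_int dfn) -iterD;
  by rewrite subnKC ?(ltnW nm) // rmorphN /= ?e1 ?e2 addrK.
Qed.

End Components.

(** * Two jumps *)

Section TwoJumps.
Variable R : realType.
Implicit Types (f g F G : R -> R) (x y z p q : R).

Definition near_right p (P : R -> Prop) : Prop :=
  exists2 e, 0 < e & forall x, p <= x < p + e -> P x.

Lemma near_right_and p P Q :
  near_right p P -> near_right p Q -> near_right p (fun x => P x /\ Q x).
Proof.
move=> [e e0 He] [d d0 Hd]; exists (Num.min e d); first by rewrite lt_min e0.
move=> x /andP[px xp].
have h1 : Num.min e d <= e by rewrite ge_min lexx.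
have h2 : Num.min e d <= d by rewrite ge_min lexx orbT.
by split; [apply: He|apply: Hd]; lra.
Qed.

Lemma near_right_comp p F F' P : circle_diffeo F F' -> F p = p ->
  near_right p P -> near_right p (P \o F).
Proof.
move=> dF Fp [e e0 He]; have [d d0 Hd] := cd_cont dF setT p e0.
exists d => // x /andP[px xp]; apply: He.
have xd : `|x - p| < d by rewrite ltr_norml; lra.
have := Hd x I xd; rewrite Fp ltr_norml.
have : F p <= F x by rewrite (cd_le dF).
by rewrite Fp; lra.
Qed.

Lemma near_rightW p (P Q : R -> Prop) : (forall x, P x -> Q x) ->
  near_right p P -> near_right p Q.
Proof. by move=> PQ [e e0 He]; exists e => // x /He /PQ. Qed.

(** The image under [g] of a point moved by [g] is again moved by [g], hence fixed by [f]. *)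
Lemma disjoint_commute f g (D : set R) : injective f -> injective g ->
  (forall x, D x -> D (f x)) -> (forall x, D x -> D (g x)) ->
  (forall x, D x -> f x = x \/ g x = x) ->
  forall x, D x -> f (g x) = g (f x).
Proof.
move=> fI gI fD gD fg x Dx; have [fx|gx] := fg x Dx.
  have [e|e] := fg (g x) (gD _ Dx); first by rewrite e fx.
  by move/gI: e => e; rewrite e fx e.
have [e|e] := fg (f x) (fD _ Dx); last by rewrite e gx.
by move/fI: e => e; rewrite gx e gx.
Qed.

Lemma fixes_der f p l : der_at setT f p l -> f p = p ->
  (forall e, 0 < e -> exists2 x, p < x < p + e & f x = x) -> l = 1.
Proof.
move=> fd fp H; apply/eqP; apply: contrapT => /negP; rewrite -subr_eq0 => l1.
have e0 : 0 < `|l - 1| / 2 by rewrite divr_gt0 // normr_gt0.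
have [d d0 Hd] := fd _ e0; have [x /andP[px xp] fx] := H d d0.
have xp0 : 0 < `|x - p| by rewrite normr_gt0 subr_eq0 gt_eqF.
have xd : `|x - p| < d by rewrite ltr_norml; lra.
have := Hd x I xd; rewrite fx fp.
have -> : x - p - l * (x - p) = - ((l - 1) * (x - p)) by ring.
rewrite normrN normrM ler_pM2r // => h.
have : 0 < `|l - 1| by rewrite normr_gt0.
by lra.
Qed.

(** Say [y < x]. Then [f y < y < x], and both [f] on [[y, x]] and [g] on [[f y, y]] have image
    [[f y, x]]. The two segments together are only as long as this image, so one of them is
    stretched by a factor of at least 2, whereas both derivatives stay below 2 near [p]. *)
Lemma two_jumps f f' g g' p : circle_diffeo f f' -> circle_diffeo g g' ->
  f' p = 1 -> g' p = 1 ->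
  exists2 e, 0 < e & forall x y, p <= x < p + e -> p <= y < p + e ->
    p <= f y < p + e -> f x = x -> g y = x -> g (f y) = f y -> y = x.
Proof.
move=> df dg f1 g1; have [_ fc _ _] := df; have [_ gc _ _] := dg.
have [d1 d10 H1] := fc p 1 ltr01; have [d2 d20 H2] := gc p 1 ltr01.
exists (Num.min d1 d2); first by rewrite lt_min d10.
have lt2 z : p <= z < p + Num.min d1 d2 -> f' z < 2 /\ g' z < 2.
  move=> zp; have [z1 z2] : `|z - p| < d1 /\ `|z - p| < d2.
    by apply/andP; rewrite -lt_min ltr_norml; lra.
  by have := H1 z I z1; have := H2 z I z2; rewrite f1 g1 !ltr_norml; lra.
set e := Num.min _ _ in lt2 *; move=> x y xe ye fye fx gy gs.
have [h|h|//] := ltgtP y x.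
  have sy : f y < y.
    have sx : f y < x by rewrite -fx (cd_lt df).
    rewrite ltNge le_eqVlt; apply/negP => /predU1P[e'|ys].
      by move: gs; rewrite -e' gy => e2; lra.
    by move: ys; rewrite -(cd_lt dg) gs gy; lra.
  have [u u1 u2] := cd_mvt df h; have [v v1 v2] := cd_mvt dg sy.
  have [ua _] := lt2 u ltac:(lra); have [_ vb] := lt2 v ltac:(lra).
  rewrite fx in u2; rewrite gs gy in v2.
  have : f' u * (x - y) < 2 * (x - y) by rewrite ltr_pM2r //; lra.
  have : g' v * (y - f y) < 2 * (y - f y) by rewrite ltr_pM2r //; lra.
  lra.
have sy : y < f y.
  have sx : x < f y by rewrite -fx (cd_lt df).
  rewrite ltNge le_eqVlt; apply/negP => /predU1P[e'|ys].
    by move: gs; rewrite e' gy => e2; lra.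
  by move: ys; rewrite -(cd_lt dg) gs gy; lra.
have [u u1 u2] := cd_mvt df h; have [v v1 v2] := cd_mvt dg sy.
have [ua _] := lt2 u ltac:(lra); have [_ vb] := lt2 v ltac:(lra).
rewrite fx in u2; rewrite gs gy in v2.
have : f' u * (y - x) < 2 * (y - x) by rewrite ltr_pM2r //; lra.
have : g' v * (f y - y) < 2 * (f y - y) by rewrite ltr_pM2r //; lra.
lra.
Qed.

Section Germ.
Variables (a ai b bi c ci d di : R -> R) (p : R).
Variables (ai' b' bi' c' ci' d' di' : R -> R).
Hypotheses (dai : circle_diffeo ai ai').
Hypotheses (db : circle_diffeo b b') (dbi : circle_diffeo bi bi').
Hypotheses (dc : circle_diffeo c c') (dci : circle_diffeo ci ci').
Hypotheses (dd : circle_diffeo d d') (ddi : circle_diffeo di di').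
Hypotheses (aK : cancel a ai) (aiK : cancel ai a).
Hypotheses (bK : cancel b bi) (biK : cancel bi b).
Hypotheses (cK : cancel c ci) (ciK : cancel ci c).
Hypotheses (dK : cancel d di) (diK : cancel di d).
Hypotheses (ap : a p = p) (bp : b p = p) (cp : c p = p) (dp : d p = p).
Hypothesis ab : forall x, a x = x \/ b x = x.
Hypothesis cd : forall x, c x = x \/ d x = x.

(** The commutator of [c] with the conjugate of [d] by [b]. Below, [phii] is its inverse and [psi]
    the commutator of [phi] with [a]. *)
Let phi x := c (b (d (bi (ci (b (di (bi x))))))).
Let phii x := b (d (bi (c (b (di (bi (ci x))))))).

Let phiK : cancel phi phii.
Proof. by move=> x; rewrite /phi /phii !(cK, bK, dK, biK, diK, ciK). Qed.

Let phiiK : cancel phii phi.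
Proof. by move=> x; rewrite /phi /phii !(cK, bK, dK, biK, diK, ciK). Qed.

Let invp f fi : cancel f fi -> f p = p -> fi p = p.
Proof. by move=> fK fp; rewrite -[in LHS]fp fK. Qed.

Let dphii : exists F', circle_diffeo phii F'.
Proof.
eexists; exact: (circle_diffeo_comp db (circle_diffeo_comp dd
  (circle_diffeo_comp dbi (circle_diffeo_comp dc (circle_diffeo_comp db
  (circle_diffeo_comp ddi (circle_diffeo_comp dbi dci))))))).
Qed.

Let phiip : phii p = p.
Proof.
by rewrite /phii (invp cK) // (invp bK) // (invp dK) // bp cp (invp bK) // dp.
Qed.

Let psi x := phi (a (phii (ai x))).

Let near_phi : near_right p (fun x => phi x = x) ->
  near_right p (fun x => psi x = x).
Proof.
move=> H; have := near_right_and H (near_right_comp dai (invp aK ap) H).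
apply: near_rightW => x [e1 /= e2]; rewrite /psi.
by rewrite -[in LHS]e2 phiK aiK.
Qed.

Let cd_comm x : c (d x) = d (c x).
Proof.
by apply: (disjoint_commute (D := setT) (cd_inj dc) (cd_inj dd)).
Qed.

Let dichotomy f : near_right p (fun x => f x = x) \/
  forall e, 0 < e -> exists2 x, p <= x < p + e & f x <> x.
Proof.
have [h|h] := pselect (near_right p (fun x => f x = x)); first by left.
right=> e e0; apply: contrapT => H; apply: h; exists e => // x xe.
by apply: contrapT => fx; apply: H; exists x.
Qed.

Let other_der f g g' : f p = p ->
  (forall e, 0 < e -> exists2 x, p <= x < p + e & f x <> x) ->
  circle_diffeo g g' -> g p = p -> (forall x, f x = x \/ g x = x) -> g' p = 1.
Proof.
move=> fp H [dg _ _ _] gp fg; apply: fixes_der (dg p) gp _ => e e0.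
have [x /andP[px xe] fx] := H e e0; exists x; last by case: (fg x).
rewrite xe andbT lt_neqAle px andbT; apply/eqP => xp; apply: fx.
by rewrite -xp.
Qed.

(** If one of the four germs at [p] is trivial, a commutator collapses. Otherwise points moved by
    [a], [c] and [d] accumulate at [p]; their partners [b], [d] and [c] fix these points, so they
    have derivative 1 at [p] and [two_jumps] applies. It confines the support of [phi] near [p] to
    that of [b], where [a] is trivial. *)
Lemma germ_trivial_right : near_right p (fun x => psi x = x).
Proof.
have cip := invp cK cp; have bip := invp bK bp; have dip := invp dK dp.
have [Ha|Aa] := dichotomy a.
  have [F' dF] := dphii.
  have := near_right_and (near_right_comp dai (invp aK ap) Ha)
    (near_right_comp dai (invp aK ap) (near_right_comp dF phiip Ha)).
  apply: near_rightW => x [/= e1 e2]; rewrite /psi e2.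
  by rewrite aiK in e1; rewrite -e1 phiiK.
have [Hb|Ab] := dichotomy b.
  apply: near_phi.
  have [e e0 He] := near_right_comp ddi dip (near_right_comp dci cip Hb).
  have Hbi : near_right p (fun x => bi x = x).
    by apply: near_rightW Hb => x {1}<-; rewrite bK.
  have H2 := near_right_comp ddi dip Hb.
  have H3 := near_right_comp ddi dip (near_right_comp dci cip Hbi).
  have H4 := near_right_comp ddi dip (near_right_comp dci cip
    (near_right_comp dd dp Hb)).
  have := near_right_and Hbi (near_right_and H2 (near_right_and H3 H4)).
  apply: near_rightW => x [e1 [/= e2 [e3 e4]]]; rewrite /phi e1 e2 e3 e4.
  by rewrite cd_comm ciK diK.
have [Hc|Ac] := dichotomy c.
  apply: near_phi.
  have Hci : near_right p (fun x => ci x = x).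
    by apply: near_rightW Hc => x {1}<-; rewrite cK.
  have dB := circle_diffeo_comp db (circle_diffeo_comp ddi dbi).
  have Bp : (b \o (di \o bi)) p = p by rewrite /= bip dip bp.
  have := near_right_and Hc (near_right_comp dB Bp Hci).
  by apply: near_rightW => x [e1 /= e2]; rewrite /phi e2 bK diK biK.
have [Hd|Ad] := dichotomy d.
  apply: near_phi.
  have Hdi : near_right p (fun x => di x = x).
    by apply: near_rightW Hd => x {1}<-; rewrite dK.
  have := near_right_and (near_right_comp dbi bip Hdi)
    (near_right_comp dci cip (near_right_comp dbi bip Hd)).
  apply: near_rightW => x [/= e1 e2].
  by rewrite /phi e1 biK e2 biK ciK.
have b1 := other_der ap Aa db bp ab.
have bi1 : bi' p = 1.
  apply: other_der ap Aa dbi bip _ => x.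
  by have [?|bx] := ab x; [left|right; rewrite -{1}bx bK].
have d1 := other_der cp Ac dd dp cd.
have c1 : c' p = 1.
  by apply: other_der dp Ad dc cp _ => x; have [] := cd x; [right|left].
have [e e0 He] := two_jumps dbi dc bi1 c1.
have [h h0 Hh] := two_jumps db dd b1 d1.
have near_itv r : 0 < r -> near_right p (fun x => p <= x < p + r).
  by move=> r0; exists r.
(* If [b x = x] and [phi x <> x], the letters of [phi] produce the configuration of [two_jumps] at
   [x]: for [b^-1] and [c] with [y = c^-1 x], or for [b] and [d] with [y = d^-1 x]. *)
have : near_right p (fun x => b x = x -> phi x = x).
  have N1 := near_itv e e0; have N2 := near_right_comp dci cip N1.
  have N3 := near_right_comp dci cip (near_right_comp dbi bip N1).
  have N4 := near_itv h h0; have N5 := near_right_comp ddi dip N4.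
  have N6 := near_right_comp ddi dip (near_right_comp db bp N4).
  have := near_right_and (near_right_and N1 (near_right_and N2 N3))
    (near_right_and N4 (near_right_and N5 N6)).
  apply: near_rightW => x [[n1 [/= n2 n3]] [n4 [n5 n6]]] bx.
  have bix : bi x = x by rewrite -[in LHS]bx bK.
  rewrite /phi bix.
  have [cx|cx] := pselect (c x = x); last first.
    have [//|dx] := cd x; have dix : di x = x by rewrite -[in LHS]dx dK.
    rewrite dix bx.
    have [e1|e1] := cd (bi (ci x)); last by rewrite e1 biK ciK.
    suff e2 : ci x = x by case: cx; rewrite -{1}e2 ciK.
    by apply: He => //; rewrite ?ciK.
  have [e1|e1] := cd (b (di x)).
    have -> : ci (b (di x)) = b (di x) by rewrite -{1}e1 cK.
    by rewrite bK diK bx cx.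
  have e2 : di x = x by apply: Hh => //; rewrite ?diK.
  have cix : ci x = x by rewrite -[in LHS]cx cK.
  by rewrite e2 bx cix bix -{1}e2 diK bx cx.
move=> Hphi; have := near_right_and Hphi (near_right_comp dai (invp aK ap) Hphi).
have [F' dF] := dphii.
have := near_right_comp dai (invp aK ap) (near_right_comp dF phiip Hphi).
move=> N1 N2; have := near_right_and N1 N2.
apply: near_rightW => x [/= e1 [e2 e3]]; rewrite /psi.
have [ax|ax] := pselect (a x = x).
  have -> : ai x = x by rewrite -[in LHS]ax aK.
  have aix : ai x = x by rewrite -[in LHS]ax aK.
  rewrite aix in e1 e3.
  have [->|hb] := ab (phii x); first by rewrite phiiK.
  move: (e1 hb); rewrite phiiK => e4.
  by rewrite -e4 ax [in LHS]e4 phiiK.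
have h1 : a (ai x) <> ai x by rewrite aiK => e4; apply: ax; rewrite {1}e4 aiK.
have [//|h2] := ab (ai x); have [//|h3] := ab x.
have e4 : phii (ai x) = ai x by rewrite -{1}(e3 h2) phiK.
by rewrite e4 aiK e2.
Qed.

End Germ.
End TwoJumps.

Section GermBothSides.
Variable R : realType.
Implicit Types (F : R -> R) (x p : R).

(** Conjugation by the reflection of the line, which exchanges left and right germs. *)
Definition flip F : R -> R := fun x => - F (- x).

Lemma flip_diffeo F F' : circle_diffeo F F' ->
  circle_diffeo (flip F) (F' \o -%R).
Proof.
have dN x : der_at setT (@GRing.opp R) x (-1).
  have := @der_affine R setT (-1) 0 x; congr der_at.
  by apply/funext => y; ring.
move=> [Fd Fc F0 F1]; split=> x /=; last 2 first.
- by [].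
- by have := F1 (- x - 1); rewrite /flip subrK opprD; lra.
- have -> : F' (- x) = -1 * (F' (- x) * -1) by ring.
  apply: (der_comp (I := setT) (J := setT) (f := -%R)) => //.
  exact: (der_comp (I := setT) (J := setT) (g := -%R)).
- apply: (cont_comp (I := setT) (J := setT) (g := -%R)) => //.
  exact: der_cont (dN x).
Qed.

Lemma germ_trivial (a ai b bi c ci d di : R -> R)
  (ai' b' bi' c' ci' d' di' : R -> R) p :
  circle_diffeo ai ai' ->
  circle_diffeo b b' -> circle_diffeo bi bi' ->
  circle_diffeo c c' -> circle_diffeo ci ci' ->
  circle_diffeo d d' -> circle_diffeo di di' ->
  cancel a ai -> cancel ai a -> cancel b bi -> cancel bi b ->
  cancel c ci -> cancel ci c -> cancel d di -> cancel di d ->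
  a p = p -> b p = p -> c p = p -> d p = p ->
  (forall x, a x = x \/ b x = x) -> (forall x, c x = x \/ d x = x) ->
  exists2 e, 0 < e & forall x, `|x - p| < e ->
  let D y := b (d (bi y)) in let Di y := b (di (bi y)) in
  c (D (ci (Di (a (D (c (Di (ci (ai x))))))))) = x.
Proof.
move=> dai db dbi dc dci dd ddi aK aiK bK biK cK ciK dK diK ap bp cp dp ab cd.
have [e e0 He] := germ_trivial_right dai db dbi dc dci dd ddi
  aK aiK bK biK cK ciK dK diK ap bp cp dp ab cd.
have flK f g : cancel f g -> cancel (flip f) (flip g).
  by move=> fK x; rewrite /flip opprK fK opprK.
have flp f : f p = p -> flip f (- p) = - p by rewrite /flip opprK => ->.
have fld f g : (forall x, f x = x \/ g x = x) ->
    forall x, flip f x = x \/ flip g x = x.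
  move=> fg x; have [h|h] := fg (- x); [left|right];
    by rewrite /flip h opprK.
have [h h0 Hh] := germ_trivial_right (flip_diffeo dai)
  (flip_diffeo db) (flip_diffeo dbi) (flip_diffeo dc) (flip_diffeo dci)
  (flip_diffeo dd) (flip_diffeo ddi) (flK _ _ aK) (flK _ _ aiK)
  (flK _ _ bK) (flK _ _ biK) (flK _ _ cK) (flK _ _ ciK) (flK _ _ dK)
  (flK _ _ diK) (flp _ ap) (flp _ bp) (flp _ cp) (flp _ dp)
  (fld _ _ ab) (fld _ _ cd).
exists (Num.min e h); first by rewrite lt_min e0.
move=> x; rewrite lt_min => /andP[xe xh] /=.
have [px|/ltW xp] := leP p x; first by apply: He; move: xe; rewrite ltr_norml; lra.
have := Hh (- x); rewrite /flip !opprK => H; apply: oppr_inj; apply: H.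
by move: xh; rewrite ltr_norml; lra.
Qed.

End GermBothSides.

(** * Actions on the circle *)

Definition comm (gT : groupType) (g h : gT) : gT := (g * h * g^-1 * h^-1)%g.

(* The elements [F] with [L h F] are the lifts to the line of the circle
   diffeomorphism by which [h] acts. *)
Record lifted_action (R : realType) (gT : groupType)
    (L : gT -> (R -> R) -> Prop) : Prop := {
  lift_bv : forall h F, L h F -> circle_bv F ;
  lift_one : L 1%g id ;
  lift_mul : forall g h F G, L g F -> L h G -> L (g * h)%g (F \o G) ;
  lift_inv : forall h F, L h F ->
    exists G, [/\ L h^-1%g G, cancel F G & cancel G F] ;
  lift_shift : forall h F (k : int), L h F -> L h (fun x => F x + k%:~R) ;
  lift_uniq : forall h F G, L h F -> L h G ->
    exists k : int, forall x, G x = F x + k%:~R }.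

Section Lifts.
Variables (R : realType) (gT : groupType) (L : gT -> (R -> R) -> Prop).
Hypothesis LA : lifted_action L.
Implicit Types (g h : gT) (F G : R -> R).

Lemma lift_diffeo h F : L h F -> exists F', circle_diffeo F F'.
Proof. by case/(lift_bv LA) => F' dF _; exists F'. Qed.

Lemma lift_iter h F n : L h F -> L (h ^+ n)%g (iter n F).
Proof.
move=> hF; elim: n => [|n IH]; first by rewrite expg0; exact: (lift_one LA).
by rewrite expgS; exact: (lift_mul LA hF IH).
Qed.

Lemma lift_comm g h F Fi G Gi : L g F -> L g^-1%g Fi -> L h G -> L h^-1%g Gi ->
  L (comm g h) (F \o G \o Fi \o Gi).
Proof. by move=> *; do 3![apply: (lift_mul LA) => //]. Qed.

(** [F G] and [G F] lift the same element, so they differ by an integer translation. At the fixed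
    point of [G] this says that [G] shifts [F z] by an integer, which vanishes by [displacement]. *)
Lemma lifts_commute g h F G z : L g F -> L h G -> (g * h = h * g)%g -> G z = z ->
  forall x, F (G x) = G (F x).
Proof.
move=> gF hG gh Gz.
have [F' dF] := lift_diffeo gF; have [G' dG] := lift_diffeo hG.
have := lift_mul LA gF hG; rewrite gh => FG; have GF := lift_mul LA hG gF.
have [k Hk] := lift_uniq LA GF FG; have := Hk z; rewrite /= Gz => e.
have := displacement dG (F z) Gz.
have -> : G (F z) = F z - k%:~R by lra.
move=> kk; have k1 : - 1 < k%:~R :> R by lra.
 have k2 : k%:~R < 1 :> R by lra.
 have k0 := int_lt1 k1 k2.
by move=> x; have := Hk x; rewrite k0 addr0.
Qed.

Section DisjointSupports.
Variables (a b c : gT).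
Hypotheses (ab : (a * b = b * a)%g) (cb : (c * b = b * c)%g).
Variables (A B C : R -> R).
Hypotheses (aA : L a A) (bB : L b B) (cC : L c C).

Let disjoint_goal := exists n m l : nat, [/\ (0 < n)%N, (0 < m)%N, (0 < l)%N &
  exists F G, [/\ L (comm (a ^+ n) (c ^+ m))%g F, L (b ^+ l)%g G &
    forall x, F x = x \/ G x = x]].

Let periodic_component g F h G p q : L g F -> L h G -> (g * h = h * g)%g ->
  component G p q -> q <= p + 1 -> exists n (k : int),
    [/\ (0 < n)%N, iter n F p = p + k%:~R & iter n F q = q + k%:~R].
Proof.
move=> gF hG gh cpq qp; have [Gp _ _ _] := cpq.
have FG := lifts_commute gF hG gh Gp.
have [F' dF Fv] := lift_bv LA gF; have [G' dG] := lift_diffeo hG.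
have [Fi [_ FK FiK]] := lift_inv LA gF.
exact: (component_periodic dF Fv FK FiK dG FG).
Qed.

(** Suppose an element of the centralizer of [b] has a fixed point but is not trivial. By Kopell's
    lemma the ends of a component of its support are periodic under [b], which is excluded here. So
    the centralizer acts freely on the line and Hoelder's theorem applies. *)
Let aperiodic_case :
  (forall l F x, (0 < l)%N -> L (b ^+ l)%g F -> F x <> x) -> disjoint_goal.
Proof.
move=> Hb; exists 1%N, 1%N, 1%N; split=> //; rewrite !expg1.
have [Ai [aAi AK AiK]] := lift_inv LA aA.
have [Ci [cCi CK CiK]] := lift_inv LA cC.
exists (A \o C \o Ai \o Ci), B; split=> //; first exact: lift_comm.
move=> x; left => /=.
pose S := [set F : R -> R | exists2 h, L h F & (h * b = b * h)%g].
have SAa : S A by exists a.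
have SCc : S C by exists c.
suff ACc y : A (C y) = C (A y) by rewrite ACc AiK CiK.
apply: (@free_action_abelian R setT S _ _ _ _ _ _ _ A C y _ _ _) => //.
- by move=> F [h hF _]; have [F' dF] := lift_diffeo hF; exact: cd_lt dF.
- by move=> F z [h hF _]; have [F' dF] := lift_diffeo hF; exact: cd_cont dF _ _.
- move=> F G [h hF hb] [k kG kb]; exists (h * k)%g; first exact: (lift_mul LA).
  by rewrite -mulgA kb mulgA hb mulgA.
- move=> F [h hF hb]; have [Fi [hFi FK FiK]] := lift_inv LA hF.
  exists Fi; split=> //; exists h^-1%g => //.
  by apply: (mulgI h); rewrite !mulgA mulgV mul1g hb mulgK.
move=> F z [h hF hb] _ Fz w _; apply: contrapT => Fw.
have [F' dF] := lift_diffeo hF.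
have [p [q [cpq _ qp]]] := component_ex dF Fz Fw.
have [n [k [n0 e _]]] := periodic_component bB hF (esym hb) cpq qp.
apply: (Hb n (fun x => iter n B x + (- k)%:~R) p) => //.
  by apply: (lift_shift LA); exact: lift_iter.
by rewrite e rmorphN /= addrK.
Qed.

(** The ends of a component of [G] are periodic under [F] up to an integer. The fixed point [x1]
    makes the integer vanish, and an increasing map has no periodic points other than fixed ones. *)
Let fix_components g F x1 l G : L g F -> (g * b = b * g)%g ->
  L (b ^+ l)%g G -> G x1 = x1 -> F x1 = x1 ->
  forall p q, component G p q -> q <= p + 1 -> F p = p /\ F q = q.
Proof.
move=> gF gb hG Gx1 Fx1 p q cpq qp.
have [F' dF] := lift_diffeo gF; have [G' dG] := lift_diffeo hG.
have gh : (g * b ^+ l = b ^+ l * g)%g by exact: commuteX.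
have [n [k [n0 e1 e2]]] := periodic_component gF hG gh cpq qp.
have Fnx1 : iter n F x1 = x1 by elim: (n) => //= m ->.
have := displacement (circle_diffeo_iter n dF) p Fnx1; rewrite e1 => kk.
have k1 : - 1 < k%:~R :> R by lra.
have k2 : k%:~R < 1 :> R by lra.
have k0 := int_lt1 k1 k2.
rewrite k0 addr0 in e1; rewrite k0 addr0 in e2.
by split; apply: (iter_fix dF n0).
Qed.

(** One power serves all components: it is chosen so that, after a translation, the ends of a single
    component are fixed, and [fix_components] spreads this to the others. *)
Let normalize g F l G : L g F -> (g * b = b * g)%g -> L (b ^+ l)%g G ->
  forall x1 y, G x1 = x1 -> G y <> y -> exists2 n, (0 < n)%N &
  exists F1, L (g ^+ n)%g F1 /\
  forall p q, component G p q -> q <= p + 1 -> F1 p = p /\ F1 q = q.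
Proof.
move=> gF gb hG x1 y Gx1 Gy; have [G' dG] := lift_diffeo hG.
have [p [q [cpq _ qp]]] := component_ex dG Gx1 Gy.
have gh : (g * b ^+ l = b ^+ l * g)%g by exact: commuteX.
have [n [k [n0 e1 e2]]] := periodic_component gF hG gh cpq qp; exists n => //.
pose F1 x := iter n F x + (- k)%:~R.
have gF1 : L (g ^+ n)%g F1 by apply: (lift_shift LA); exact: lift_iter.
exists F1; split=> //; have [Gp _ _ _] := cpq.
apply: (fix_components gF1 _ hG Gp).
  exact/esym/commuteX.
by rewrite /F1 e1 rmorphN /= addrK.
Qed.

Let periodic_case l G x1 : (0 < l)%N -> L (b ^+ l)%g G -> G x1 = x1 ->
  disjoint_goal.
Proof.
move=> l0 hG Gx1.
have [[y Gy]|] := pselect (exists y, G y <> y); last first.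
  move=> /forallNP H; exists 1%N, 1%N, l; split=> //; rewrite !expg1.
  have [Ai [aAi _ _]] := lift_inv LA aA; have [Ci [cCi _ _]] := lift_inv LA cC.
  exists (A \o C \o Ai \o Ci), G; split=> //; first exact: lift_comm.
  by move=> x; right; apply: contrapT; exact: H.
have [n n0 [A1 [aA1 HA]]] := normalize aA ab hG Gx1 Gy.
have [m m0 [C1 [cC1 HC]]] := normalize cC cb hG Gx1 Gy.
exists n, m, l; split=> //.
have [Ai [aAi AK AiK]] := lift_inv LA aA1.
have [Ci [cCi CK CiK]] := lift_inv LA cC1.
exists (A1 \o C1 \o Ai \o Ci), G; split=> //; first exact: lift_comm.
move=> x; have [Gx|Gx] := pselect (G x = x); first by right.
left; have [G' dG Gv] := lift_bv LA hG.
have [Gi [_ GK GiK]] := lift_inv LA hG.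
have [p [q [cpq xpq qp]]] := component_ex dG Gx1 Gx.
have [Gp Gq pq Gno] := cpq.
pose X := [set z | p < z < q].
pose S := [set F : R -> R | exists2 h, L h F &
  [/\ forall z, G (F z) = F (G z), F p = p & F q = q]].
have inS h F : L (h ^+ 1)%g F -> (h * b = b * h)%g -> F p = p -> F q = q -> S F.
  rewrite expg1 => hF hb Fp Fq; exists h => //; split=> // z.
  by apply/esym/(lifts_commute hF hG _ Gp); exact: commuteX.
have SAa : S A1.
  have [Ap Aq] := HA p q cpq qp; apply: (inS (a ^+ n)%g); rewrite ?expg1 //.
  exact/esym/commuteX.
have SCc : S C1.
  have [Cp Cq] := HC p q cpq qp; apply: (inS (c ^+ m)%g); rewrite ?expg1 //.
  exact/esym/commuteX.
have S_X F z : S F -> X z -> X (F z).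
  move=> [h hF [_ Fp Fq]]; have [F' dF] := lift_diffeo hF.
  by rewrite /X /= -{2}Fp -{2}Fq !(cd_lt dF).
have S_inv F : S F -> exists Fi, [/\ S Fi, cancel F Fi & cancel Fi F].
  move=> [h hF [GF Fp Fq]]; have [Fi [hFi FK FiK]] := lift_inv LA hF.
  exists Fi; split=> //; exists h^-1%g => //; split.
  - by move=> z; apply: (can_inj FK); rewrite -GF !FiK.
  - by rewrite -{1}Fp FK.
  - by rewrite -{1}Fq FK.
have ACc y0 : X y0 -> A1 (C1 y0) = C1 (A1 y0).
  move=> Xy0; apply: (@free_action_abelian R X S _ _ _ _ _ _ _ A1 C1 y0 _ _ _) => //.
  - by move=> z1 z2 z; rewrite /X /=; lra.
  - by move=> F [h hF _]; have [F' dF] := lift_diffeo hF; exact: cd_lt dF.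
  - by move=> F z [h hF _]; have [F' dF] := lift_diffeo hF; exact: cd_cont dF _ _.
  - move=> F1 F2 [h hF [e1 e2 e3]] [k kF [d1 d2 d3]]; exists (h * k)%g.
      exact: (lift_mul LA).
    by split=> [z||] /=; rewrite ?e1 ?d1 ?d2 ?d3.
  (* Freeness on [(p, q)]: a component of the support of [F] is carried to itself by a power of [G]
     up to an integer, so an end of it inside [(p, q)] would be fixed by [G]. Hence its ends are [p]
     and [q], and it contains the fixed point [z]. *)
  move=> F z [h hF [GF Fp Fq]] Xz Fz w Xw; apply: contrapT => Fw.
  have [F' dF] := lift_diffeo hF.
  have [p' [q' [cpq' wpq qp']]] := component_ex dF Fz Fw.
  have [n' [k [n'0 e1 e2]]] := component_periodic dG Gv GK GiK dF GF cpq' qp'.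
  have Gn := circle_diffeo_iter n' dG.
  have Gnp : iter n' G p = p by elim: (n') => //= ? ->.
  have [Fp' Fq' _ Fno] := cpq'.
  have pp' : p <= p'.
    rewrite leNgt; apply/negP => h1; apply: (Fno p) => //.
    by move: Xw; rewrite /X /=; lra.
  have qq' : q' <= q.
    rewrite leNgt; apply/negP => h1; apply: (Fno q) => //.
    by move: Xw; rewrite /X /=; lra.
  have noend e : X e -> iter n' G e = e + k%:~R -> False.
    move=> Xe Ge; have := displacement Gn e Gnp; rewrite Ge => kk.
    have k1 : - 1 < k%:~R :> R by lra.
    have k2 : k%:~R < 1 :> R by lra.
    have k0 := int_lt1 k1 k2.
    rewrite k0 addr0 in Ge; apply: (Gno e) => //.
    exact: (iter_fix dG n'0).
  have [lt_pp|le_pp] := ltP p p'.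
    by apply: (noend p') => //; move: Xw; rewrite /X /=; lra.
  have ep : p' = p by apply/eqP; rewrite eq_le le_pp pp'.
  apply: (noend q') => //; move: Xw Xz; rewrite /X /= => h1 h2.
  have [lt_zq|] := ltP z q'; last by lra.
  by exfalso; apply: (Fno z) => //; rewrite ep; lra.
rewrite /=.
have XCi : X (Ci x).
  have [Ci' [SCi' _ Ci'K]] := S_inv _ SCc.
  have -> : Ci x = Ci' x by rewrite -{1}(Ci'K x) CK.
  exact: S_X SCi' xpq.
have XAi : X (Ai (Ci x)).
  have [Ai' [SAi' _ Ai'K]] := S_inv _ SAa.
  have -> : Ai (Ci x) = Ai' (Ci x) by rewrite -{1}(Ai'K (Ci x)) AK.
  exact: S_X SAi' XCi.
by rewrite ACc // AiK CiK.
Qed.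

(* By Kopell's lemma and Hoelder's theorem the centralizer of a diffeomorphism
   acts on each component of its support through an abelian group. *)
Lemma disjoint_supports : exists n m l : nat,
  [/\ (0 < n)%N, (0 < m)%N, (0 < l)%N &
  exists F G, [/\ L (comm (a ^+ n) (c ^+ m))%g F, L (b ^+ l)%g G &
    forall x, F x = x \/ G x = x]].
Proof.
have [H|H] := pselect (exists l F x, [/\ (0 < l)%N, L (b ^+ l)%g F & F x = x]).
  by case: H => l [F [x [l0 bF Fx]]]; exact: periodic_case l0 bF Fx.
apply: aperiodic_case => l F x l0 bF Fx.
by apply: H; exists l, F, x.
Qed.

End DisjointSupports.
End Lifts.

(** * Continuous induction and gaps of closed sets *)

Section Intervals.
Variable R : realType.

(** By the local hypothesis at the supremum of the [x] with [P a x], the property reaches this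
    supremum and passes beyond it unless it is [b]. *)
Lemma interval_induction (P : R -> R -> Prop) a b : a <= b ->
  (forall u v w, a <= u -> u <= v -> v <= w -> w <= b ->
     P u v -> P v w -> P u w) ->
  (forall t, a <= t <= b -> exists2 d, 0 < d &
     forall u v, a <= u -> t - d < u -> u <= t -> t <= v -> v < t + d ->
       v <= b -> P u v) ->
  P a b.
Proof.
move=> ab Ptrans Ploc; pose E := [set x | a <= x <= b /\ P a x].
have Ea : E a.
  split; first by rewrite lexx.
  by have [|d d0 H] := Ploc a; [rewrite lexx|apply: H => //; lra].
have supE : has_sup E by split; [exists a|exists b => x [/andP[]]].
have aS : a <= sup E by apply: sup_upper_bound.
have Sb : sup E <= b by apply: ge_sup; [exists a|move=> x [/andP[]]].
have [|d d0 H] := Ploc (sup E); first by rewrite aS.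
have [x [/andP[ax xb] Px] Sx] := sup_adherent d0 supE.
have xS : x <= sup E.
  by apply: sup_upper_bound => //; split=> //; rewrite ax.
pose s := Num.min b (sup E + d / 2).
have sb : s <= b by rewrite /s ge_min lexx.
have sd : s <= sup E + d / 2 by rewrite /s ge_min lexx orbT.
have Ss : sup E <= s by rewrite /s le_min Sb; lra.
have Pas : P a s.
  by apply: (Ptrans a x s) => //; [lra|apply: H => //; lra].
have : s <= sup E by apply: sup_upper_bound => //; split=> //; lra.
move=> sS; have [h|h] := leP b (sup E + d / 2).
  by move: Pas; rewrite /s min_l.
by move: sS; rewrite /s min_r ?(ltW h) //; lra.
Qed.

Lemma closed_gap (E : set R) l0 r0 y :
  (forall x, ~ E x -> exists2 d, 0 < d & forall z, `|z - x| < d -> ~ E z) ->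
  E l0 -> E r0 -> l0 <= y <= r0 -> ~ E y ->
  exists l r, [/\ E l, E r, l0 <= l, r <= r0 & l < y < r /\
    forall z, l < z < r -> ~ E z].
Proof.
move=> Ec El Er /andP[ly yr] Ey.
pose A := [set z | z <= y /\ E z]; pose B := [set z | y <= z /\ E z].
have supA : has_sup A by split; [exists l0|exists y => z []].
have infB : has_inf B by split; [exists r0|exists y => z []].
have Ay : sup A <= y by apply: ge_sup; [exists l0|move=> z []].
have yB : y <= inf B by apply: lb_le_inf; [exists r0|move=> z []].
have EA : E (sup A).
  apply: contrapT => /Ec[d d0 Hd].
  have [z [zy Ez] zs] := sup_adherent d0 supA; apply: (Hd z) => //.
  have : z <= sup A by apply: sup_upper_bound.
  by rewrite ltr_norml; lra.
have EB : E (inf B).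
  apply: contrapT => /Ec[d d0 Hd].
  have [z [zy Ez] zs] := inf_adherent d0 infB; apply: (Hd z) => //.
  have : inf B <= z by apply: ge_inf => //; case: infB.
  by rewrite ltr_norml; lra.
have Ay' : sup A < y.
  by rewrite lt_neqAle Ay andbT; apply/eqP => e; apply: Ey; rewrite -e.
have yB' : y < inf B.
  by rewrite lt_neqAle yB andbT; apply/eqP => e; apply: Ey; rewrite e.
exists (sup A), (inf B); split=> //.
- by apply: sup_upper_bound.
- by apply: ge_inf => //; case: infB.
split; first by rewrite Ay'.
move=> z /andP[z1 z2] Ez; have [zy|yz] := leP z y.
  have : z <= sup A by apply: sup_upper_bound.
  lra.
have : inf B <= z by apply: ge_inf; [case: infB|split=> //; exact: ltW].
lra.
Qed.

End Intervals.

(** * Killing an element on one gap after another *)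

Section Kill.
Variables (R : realType) (gT : groupType) (L : gT -> (R -> R) -> Prop).
Hypothesis LA : lifted_action L.
Variable p0 : R.
Implicit Types (g h x : gT) (F G : R -> R).

(** Fixing [p0] selects at most one lift of each element, so the elements that have such a lift form
    a group acting on the line itself, not merely on the circle. *)
Definition stab h F : Prop := L h F /\ F p0 = p0.

Definition globally_fixed : set R := [set y | forall h F, stab h F -> F y = y].

Let stab_mul g h F G : stab g F -> stab h G -> stab (g * h)%g (F \o G).
Proof.
by move=> [gF Fp] [hG Gp]; split; [exact: (lift_mul LA)|rewrite /= Gp].
Qed.

Let stab_inv h F : stab h F ->
  exists G, [/\ stab h^-1%g G, cancel F G & cancel G F].
Proof.
move=> [hF Fp]; have [G [hG FG GF]] := lift_inv LA hF.
by exists G; split=> //; split=> //; rewrite -{1}Fp FG.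
Qed.

Let stab_diffeo h F : stab h F -> exists F', circle_diffeo F F'.
Proof. by case=> /(lift_diffeo LA). Qed.

Let fixed_int (k : int) y : globally_fixed y -> globally_fixed (y + k%:~R).
Proof.
move=> fy h F sF; have [F' dF] := stab_diffeo sF.
by rewrite (cd_int dF) (fy _ _ sF).
Qed.

Let fixed_p0 : globally_fixed p0. Proof. by move=> h F []. Qed.

Let fixed_closed y : ~ globally_fixed y ->
  exists2 d, 0 < d & forall z, `|z - y| < d -> ~ globally_fixed z.
Proof.
move=> fy; have [h [F [sF Fy]]] : exists h F, stab h F /\ F y <> y.
  apply: contrapT => H; apply: fy => h F sF; apply: contrapT => Fy.
  by apply: H; exists h, F.
have [F' dF] := stab_diffeo sF.
have [d d0 Hd] := fix_open (cd_cont dF _ _) Fy.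
by exists d => // z /Hd Fz fz; apply: Fz; exact: fz sF.
Qed.

Definition fixed_gap (l r : R) : Prop :=
  [/\ globally_fixed l, globally_fixed r, p0 <= l, r <= p0 + 1 &
      l < r /\ forall z, l < z < r -> ~ globally_fixed z].

Definition near_trivial F : Prop := forall y, globally_fixed y ->
  exists2 e, 0 < e & forall z, `|z - y| < e -> F z = z.

(** One period suffices because lifts commute with integer translations. *)
Definition supported_in (Y : seq (R * R)) F : Prop :=
  forall z, p0 <= z <= p0 + 1 -> (forall I, I \in Y -> ~ (I.1 < z < I.2)) ->
    F z = z.

Let good Y h F := [/\ stab h F, near_trivial F & supported_in Y F].

Let gapped (Y : seq (R * R)) := forall I, I \in Y -> fixed_gap I.1 I.2.

Let stab_gap h F z l r : globally_fixed l -> globally_fixed r -> stab h F ->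
  (l < F z < r) = (l < z < r).
Proof.
move=> fl fr sF; have [F' dF] := stab_diffeo sF.
by rewrite -{1}(fl _ _ sF) -{1}(fr _ _ sF) !(cd_lt dF).
Qed.

Let good_mul Y g h F G : good Y g F -> good Y h G -> good Y (g * h)%g (F \o G).
Proof.
move=> [sF nF uF] [sG nG uG]; split; first exact: stab_mul.
  move=> y fy; have [e e0 He] := nF y fy; have [d d0 Hd] := nG y fy.
  exists (Num.min e d); first by rewrite lt_min e0.
  by move=> z; rewrite lt_min => /andP[z1 z2] /=; rewrite Hd // He.
by move=> z zp zY; rewrite /= uG // uF.
Qed.

Let good_inv Y h F : good Y h F -> exists G,
  [/\ good Y h^-1%g G, cancel F G & cancel G F].
Proof.
move=> [sF nF uF]; have [G [sG FG GF]] := stab_inv sF.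
exists G; split=> //; split=> // [y /nF[e e0 He]|z zp zY].
  by exists e => // z ze; rewrite -{1}(He z ze) FG.
by rewrite -{1}(uF z zp zY) FG.
Qed.

Let good_conj Y g h F G Gi : gapped Y -> good Y h F -> stab g G ->
  stab g^-1%g Gi -> cancel Gi G -> good Y (g * h * g^-1)%g (G \o F \o Gi).
Proof.
move=> gY [sF nF uF] sG sGi GiK; split.
- by do 2![apply: stab_mul => //].
- move=> y fy; have [e e0 He] := nF y fy.
  have [Gi' dGi] := stab_diffeo sGi.
  have [d d0 Hd] := cd_cont dGi setT y e0.
  exists d => // z zd /=; rewrite He ?GiK // -{1}(fy _ _ sGi).
  exact: Hd.
move=> z /andP[z1 z2] zY /=; have [Gi' dGi] := stab_diffeo sGi.
rewrite uF ?GiK //.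
  have f1 := fixed_int 1 fixed_p0.
  by rewrite -{1}(fixed_p0 sGi) -{1}(f1 _ _ sGi) !(cd_le dGi) z1.
move=> I IY; have [f1 f2 _ _ _] := gY I IY.
by rewrite (stab_gap z f1 f2 sGi); exact: zY.
Qed.

(** Otherwise the supremum of the orbit of [u] lies in [[u, v]], inside the gap, and it is fixed by
    the whole stabilizer. *)
Let displace l r u v : fixed_gap l r -> l < u < r -> v < r ->
  exists h F, stab h F /\ v < F u.
Proof.
move=> [_ fr _ _ [_ noF]] /andP[lu ur] vr; apply: contrapT => H.
have {}H h F : stab h F -> F u <= v.
  by move=> sF; rewrite leNgt; apply/negP => vF; apply: H; exists h, F.
pose E := [set y | exists h F, stab h F /\ F u = y].
have s1 : stab 1%g id by split=> //; exact: (lift_one LA).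
have Eu : E u by exists 1%g, id.
have supE : has_sup E.
  by split; [exists u|exists v => _ [h [F [sF <-]]]; exact: H sF].
have uS : u <= sup E by apply: sup_upper_bound.
have Sv : sup E <= v.
  by apply: ge_sup; [exists u|move=> _ [h [F [sF <-]]]; exact: H sF].
apply: (noF (sup E)); first lra.
have noup h F : stab h F -> F (sup E) <= sup E.
  move=> sF; rewrite leNgt; apply/negP => SF.
  have [F' dF] := stab_diffeo sF; have [Fi [sFi FK FiK]] := stab_inv sF.
  have [Fi' dFi] := stab_diffeo sFi.
  have : Fi (sup E) < sup E by rewrite -(cd_lt dF) FiK.
  rewrite -subr_gt0 => e0; have [_ [k [G [sG <-]]]] := sup_adherent e0 supE.
  rewrite opprB addrC subrK -(cd_lt dF) FiK ltNge => /negP; apply.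
  apply: sup_upper_bound => //; exists (h * k)%g, (F \o G); split=> //.
  exact: stab_mul.
move=> h F sF; have [F' dF] := stab_diffeo sF.
have [Fi [sFi FK FiK]] := stab_inv sF.
apply/eqP; rewrite eq_le (noup _ _ sF) /= -[X in X <= _]FiK (cd_le dF).
exact: noup sFi.
Qed.

Variable nt : gT -> Prop.
Hypothesis nt_conj : forall g x, nt x -> nt (g * x * g^-1)%g.
Hypothesis nt_comm : forall x, nt x -> exists2 s : seq gT,
  forall g, g \in s -> exists F, stab g F &
  forall z, nt z -> exists2 g, g \in s & nt (comm z (g * x * g^-1))%g.

Let shrink l r F : fixed_gap l r -> near_trivial F ->
  exists2 e, 0 < e & forall z, l < z < r -> z < l + e \/ r - e < z -> F z = z.
Proof.
move=> [fl fr _ _ _] nF; have [e e0 He] := nF l fl; have [d d0 Hd] := nF r fr.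
exists (Num.min e d); first by rewrite lt_min e0.
have h1 : Num.min e d <= e by rewrite ge_min lexx.
have h2 : Num.min e d <= d by rewrite ge_min lexx orbT.
by move=> z zlr [h|h]; [apply: He|apply: Hd]; rewrite ltr_norml; lra.
Qed.

Let shrink_all l r (s : seq gT) (P : gT -> (R -> R) -> Prop) :
  fixed_gap l r ->
  (forall g, g \in s -> exists2 F, P g F & near_trivial F) ->
  exists2 e, 0 < e & forall g, g \in s -> exists2 F, P g F &
    forall z, l < z < r -> z < l + e \/ r - e < z -> F z = z.
Proof.
move=> lr; elim: s => [|g s IH] H; first by exists 1.
have [|e e0 He] := IH; first by move=> k ks; apply: H; rewrite inE ks orbT.
have [F PF nF] := H g (mem_head _ _); have [d d0 Hd] := shrink lr nF.
have h1 : Num.min e d <= e by rewrite ge_min lexx.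
have h2 : Num.min e d <= d by rewrite ge_min lexx orbT.
exists (Num.min e d); first by rewrite lt_min e0.
move=> k; rewrite inE => /predU1P[->|/He[G PG HG]].
  by exists F => // z zlr h; apply: Hd => //; lra.
by exists G => // z zlr h; apply: HG => //; lra.
Qed.

(* A compactly supported element and suitable conjugates of it commute on a
   component of the complement of the fixed point set, because the group
   displaces compact sets there. *)
Let kill_gap l r Y x F : gapped Y -> (l, r) \in Y -> good Y x F -> nt x ->
  exists y G, [/\ good Y y G, nt y & forall z, l < z < r -> G z = z].
Proof.
move=> gY lrY gx ntx; have lr : fixed_gap l r := gY _ lrY; have [sF nF uF] := gx.
have [s sS Hs] := nt_comm ntx.
pose P g (C : R -> R) := good Y (g * x * g^-1)%g C.
have sP g : g \in s -> exists2 C, P g C & near_trivial C.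
  case/sS => G sG; have [Gi [sGi _ GiK]] := stab_inv sG.
  have gc := good_conj gY gx sG sGi GiK.
  by exists (G \o F \o Gi) => //; case: gc.
(* [e] has to serve every [g] of the list: [h] is chosen from it, and only afterwards does [Hs]
   select [g], for the conjugate of [x] by [h]. *)
have [e e0 He] := shrink_all lr sP; have [d d0 Hd] := shrink lr nF.
have [fl fr pl rp [llr _]] := lr.
pose c := Num.min (Num.min e d) ((r - l) / 2).
have c0 : 0 < c by rewrite /c !lt_min e0 d0 divr_gt0 // subr_gt0.
have ce : c <= e by rewrite /c !ge_min lexx.
have cd : c <= d by rewrite /c !ge_min lexx orbT.
have cr : c <= (r - l) / 2 by rewrite /c !ge_min lexx !orbT.
(* [H] moves [l + c / 2] beyond [r - c / 2]. To the left of the image point the conjugate of [F] by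
   [H] is trivial, to its right the conjugates from the list are, so the supports are disjoint in
   the gap. *)
have [||h [H [sH Hu]]] := @displace l r (l + c / 2) (r - c / 2) lr; try lra.
have [Hi [sHi HK HiK]] := stab_inv sH; have [Hi' dHi] := stab_diffeo sHi.
have gy := good_conj gY gx sH sHi HiK.
have [g gs ntg] := Hs _ (nt_conj h ntx).
have [C PC HC] := He g gs; have [[sC _ _] [sy _ _]] := (PC, gy).
have [Ci [gCi CK CiK]] := good_inv PC.
have [Yi [gYi YK YiK]] := good_inv gy.
set K := H \o F \o Hi in gy sy YK YiK.
exists (comm (h * x * h^-1) (g * x * g^-1))%g, (K \o C \o Yi \o Ci).
split=> //; first by do 3![apply: good_mul => //].
have pres k G z : stab k G -> (l < z < r -> l < G z < r).
  by move=> sG; rewrite (stab_gap z fl fr sG).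
have comKC z : l < z < r -> K (C z) = C (K z).
  apply: (disjoint_commute (D := [set z | l < z < r])).
  - exact: can_inj YK.
  - exact: can_inj CK.
  - by move=> w /(pres _ _ w sy).
  - by move=> w /(pres _ _ w sC).
  move=> w wlr; have [wu|uw] := ltP w (H (l + c / 2)).
    left; rewrite /K /= Hd ?HiK //; first exact: pres sHi wlr.
    have : Hi w < l + c / 2 by rewrite -[l + c / 2]HK (cd_lt dHi).
    by left; lra.
  by right; apply: HC => //; right; lra.
move=> z zlr /=; have [sCi _ _] := gCi; have [sYi _ _] := gYi.
rewrite comKC ?YiK ?CiK //.
exact: pres sYi (pres _ _ _ sCi zlr).
Qed.

Let kill_all Y : gapped Y -> forall x F, good Y x F -> nt x ->
  exists y, nt y /\ L y id.
Proof.
elim: Y => [|[l r] Y IH] gY x F gx ntx.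
  have [[xF Fp] _ uF] := gx; exists x; split=> //.
  have [F' dF] := lift_diffeo LA xF.
  rewrite (_ : id = F) //; apply/funext => z.
  pose k := Num.floor (z - p0).
  have h1 := floor_le (z - p0); have := floorD1_gt (z - p0).
  rewrite intrD -/k => h2; have := uF (z + (- k)%:~R).
  rewrite (cd_int dF) rmorphN /= => H; have := H _ _; rewrite /k.
  by move=> /(_ _ _)/wrap[]; [rewrite -/k; lra|by []|lra].
have [y [G [[sG nG uG] nty Gid]]] := kill_gap gY (mem_head _ _) gx ntx.
apply: (IH _ y G) => //.
  by move=> I IY; apply: gY; rewrite inE IY orbT.
split=> // z zp zY; have [zlr|zlr] := boolP (l < z < r); first exact: Gid.
apply: uG => // I; rewrite inE => /predU1P[->|]; first exact/negP.
exact: zY.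
Qed.

(** Near a global fixed point [F] is trivial, and near any other point only one gap occurs; over one
    period, continuous induction leaves finitely many gaps. *)
Lemma kill_near_trivial x F : stab x F -> near_trivial F -> nt x ->
  exists y, nt y /\ L y id.
Proof.
move=> sF nF ntx.
suff [Y gY uY] : exists2 Y, gapped Y & supported_in Y F.
  exact: (kill_all gY (And3 sF nF uY) ntx).
pose P (u v : R) := exists2 Y, gapped Y & forall z, u <= z <= v ->
  (forall I, I \in Y -> ~ (I.1 < z < I.2)) -> F z = z.
suff [Y gY HY] : P p0 (p0 + 1) by exists Y.
apply: interval_induction => [|u v w _ uv vw _ [Y1 g1 H1] [Y2 g2 H2]|t tp].
- by rewrite lerDl.
- exists (Y1 ++ Y2) => [I|z /andP[uz zw] zY].
    by rewrite mem_cat => /orP[/g1|/g2].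
  have [zv|vz] := leP z v.
    by apply: H1 => [|I IY]; [rewrite uz|apply: zY; rewrite mem_cat IY].
  by apply: H2 => [|I IY]; [lra|apply: zY; rewrite mem_cat IY orbT].
have [ft|nft] := pselect (globally_fixed t).
  have [e e0 He] := nF t ft; exists e => // u v _ tu _ _ vt _.
  by exists [::] => // z zuv _; apply: He; rewrite ltr_norml; lra.
have [l [r [fl fr pl rp [ltr Hlr]]]] :=
  closed_gap fixed_closed fixed_p0 (fixed_int 1 fixed_p0) tp nft.
exists (Num.min (t - l) (r - t)); first by rewrite lt_min; lra.
have h1 : Num.min (t - l) (r - t) <= t - l by rewrite ge_min lexx.
have h2 : Num.min (t - l) (r - t) <= r - t by rewrite ge_min lexx orbT.
move=> u v _ tu _ _ vt _; exists [:: (l, r)].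
  by move=> I; rewrite inE => /eqP->; split=> //; split=> //=; lra.
by move=> z zuv /(_ (l, r) (mem_head _ _)) []; rewrite /=; lra.
Qed.

End Kill.

(** * A nontrivial element acting trivially on one component *)

Section Core.
Variable gT : groupType.
Implicit Types (g h : gT).

(** Membership is used by instantiating [K] with a subgroup, such as the elements that have a lift
    fixing [p0]. *)
Definition generated_by (s : seq gT) g : Prop := forall K : set gT,
  K 1%g -> (forall x y, K x -> K y -> K (x * y)%g) ->
  (forall x, K x -> K x^-1%g) -> (forall x, x \in s -> K x) -> K g.

(* With [dl' = be dl be^-1] this is the commutator [[ga, dl'], al]. *)
Definition jump_word (al be ga dl : gT) : gT :=
  (let dl' := be * dl * be^-1 in let dli' := be * dl^-1 * be^-1 in
   ga * dl' * ga^-1 * dli' * al * (dl' * ga * dli' * ga^-1) * al^-1)%g.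

(** All that the dynamics asks of the group. Which of the two values [t] takes is decided by the
    action, so both are covered. *)
Record nontriviality (nt : gT -> Prop) (a b c d : gT) : Prop := {
  nt_conj : forall g x, nt x -> nt (g * x * g^-1)%g ;
  nt_al : forall n m, (0 < n)%N -> (0 < m)%N -> nt (comm (a ^+ n) (c ^+ m))%g ;
  nt_be : forall l, (0 < l)%N -> nt (b ^+ l)%g ;
  nt_jump : forall n m l, (0 < n)%N -> (0 < m)%N -> (0 < l)%N ->
    let al := comm (a ^+ n)%g (c ^+ m)%g in let be := (b ^+ l)%g in
    forall t, t = (d * al * d^-1)%g \/ t = (d * be * d^-1)%g ->
    nt (jump_word al be (t * al * t^-1) (t * be * t^-1))%g ;
  nt_list : forall n m l, (0 < n)%N -> (0 < m)%N -> (0 < l)%N ->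
    let al := comm (a ^+ n)%g (c ^+ m)%g in let be := (b ^+ l)%g in
    forall t, t = (d * al * d^-1)%g \/ t = (d * be * d^-1)%g ->
    forall x, nt x -> exists2 s : seq gT,
      forall g, g \in s -> generated_by [:: al; be; t] g &
      forall z, nt z -> exists2 g, g \in s & nt (comm z (g * x * g^-1))%g }.

Variables (R : realType) (L : gT -> (R -> R) -> Prop) (nt : gT -> Prop).
Hypothesis LA : lifted_action L.
Variables (a b c d : gT) (A B C D : R -> R).
Hypotheses (aA : L a A) (bB : L b B) (cC : L c C) (dD : L d D).
Hypotheses (ab : (a * b = b * a)%g) (cb : (c * b = b * c)%g).
Hypothesis NT : nontriviality nt a b c d.

Let lift_conj g h F Fi G : L g F -> L g^-1%g Fi -> L h G ->
  L (g * h * g^-1)%g (F \o G \o Fi).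
Proof. by move=> *; do 2![apply: (lift_mul LA) => //]. Qed.

(** The left end of a component of the support of [F] works: if [G] moved it, [G] would also move
    points slightly to its right, which [F] moves. *)
Let common_fixed (F G : R -> R) : (forall y : R, F y = y \/ G y = y) ->
  (exists F', circle_diffeo F F') -> (exists G', circle_diffeo G G') ->
  ~ (forall y : R, F y = y) -> ~ (forall y : R, G y = y) ->
  exists y, F y = y /\ G y = y.
Proof.
move=> FG [F' dF] [G' dG] /existsNP[x Fx] /existsNP[y Gy].
have Fy : F y = y by case: (FG y).
have [p [q [[Fp Fq pq no] _ _]]] := component_ex dF Fy Fx.
exists p; split=> //; apply: contrapT => Gp.
have [e e0 He] := fix_open (cd_cont dG _ _) Gp.
pose z := p + Num.min (e / 2) ((q - p) / 2).
have h1 : Num.min (e / 2) ((q - p) / 2) <= e / 2 by rewrite ge_min lexx.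
have h2 : Num.min (e / 2) ((q - p) / 2) <= (q - p) / 2.
  by rewrite ge_min lexx orbT.
have h3 : 0 < Num.min (e / 2) ((q - p) / 2) by rewrite lt_min; lra.
case: (FG z); first by apply: no; rewrite /z; lra.
by apply: He; rewrite /z ltr_norml; lra.
Qed.

Theorem nontrivial_kernel : exists x, nt x /\ L x id.
Proof.
have [n [m [l [n0 m0 l0 [F [G [alF beG FG]]]]]]] :=
  disjoint_supports LA ab cb aA bB cC.
set al := comm _ _ in alF; set be := (b ^+ l)%g in beG.
have [Fid|Fid] := pselect (forall x, F x = x).
  exists al; split; first exact: (nt_al NT).
  by rewrite (_ : id = F) //; apply/funext => x; rewrite Fid.
have [Gid|Gid] := pselect (forall x, G x = x).
  exists be; split; first exact: (nt_be NT).
  by rewrite (_ : id = G) //; apply/funext => x; rewrite Gid.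
have dF := lift_diffeo LA alF; have dG := lift_diffeo LA beG.
have [p1 [Fp1 Gp1]] := common_fixed FG dF dG Fid Gid.
have [Di [dDi DK DiK]] := lift_inv LA dD.
(* If the conjugate of [F] by [D] fixes no common fixed point of [F] and [G], then [F] moves
   [Di p1]; hence [G] fixes [Di p1], and the conjugate of [G] by [D] fixes [p1]. *)
have [t [T [tE tT [p0 [Fp Gp Tp]]]]] : exists t T,
    [/\ t = (d * al * d^-1)%g \/ t = (d * be * d^-1)%g, L t T &
     exists p0, [/\ F p0 = p0, G p0 = p0 & T p0 = p0]].
  have [[x [Fx Gx Tx]]|H] :=
      pselect (exists x, [/\ F x = x, G x = x & D (F (Di x)) = x]).
    exists (d * al * d^-1)%g, (D \o F \o Di); split; first by left.
      exact: lift_conj dD dDi alF.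
    by exists x.
  exists (d * be * d^-1)%g, (D \o G \o Di); split; first by right.
    exact: lift_conj dD dDi beG.
  exists p1; split=> //=; have [e|->] := FG (Di p1); last by rewrite DiK.
  by case: H; exists p1; split=> //; rewrite e DiK.
have [Fi [ali FK FiK]] := lift_inv LA alF.
have [Gi [bei GK GiK]] := lift_inv LA beG.
have [Ti [ti TK TiK]] := lift_inv LA tT.
have sinv h E Ei : L h^-1%g Ei -> cancel E Ei -> E p0 = p0 -> stab L p0 h^-1%g Ei.
  by move=> hE EK Ep; split=> //; rewrite -{1}Ep EK.
have sal : stab L p0 al F by split.
have sbe : stab L p0 be G by split.
have st : stab L p0 t T by split.
have sali := sinv _ _ _ ali FK Fp; have sbei := sinv _ _ _ bei GK Gp.
have sti := sinv _ _ _ ti TK Tp.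
have smul g h E E' : stab L p0 g E -> stab L p0 h E' ->
    stab L p0 (g * h)%g (E \o E').
  by move=> [e1 e2] [e3 e4]; split; [exact: (lift_mul LA)|rewrite /= e4].
have sga : stab L p0 (t * al * t^-1)%g (T \o F \o Ti).
  by do 2![apply: (smul _ _ _ _) => //].
have sdl : stab L p0 (t * be * t^-1)%g (T \o G \o Ti).
  by do 2![apply: (smul _ _ _ _) => //].
have sgai : stab L p0 (t * al * t^-1)^-1%g (T \o Fi \o Ti).
  by rewrite invgM invgK [(t * al)^-1%g]invgM mulgA; do 2![apply: (smul _ _ _ _) => //].
have sdli : stab L p0 (t * be * t^-1)^-1%g (T \o Gi \o Ti).
  by rewrite invgM invgK [(t * be)^-1%g]invgM mulgA; do 2![apply: (smul _ _ _ _) => //].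
pose dl' := G \o (T \o G \o Ti) \o Gi.
pose dli' := G \o (T \o Gi \o Ti) \o Gi.
pose W := (T \o F \o Ti) \o dl' \o (T \o Fi \o Ti) \o dli' \o F \o
  (dl' \o (T \o F \o Ti) \o dli' \o (T \o Fi \o Ti)) \o Fi.
apply: (@kill_near_trivial _ _ _ LA p0 nt (nt_conj NT) _ _ W _ _
  (nt_jump NT n0 m0 l0 tE)).
- move=> x ntx; have [s Hs Hz] := nt_list NT n0 m0 l0 tE ntx.
  exists s => // g gs; apply: (Hs g gs [set k | exists F0, stab L p0 k F0]) => {g gs}.
  + by exists id; split=> //; exact: (lift_one LA).
  + by move=> g h [E sE] [E' sE']; exists (E \o E'); exact: (smul _ _ _ _ sE sE').
  + move=> g [E [gE Ep]]; have [Ei [gi EK _]] := lift_inv LA gE.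
    by exists Ei; exact: sinv gi EK Ep.
  + move=> g; rewrite !inE => /or3P[] /eqP->; [by exists F|by exists G|].
    by exists T.
- by rewrite /jump_word /W /dl' /dli'; do ?[apply: (smul _ _ _ _) => //].
(* At a global fixed point [y] the maps [F], [G] and their conjugates by [T] all fix [y], and within
   each pair the supports are disjoint: the situation of [germ_trivial]. *)
move=> y fy; have fix_ h E := fy h E.
have [F' dF'] := lift_diffeo LA alF; have [Fi' dFi'] := lift_diffeo LA ali.
have [G' dG'] := lift_diffeo LA beG; have [Gi' dGi'] := lift_diffeo LA bei.
have [c1 dc1] := lift_diffeo LA (proj1 sga).
have [c2 dc2] := lift_diffeo LA (proj1 sgai).
have [d1 dd1] := lift_diffeo LA (proj1 sdl).
have [d2 dd2] := lift_diffeo LA (proj1 sdli).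
have cj E Ei : cancel E Ei -> cancel (T \o E \o Ti) (T \o Ei \o Ti).
  by move=> EK x /=; rewrite TK EK TiK.
have [e e0 He] := germ_trivial dFi' dG' dGi' dc1 dc2 dd1 dd2 FK FiK GK GiK
  (cj _ _ FK) (cj _ _ FiK) (cj _ _ GK) (cj _ _ GiK) (fy _ _ sal) (fy _ _ sbe)
  (fy _ _ sga) (fy _ _ sdl) FG (fun x => match FG (Ti x) with
     | or_introl h => or_introl (etrans (congr1 T h) (TiK x))
     | or_intror h => or_intror (etrans (congr1 T h) (TiK x)) end).
by exists e => // z ze; exact: He z ze.
Qed.

End Core.

(** * A representation of A(P_4) *)

Section Matrices.
Implicit Types (x y z : rat).

Definition mx3 (a b c d e f g h k : rat) : 'M[rat]_3 :=
  \matrix_(i, j) nth 0 (nth [::] [:: [:: a; b; c]; [:: d; e; f]; [:: g; h; k]] i) j.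

Lemma I3_cases (P : 'I_3 -> Prop) : P 0 -> P 1 -> P 2%:R -> forall i, P i.
Proof.
move=> P0 P1 P2 i; have /or3P[] : [|| i == 0, i == 1 | i == 2%:R].
- by case: i => -[|[|[|i]]].
- by move/eqP->.
- by move/eqP->.
- by move/eqP->.
Qed.

Lemma mx3E (A : 'M[rat]_3) : A = mx3 (A 0 0) (A 0 1) (A 0 2%:R)
  (A 1 0) (A 1 1) (A 1 2%:R) (A 2%:R 0) (A 2%:R 1) (A 2%:R 2%:R).
Proof.
by apply/matrixP; apply: I3_cases; apply: I3_cases; rewrite mxE.
Qed.

Lemma mx3_inj a b c d e f g h k a' b' c' d' e' f' g' h' k' :
  mx3 a b c d e f g h k = mx3 a' b' c' d' e' f' g' h' k' ->
  [/\ [/\ a = a', b = b' & c = c'], [/\ d = d', e = e' & f = f'] &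
      [/\ g = g', h = h' & k = k']].
Proof.
move=> /matrixP E; split; split.
- by have := E 0 0; rewrite !mxE.
- by have := E 0 1; rewrite !mxE.
- by have := E 0 2%:R; rewrite !mxE.
- by have := E 1 0; rewrite !mxE.
- by have := E 1 1; rewrite !mxE.
- by have := E 1 2%:R; rewrite !mxE.
- by have := E 2%:R 0; rewrite !mxE.
- by have := E 2%:R 1; rewrite !mxE.
- by have := E 2%:R 2%:R; rewrite !mxE.
Qed.

Lemma mx3M a b c d e f g h k a' b' c' d' e' f' g' h' k' :
  mx3 a b c d e f g h k * mx3 a' b' c' d' e' f' g' h' k' =
  mx3 (a * a' + b * d' + c * g') (a * b' + b * e' + c * h')
      (a * c' + b * f' + c * k')
      (d * a' + e * d' + f * g') (d * b' + e * e' + f * h')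
      (d * c' + e * f' + f * k')
      (g * a' + h * d' + k * g') (g * b' + h * e' + k * h')
      (g * c' + h * f' + k * k').
Proof.
by apply/matrixP; apply: I3_cases; apply: I3_cases;
  rewrite !mxE !big_ord_recl big_ord0 !mxE /= addr0 addrA.
Qed.

Lemma mx3D a b c d e f g h k a' b' c' d' e' f' g' h' k' :
  mx3 a b c d e f g h k + mx3 a' b' c' d' e' f' g' h' k' =
  mx3 (a + a') (b + b') (c + c') (d + d') (e + e') (f + f')
      (g + g') (h + h') (k + k').
Proof.
by apply/matrixP; apply: I3_cases; apply: I3_cases; rewrite !mxE.
Qed.

Lemma mx3Z x a b c d e f g h k : x *: mx3 a b c d e f g h k =
  mx3 (x * a) (x * b) (x * c) (x * d) (x * e) (x * f) (x * g) (x * h) (x * k).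
Proof.
by apply/matrixP; apply: I3_cases; apply: I3_cases; rewrite !mxE.
Qed.

Lemma mx3_scalar x : x%:M = mx3 x 0 0 0 x 0 0 0 x.
Proof.
by apply/matrixP; apply: I3_cases; apply: I3_cases; rewrite !mxE.
Qed.

(** A rational root of an integer is an integer [p] up to sign, and
    [k^2 < p^2 = k^2 + 4 < (k + 2)^2] leaves [p = k + 1], which parity excludes. *)
Lemma rat_square (k : nat) x : (0 < k)%N -> x ^+ 2 <> (k ^ 2 + 4)%:R.
Proof.
move=> k0 e.
have d0 : (denq x)%:~R != 0 :> rat by rewrite intr_eq0 denq_neq0.
have : (numq x ^+ 2)%:~R = ((k ^ 2 + 4)%:Z * denq x ^+ 2)%:~R :> rat.
  rewrite rmorphXn /= [RHS]rmorphM /= rmorphXn /= -pmulrn -e.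
  rewrite -{2}(divq_num_den x) expr_div_n.
  by rewrite mulfVK // expf_neq0.
move/eqP; rewrite eqr_int => /eqP /(congr1 absz).
rewrite abszM !abszX absz_nat => {}e.
have cop : coprime (`|numq x| ^ 2) (`|denq x| ^ 2).
  by rewrite coprimeXl ?coprimeXr // coprime_num_den.
have d1 : (`|denq x| ^ 2 %| `|numq x| ^ 2)%N by rewrite e dvdn_mull.
have : (`|denq x| ^ 2 = 1)%N.
  by move: cop; rewrite /coprime (gcdn_idPr d1) => /eqP.
move=> dd; rewrite dd muln1 in e; set p := `|numq x|%N in e.
have [h|h] := leqP p k; first by have := leq_sqr p k; rewrite h; lia.
have [h'|h'] := leqP p k.+1; last first.
  by have := leq_sqr k.+2 p; rewrite h' -!mulnn in e *; nia.
by have pk : p = k.+1; [lia|rewrite pk -!mulnn in e; nia].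
Qed.

(* The discriminant [u^2 + 4] of this form is not a square. *)
Lemma form_aniso (n m : nat) (s x y : rat) : (0 < n)%N -> (0 < m)%N ->
  s ^+ 2 = 1 -> let u := n%:R * m%:R in
  n%:R * x ^+ 2 + s * (u + 2) * x * y + m%:R * y ^+ 2 = 0 -> x = 0 /\ y = 0.
Proof.
move=> n0 m0 s2 u e.
have n0' : (n%:R : rat) != 0 by rewrite pnatr_eq0 -lt0n.
have [y0|y0] := eqVneq y 0.
  move: e; rewrite y0 expr0n !mulr0 !addr0 => /eqP.
  by rewrite mulf_eq0 (negbTE n0') expf_eq0 /= => /eqP.
have nm : (0 < n * m)%N by rewrite muln_gt0 n0.
case: (@rat_square (n * m) ((2 * n%:R * x + s * (u + 2) * y) / y) nm).
rewrite expr_div_n; apply: (canLR (mulfK _)); first by rewrite expf_neq0.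
rewrite natrD natrX natrM -/u.
have -> : (2 * n%:R * x + s * (u + 2) * y) ^+ 2 =
   4 * n%:R * (n%:R * x ^+ 2 + s * (u + 2) * x * y + m%:R * y ^+ 2)
   + s ^+ 2 * (u + 2) ^+ 2 * y ^+ 2 - 4 * u * y ^+ 2 by rewrite /u; ring.
by rewrite e s2; ring.
Qed.

End Matrices.

Lemma comm_delta_col (y11 y12 y13 y21 y22 y23 y31 y32 y33 : rat) :
  let Y := mx3 y11 y12 y13 y21 y22 y23 y31 y32 y33 in
  mx3 0 0 1 0 0 0 0 0 0 * Y = Y * mx3 0 0 1 0 0 0 0 0 0 ->
  mx3 0 0 0 0 0 1 0 0 0 * Y = Y * mx3 0 0 0 0 0 1 0 0 0 ->
  [/\ y31 = 0, y32 = 0, y11 = y33 & [/\ y22 = y33, y21 = 0 & y12 = 0]].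
Proof.
rewrite /= !mx3M => /mx3_inj[[h1 h2 h3] [_ _ h6] _] /mx3_inj[[_ _ h4] [_ _ h5] _].
by split; [lra|lra|lra|split; lra].
Qed.

Lemma comm_delta_row (y11 y12 y13 y21 y22 y23 y31 y32 y33 : rat) :
  let Y := mx3 y11 y12 y13 y21 y22 y23 y31 y32 y33 in
  mx3 0 0 0 0 0 0 1 0 0 * Y = Y * mx3 0 0 0 0 0 0 1 0 0 ->
  mx3 0 0 0 0 0 0 0 1 0 * Y = Y * mx3 0 0 0 0 0 0 0 1 0 ->
  [/\ y13 = 0, y23 = 0, y11 = y33 & [/\ y22 = y33, y21 = 0 & y12 = 0]].
Proof.
rewrite /= !mx3M => /mx3_inj[[h1 _ _] [h2 _ _] [h3 h4 h7]] /mx3_inj[_ _ [h5 h6 _]].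
by split; [lra|lra|lra|split; lra].
Qed.

(** * The common commutant of the conjugates of a nonscalar matrix *)

Section Commutant.
Variables (n m : nat) (s : rat).
Hypotheses (n0 : (0 < n)%N) (m0 : (0 < m)%N) (s1 : 1 < s).
Let u : rat := n%:R * m%:R.

(** The commutator of [1 + n E21] and [1 + m E12]. Its upper block has determinant 1 and trace
    [u^2 + 2]; the discriminant [u^2 (u^2 + 4)] of its characteristic polynomial is not a rational
    square. *)
Definition al_mx := mx3 (1 - u) (m%:R * u) 0 (- (n%:R * u)) (1 + u + u ^+ 2) 0
  0 0 1.
Definition ali_mx := mx3 (1 + u + u ^+ 2) (- (m%:R * u)) 0 (n%:R * u) (1 - u) 0
  0 0 1.
Definition be_mx (r : rat) := mx3 r 0 0 0 r 0 0 0 1.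

Lemma al_mxK : al_mx * ali_mx = 1.
Proof.
by rewrite mx3M -[RHS]/(1%:M) mx3_scalar; congr mx3; rewrite /u; ring.
Qed.

Lemma ali_mxK : ali_mx * al_mx = 1.
Proof.
by rewrite mx3M -[RHS]/(1%:M) mx3_scalar; congr mx3; rewrite /u; ring.
Qed.

Let u0 : u != 0.
Proof. by rewrite mulf_neq0 // pnatr_eq0 -lt0n. Qed.

Let col_indep x y :
  x * (- (n%:R * u) * x + (1 + u + u ^+ 2) * y) =
  y * ((1 - u) * x + m%:R * u * y) -> x = 0 /\ y = 0.
Proof.
move=> e; have h : (-1) ^+ 2 = 1 :> rat by rewrite sqrrN expr1n.
apply: (form_aniso n0 m0 h).
apply: (mulfI u0); rewrite mulr0; move/eqP: e; rewrite -subr_eq0 => /eqP e.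
by rewrite -oppr0 -e /u; ring.
Qed.

Let row_indep x y :
  x * (m%:R * u * x + (1 + u + u ^+ 2) * y) =
  y * ((1 - u) * x - n%:R * u * y) -> x = 0 /\ y = 0.
Proof.
move=> e; apply/and_comm; apply: (form_aniso n0 m0 (expr1n _ 2)).
apply: (mulfI u0); rewrite mulr0; move/eqP: e; rewrite -subr_eq0 => /eqP e.
by rewrite -e /u; ring.
Qed.

(* The only eigenline of [al] is spanned by the third basis vector. *)
Lemma al_eigencol (x y k : rat) :
  (1 - u) * x + m%:R * u * y = k * x ->
  - (n%:R * u) * x + (1 + u + u ^+ 2) * y = k * y -> x = 0 /\ y = 0.
Proof. by move=> e1 e2; apply: col_indep; rewrite e1 e2; ring. Qed.

Lemma al_eigenrow (x y k : rat) :
  (1 - u) * x - n%:R * u * y = k * x ->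
  m%:R * u * x + (1 + u + u ^+ 2) * y = k * y -> x = 0 /\ y = 0.
Proof. by move=> e1 e2; apply: row_indep; rewrite e1 e2; ring. Qed.

Variables (t11 t12 t13 t21 t22 t23 t31 t32 t33 : rat).
Variables (r11 r12 r13 r21 r22 r23 r31 r32 r33 : rat).
Let T := mx3 t11 t12 t13 t21 t22 t23 t31 t32 t33.
Let Ti := mx3 r11 r12 r13 r21 r22 r23 r31 r32 r33.
Hypothesis TK : T * Ti = 1.
Hypothesis TiK : Ti * T = 1.
Hypotheses (t_col : t13 != 0 \/ t23 != 0) (t33_neq0 : t33 != 0).
Hypotheses (t_row : t31 != 0 \/ t32 != 0) (r_col : r13 != 0 \/ r23 != 0).

Variables (x11 x12 x13 x21 x22 x23 x31 x32 x33 : rat).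
Let X := mx3 x11 x12 x13 x21 x22 x23 x31 x32 x33.
(** [V] stands for the matrices that commute with all conjugates of [X] under the group generated by
    [al], [be] and [t]. *)
Variable V : set 'M[rat]_3.
Hypothesis V_lin : forall k l z w, V z -> V w -> V (k *: z + l *: w).
Hypothesis V_al : forall z, V z -> V (al_mx * z * ali_mx).
Hypothesis V_ali : forall z, V z -> V (ali_mx * z * al_mx).
Hypothesis V_be : forall z, V z -> V (be_mx s * z * be_mx s^-1).
Hypothesis V_bei : forall z, V z -> V (be_mx s^-1 * z * be_mx s).
Hypothesis V_t : forall z, V z -> V (T * z * Ti).
Hypothesis V_ti : forall z, V z -> V (Ti * z * T).
Hypothesis V_X : forall z, V z -> z * X = X * z.
Hypothesis X_nscal : forall k, X <> k%:M.

Let s0 : s != 0. Proof. by rewrite gt_eqF // (lt_trans ltr01). Qed.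

Let D := (s - 1) ^+ 2 - (s^-1 - 1) ^+ 2.

Let D0 : D != 0.
Proof.
have -> : D = (s - 1) ^+ 3 * (s + 1) / s ^+ 2 by rewrite /D; field.
have h1 : s - 1 != 0 by rewrite subr_eq0 gt_eqF.
have h2 : s + 1 != 0 by rewrite gt_eqF // addr_gt0 // (lt_trans ltr01).
by rewrite mulf_neq0 ?invr_eq0 ?expf_neq0 // mulf_neq0 // expf_neq0.
Qed.

(** Conjugation by [be_mx s] multiplies the off-diagonal part of the third column by [s], that of
    the third row by [s^-1], and fixes the other entries. Subtracting the identity and combining
    with the inverse conjugation isolates each part, with the common factor [D]. *)
Let weights a b c d e f g h k : V (mx3 a b c d e f g h k) ->
  V (mx3 0 0 c 0 0 f 0 0 0) /\ V (mx3 0 0 0 0 0 0 g h 0).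
Proof.
move=> Vz; have V1 := V_lin 1 (-1) (V_be Vz) Vz.
have V2 := V_lin 1 (-1) (V_bei Vz) Vz.
have E1 := V_lin (s - 1) (- (s^-1 - 1)) V1 V2.
have E2 := V_lin (- (s^-1 - 1)) (s - 1) V1 V2.
have {}E1 : V (mx3 0 0 (D * c) 0 0 (D * f) 0 0 0).
  by move: E1; rewrite !(mx3M, mx3Z, mx3D); congr V; congr mx3; rewrite /D; field.
have {}E2 : V (mx3 0 0 0 0 0 0 (D * g) (D * h) 0).
  by move: E2; rewrite !(mx3M, mx3Z, mx3D); congr V; congr mx3; rewrite /D; field.
have := V_lin D^-1 0 E1 E1; have := V_lin D^-1 0 E2 E2.
by rewrite !scale0r !addr0 !mx3Z !mulKf // !mulr0.
Qed.

Let V_conj z : V z -> z * (Ti * X * T) = Ti * X * T * z.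
Proof.
move=> Vz; have := V_X (V_t Vz) => /(congr1 (fun w => Ti * w * T)).
rewrite !mulrA TiK mul1r => ->.
by rewrite -!mulrA TiK mulr1 !mulrA.
Qed.

Let mulf0 (x y : rat) : x != 0 -> y * x = 0 -> y = 0.
Proof. by move=> x0 /eqP; rewrite mulf_eq0 (negbTE x0) orbF => /eqP. Qed.

Let T_inj x y z : r11 * x + r12 * y + r13 * z = 0 ->
  r21 * x + r22 * y + r23 * z = 0 -> r31 * x + r32 * y + r33 * z = 0 ->
  [/\ x = 0, y = 0 & z = 0].
Proof.
move=> e1 e2 e3; have := TK; rewrite mx3M -[RHS]/(1%:M) mx3_scalar.
move=> /mx3_inj[[a1 a2 a3] [b1 b2 b3] [c1 c2 c3]].
pose k i j l := i * (r11 * x + r12 * y + r13 * z) +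
  j * (r21 * x + r22 * y + r23 * z) + l * (r31 * x + r32 * y + r33 * z).
have k0 i j l : k i j l = 0 by rewrite /k e1 e2 e3 !mulr0 !addr0.
split.
- rewrite -(k0 t11 t12 t13); transitivity (
    (t11 * r11 + t12 * r21 + t13 * r31) * x +
    (t11 * r12 + t12 * r22 + t13 * r32) * y +
    (t11 * r13 + t12 * r23 + t13 * r33) * z); last by rewrite /k; ring.
  by rewrite a1 a2 a3; ring.
- rewrite -(k0 t21 t22 t23); transitivity (
    (t21 * r11 + t22 * r21 + t23 * r31) * x +
    (t21 * r12 + t22 * r22 + t23 * r32) * y +
    (t21 * r13 + t22 * r23 + t23 * r33) * z); last by rewrite /k; ring.
  by rewrite b1 b2 b3; ring.
- rewrite -(k0 t31 t32 t33); transitivity (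
    (t31 * r11 + t32 * r21 + t33 * r31) * x +
    (t31 * r12 + t32 * r22 + t33 * r32) * y +
    (t31 * r13 + t32 * r23 + t33 * r33) * z); last by rewrite /k; ring.
  by rewrite c1 c2 c3; ring.
Qed.

Let row_T_inj x y z : x * t11 + y * t21 + z * t31 = 0 ->
  x * t12 + y * t22 + z * t32 = 0 -> x * t13 + y * t23 + z * t33 = 0 ->
  [/\ x = 0, y = 0 & z = 0].
Proof.
move=> e1 e2 e3; have := TK; rewrite mx3M -[RHS]/(1%:M) mx3_scalar.
move=> /mx3_inj[[a1 a2 a3] [b1 b2 b3] [c1 c2 c3]].
pose k i j l := (x * t11 + y * t21 + z * t31) * i +
  (x * t12 + y * t22 + z * t32) * j + (x * t13 + y * t23 + z * t33) * l.
have k0 i j l : k i j l = 0 by rewrite /k e1 e2 e3 !mul0r !addr0.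
split.
- rewrite -(k0 r11 r21 r31); transitivity (
    x * (t11 * r11 + t12 * r21 + t13 * r31) +
    y * (t21 * r11 + t22 * r21 + t23 * r31) +
    z * (t31 * r11 + t32 * r21 + t33 * r31)); last by rewrite /k; ring.
  by rewrite a1 b1 c1; ring.
- rewrite -(k0 r12 r22 r32); transitivity (
    x * (t11 * r12 + t12 * r22 + t13 * r32) +
    y * (t21 * r12 + t22 * r22 + t23 * r32) +
    z * (t31 * r12 + t32 * r22 + t33 * r32)); last by rewrite /k; ring.
  by rewrite a2 b2 c2; ring.
- rewrite -(k0 r13 r23 r33); transitivity (
    x * (t11 * r13 + t12 * r23 + t13 * r33) +
    y * (t21 * r13 + t22 * r23 + t23 * r33) +
    z * (t31 * r13 + t32 * r23 + t33 * r33)); last by rewrite /k; ring.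
  by rewrite a3 b3 c3; ring.
Qed.

(** A nonzero column in [V] and its image under [al] are independent, so [V] contains [E13] and
    [E23]. Both [X] and [T^-1 X T] commute with these, hence are a scalar plus a third column; since
    the third row of [T] has a nonzero entry off the diagonal, the column of [X] vanishes and [X] is
    scalar. *)
Let no_col c f : V (mx3 0 0 c 0 0 f 0 0 0) -> c = 0 /\ f = 0.
Proof.
move=> Vz; apply: contrapT => cf.
pose c' := (1 - u) * c + m%:R * u * f.
pose f' := - (n%:R * u) * c + (1 + u + u ^+ 2) * f.
have Vz' : V (mx3 0 0 c' 0 0 f' 0 0 0).
  by have := V_al Vz; rewrite /al_mx /ali_mx !mx3M; congr V; congr mx3;
    rewrite /c' /f'; ring.
have d0 : c * f' - f * c' != 0.
  by apply/eqP => /eqP; rewrite subr_eq0 => /eqP/col_indep.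
have V13 : V (mx3 0 0 1 0 0 0 0 0 0).
  have := V_lin ((c * f' - f * c')^-1) 0 (V_lin f' (- f) Vz Vz') Vz.
  by rewrite !(mx3Z, mx3D); congr V; congr mx3; field.
have V23 : V (mx3 0 0 0 0 0 1 0 0 0).
  have := V_lin ((c * f' - f * c')^-1) 0 (V_lin (- c') c Vz Vz') Vz.
  by rewrite !(mx3Z, mx3D); congr V; congr mx3; field.
have shape y11 y12 y13 y21 y22 y23 y31 y32 y33 :
    (forall z, V z -> z * mx3 y11 y12 y13 y21 y22 y23 y31 y32 y33 =
      mx3 y11 y12 y13 y21 y22 y23 y31 y32 y33 * z) ->
    [/\ y31 = 0, y32 = 0, y11 = y33 & [/\ y22 = y33, y21 = 0 & y12 = 0]].
  by move=> Y; exact: comm_delta_col (Y _ V13) (Y _ V23).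
have [h31 h32 h11 [h22 h21 h12]] := shape _ _ _ _ _ _ _ _ _ V_X.
have XT : Ti * X * T = mx3
   (x33 + (r11 * x13 + r12 * x23) * t31) ((r11 * x13 + r12 * x23) * t32)
     ((r11 * x13 + r12 * x23) * t33)
   ((r21 * x13 + r22 * x23) * t31) (x33 + (r21 * x13 + r22 * x23) * t32)
     ((r21 * x13 + r22 * x23) * t33)
   ((r31 * x13 + r32 * x23) * t31) ((r31 * x13 + r32 * x23) * t32)
     (x33 + (r31 * x13 + r32 * x23) * t33).
  have -> : X = x33%:M + mx3 0 0 x13 0 0 x23 0 0 0.
    by rewrite /X mx3_scalar mx3D; congr mx3; rewrite ?h31 ?h32 ?h11 ?h22 ?h21 ?h12;
      ring.
  rewrite mulrDr mulrDl -scalemx1 -[1%:M]/1 -scalerAr mulr1 -scalerAl TiK.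
  rewrite -[1]/(1%:M) mx3_scalar /Ti /T !mx3M mx3Z mx3D; congr mx3; ring.
have := V_conj; rewrite XT => /shape[e1 e2 e3 [e4 e5 e6]].
have [h1 [h2 h3]] : r11 * x13 + r12 * x23 = 0 /\ r21 * x13 + r22 * x23 = 0 /\
    r31 * x13 + r32 * x23 = 0.
  have g3 : r31 * x13 + r32 * x23 = 0.
    by case: t_row => t0; [apply: (mulf0 t0)|apply: (mulf0 t0)].
  rewrite g3 !mul0r addr0 in e3 e4.
  split; last split=> //.
    case: t_row => t0; last exact: (mulf0 t0).
    by apply: (mulf0 t0); move: e3; set w := _ * _; lra.
  case: t_row => t0; first exact: (mulf0 t0).
  by apply: (mulf0 t0); move: e4; set w := _ * _; lra.
have [||| p0 q0 _] := @T_inj x13 x23 0; rewrite ?mulr0 ?addr0 //.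
by apply: (@X_nscal x33); rewrite /X h11 h12 h21 h22 h31 h32 p0 q0 mx3_scalar.
Qed.

(** The transposed argument, with [r_col] in place of [t_row]. *)
Let no_row g h : V (mx3 0 0 0 0 0 0 g h 0) -> g = 0 /\ h = 0.
Proof.
move=> Vz; apply: contrapT => gh.
pose g' := (1 - u) * g - n%:R * u * h.
pose h' := m%:R * u * g + (1 + u + u ^+ 2) * h.
have Vz' : V (mx3 0 0 0 0 0 0 g' h' 0).
  by have := V_ali Vz; rewrite /al_mx /ali_mx !mx3M; congr V; congr mx3;
    rewrite /g' /h'; ring.
have d0 : g * h' - h * g' != 0.
  by apply/eqP => /eqP; rewrite subr_eq0 => /eqP/row_indep.
have V31 : V (mx3 0 0 0 0 0 0 1 0 0).
  have := V_lin ((g * h' - h * g')^-1) 0 (V_lin h' (- h) Vz Vz') Vz.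
  by rewrite !(mx3Z, mx3D); congr V; congr mx3; field.
have V32 : V (mx3 0 0 0 0 0 0 0 1 0).
  have := V_lin ((g * h' - h * g')^-1) 0 (V_lin (- g') g Vz Vz') Vz.
  by rewrite !(mx3Z, mx3D); congr V; congr mx3; field.
have shape y11 y12 y13 y21 y22 y23 y31 y32 y33 :
    (forall z, V z -> z * mx3 y11 y12 y13 y21 y22 y23 y31 y32 y33 =
      mx3 y11 y12 y13 y21 y22 y23 y31 y32 y33 * z) ->
    [/\ y13 = 0, y23 = 0, y11 = y33 & [/\ y22 = y33, y21 = 0 & y12 = 0]].
  by move=> Y; exact: comm_delta_row (Y _ V31) (Y _ V32).
have [h13 h23 h11 [h22 h21 h12]] := shape _ _ _ _ _ _ _ _ _ V_X.
have XT : Ti * X * T = mx3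
   (x33 + r13 * (x31 * t11 + x32 * t21)) (r13 * (x31 * t12 + x32 * t22))
     (r13 * (x31 * t13 + x32 * t23))
   (r23 * (x31 * t11 + x32 * t21)) (x33 + r23 * (x31 * t12 + x32 * t22))
     (r23 * (x31 * t13 + x32 * t23))
   (r33 * (x31 * t11 + x32 * t21)) (r33 * (x31 * t12 + x32 * t22))
     (x33 + r33 * (x31 * t13 + x32 * t23)).
  have -> : X = x33%:M + mx3 0 0 0 0 0 0 x31 x32 0.
    by rewrite /X mx3_scalar mx3D; congr mx3; rewrite ?h13 ?h23 ?h11 ?h22 ?h21 ?h12;
      ring.
  rewrite mulrDr mulrDl -scalemx1 -[1%:M]/1 -scalerAr mulr1 -scalerAl TiK.
  rewrite -[1]/(1%:M) mx3_scalar /Ti /T !mx3M mx3Z mx3D; congr mx3; ring.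
have := V_conj; rewrite XT => /shape[e1 e2 e3 [e4 e5 e6]].
have mulf0' (x y : rat) : x != 0 -> x * y = 0 -> y = 0.
  by rewrite mulrC; exact: mulf0.
have [h1 [h2 h3]] : x31 * t11 + x32 * t21 = 0 /\ x31 * t12 + x32 * t22 = 0 /\
    x31 * t13 + x32 * t23 = 0.
  have g3 : x31 * t13 + x32 * t23 = 0.
    by case: r_col => t0; [apply: (mulf0' _ _ t0)|apply: (mulf0' _ _ t0)].
  rewrite g3 !mulr0 addr0 in e3 e4.
  split; last split=> //.
    case: r_col => t0; last exact: (mulf0' _ _ t0).
    by apply: (mulf0' _ _ t0); move: e3; set w := _ * _; lra.
  case: r_col => t0; first exact: (mulf0' _ _ t0).
  by apply: (mulf0' _ _ t0); move: e4; set w := _ * _; lra.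
have [||| p0 q0 _] := @row_T_inj x31 x32 0; rewrite ?mul0r ?addr0 //.
by apply: (@X_nscal x33); rewrite /X h11 h12 h21 h22 h13 h23 p0 q0 mx3_scalar.
Qed.

(** By [no_col] and [no_row], [z] and [T^-1 z T] are block diagonal. So the third column of [T] is
    an eigenvector of [z], and [t33_neq0] identifies its eigenvalue as the last diagonal entry [k].
    The same for [al^-1 z al] shows that [al] maps [(t13, t23)] to another eigenvector for [k]; the
    two are independent, and the upper block is [k]. *)
Lemma commutant_scalar z : V z -> exists k, z = k%:M.
Proof.
have block w : V w -> [/\ w 0 2%:R = 0, w 1 2%:R = 0, w 2%:R 0 = 0 & w 2%:R 1 = 0].
  rewrite {1}(mx3E w) => /weights[/no_col[? ?] /no_row[? ?]]; split=> //.
have eigen w : V w -> w 0 0 * t13 + w 0 1 * t23 = w 2%:R 2%:R * t13 /\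
    w 1 0 * t13 + w 1 1 * t23 = w 2%:R 2%:R * t23.
  move=> Vw; have [w1 w2 w3 w4] := block _ Vw.
  have [] := block _ (V_ti Vw); set y := Ti * w * T => y1 y2 y3 y4.
  have : w * T = T * y by rewrite /y !mulrA TK mul1r.
  rewrite {1}(mx3E w) (mx3E y) y1 y2 y3 y4 w1 w2 w3 w4 /T !mx3M.
  move=> /mx3_inj[[_ _ a] [_ _ b] [_ _ c]].
  rewrite !mul0r !mulr0 !addr0 !add0r in a b c.
  have yw : y 2%:R 2%:R = w 2%:R 2%:R.
    by apply: (mulfI t33_neq0); rewrite -c mulrC.
  by rewrite a b yw ![_ * w _ _]mulrC.
move=> Vz; have [z1 z2 z3 z4] := block z Vz; have [a1 a2] := eigen z Vz.
have [b1 b2] := eigen _ (V_ali Vz).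
move: b1 b2; rewrite (mx3E z) z1 z2 z3 z4 /al_mx /ali_mx !mx3M !mxE /=.
move: a1 a2; set a := z 0 0; set b := z 0 1; set c := z 1 0; set d := z 1 1.
set k := z 2%:R 2%:R => a1 a2 b1 b2; exists k; rewrite mx3_scalar.
pose v := (1 - u) * t13 + m%:R * u * t23.
pose w := - (n%:R * u) * t13 + (1 + u + u ^+ 2) * t23.
have d0 : t13 * w - t23 * v != 0.
  apply/eqP => /eqP; rewrite subr_eq0 => /eqP/col_indep[e1 e2].
  by case: t_col; rewrite ?e1 ?e2 eqxx.
have [c1 c2] : a * v + b * w = k * v /\ c * v + d * w = k * w.
  split.
    have := congr2 (fun p q => (1 - u) * p + m%:R * u * q) b1 b2 => e.
    match type of e with ?l = ?r => transitivity l; [|rewrite e] end;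
      by rewrite /v /w /u; ring.
  have := congr2 (fun p q => - (n%:R * u) * p + (1 + u + u ^+ 2) * q) b1 b2 => e.
  match type of e with ?l = ?r => transitivity l; [|rewrite e] end;
    by rewrite /v /w /u; ring.
have ka : a = k /\ b = 0.
  split; apply: (mulfI d0).
    transitivity ((a * t13 + b * t23) * w - (a * v + b * w) * t23); first ring.
    by rewrite a1 c1; ring.
  transitivity ((a * v + b * w) * t13 - (a * t13 + b * t23) * v); first ring.
  by rewrite a1 c1; ring.
have kd : c = 0 /\ d = k.
  split; apply: (mulfI d0).
    transitivity ((c * t13 + d * t23) * w - (c * v + d * w) * t23); first ring.
    by rewrite a2 c2; ring.
  transitivity ((c * v + d * w) * t13 - (c * t13 + d * t23) * v); first ring.
  by rewrite a2 c2; ring.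
by case: ka kd => -> -> [-> ->].
Qed.

End Commutant.

(** * A rank two obstruction to commuting *)

Section Jump.

(* If [phi] commuted with [al], the image of [phi - 1] would be an [al]-invariant
   plane through [y]; it would meet the plane [e^T k = 0] in an eigenline. *)
Lemma rank_two_not_commuting (al phi D : 'M[rat]_3) (s : rat)
  (y y' : 'cV[rat]_3) (rho rho' e : 'rV[rat]_3) :
  (forall (k : 'cV_3) mu, al *m k = mu *: k -> e *m k = 0 -> k = 0) ->
  e *m al = e -> D \in unitmx -> s != 1 ->
  phi *m D = D + (1 - s) *: (y' *m rho' - y *m rho) ->
  e *m y != 0 -> (forall mu, y' <> mu *: y) ->
  (forall u v, u *: rho + v *: rho' = 0 -> u = 0 /\ v = 0) ->
  phi *m al = al *m phi -> False.
Proof.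
move=> eig eal Du s1 phiD ey yy' rr' com.
pose P := col_mx rho rho'; pose Y := row_mx (- y) y'.
have YP : y' *m rho' - y *m rho = Y *m P.
  by rewrite /Y /P mul_row_col mulNmx addrC.
have [B PB] : exists B, P *m B = 1%:M.
  apply/row_freeP; rewrite -kermx_eq0; apply/eqP/row_matrixP => i; rewrite row0.
  have : row i (kermx P) *m P = 0 by apply/sub_kermxP; exact: row_sub.
  rewrite -[row i _](@hsubmxK _ 1 1 1) mul_row_col.
  rewrite [lsubmx _]mx11_scalar [rsubmx _]mx11_scalar !mul_scalar_mx.
  by move=> /rr'[-> ->]; rewrite raddf0 row_mx0.
pose Phi := phi - 1%:M.
have PhiD : Phi *m D = (1 - s) *: (Y *m P).
  by rewrite /Phi mulmxBl mul1mx phiD YP addrC addKr.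
have Phial : Phi *m al = al *m Phi.
  by rewrite /Phi mulmxBl mulmxBr com mul1mx mulmx1.
have s1' : 1 - s != 0 by rewrite subr_eq0 eq_sym.
have YE : Y = (1 - s)^-1 *: (Phi *m D *m B).
  by rewrite PhiD -scalemxAl -mulmxA PB mulmx1 scalerA mulVf // scale1r.
(* Commuting with [Phi], [al] preserves its image, spanned by the columns of [Y]; [N] is the matrix
   of [al] there. *)
pose N := P *m (invmx D *m al *m D *m B).
have alY : al *m Y = Y *m N.
  rewrite {1}YE -scalemxAr !mulmxA -Phial -!mulmxA.
  have -> : Phi *m (al *m (D *m B)) =
      (Phi *m D) *m (invmx D *m al *m D *m B).
    by rewrite -!mulmxA (mulKVmx Du).
  by rewrite PhiD -scalemxAl scalerA mulVf // scale1r !mulmxA.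
pose t := e *m Y.
have tN : t *m N = t by rewrite /t -mulmxA -alY mulmxA eal.
have tE : t = row_mx (- (e *m y)) (e *m y') by rewrite /t mul_mx_row mulmxN.
pose t1 := t 0 0; pose t2 := t 0 1.
have t10 : t1 != 0.
  have -> : t1 = - (e *m y) 0 0.
    transitivity (t 0 (lshift 1 0)); first by congr (t _ _); exact/val_inj.
    by rewrite tE row_mxEl mxE.
  rewrite oppr_eq0; apply: contra ey => /eqP h.
  by rewrite [e *m y]mx11_scalar h; apply/eqP; exact: raddf0.
(* [k] spans the kernel of [t = e Y]. Since [t N = t], this line is stable under [N], so [al] maps
   [Y k] to a multiple of itself, and [e] annihilates it. *)
pose k : 'cV[rat]_2 := \col_i (if i == 0 then - t2 else t1).
have two (w : 'cV[rat]_2) : t *m w = (t1 * w 0 0 + t2 * w 1 0)%:M.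
  apply/matrixP => i j; rewrite !ord1 !mxE !big_ord_recl big_ord0 addr0.
  rewrite mulr1n; congr (_ * w _ _ + t _ _ * w _ _); exact/val_inj.
have tk : t *m k = 0.
  by rewrite two !mxE /= mulrN mulrC addNr raddf0.
have Nk : N *m k = ((N *m k) 1 0 / t1) *: k.
  have : t *m (N *m k) = 0 by rewrite mulmxA tN.
  rewrite two; set w := N *m k => /matrixP/(_ 0 0).
  rewrite [LHS]mxE [RHS]mxE mulr1n => h.
  have {}h : w 0 0 = - (t2 * w 1 0) / t1.
    by apply: (mulIf t10); rewrite mulfVK // mulrC; lra.
  apply/matrixP => i j; rewrite ord1 [RHS]mxE [k _ _]mxE; case: eqP => [->|i0].
    by rewrite h; field.
  have -> : i = 1 by case: i i0 => -[|[|//]] ? h0; [case: h0|]; exact/val_inj.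
  by rewrite mulfVK.
have : Y *m k = 0.
  apply: (eig _ ((N *m k) 1 0 / t1)); last by rewrite mulmxA.
  by rewrite mulmxA alY -mulmxA {1}Nk -scalemxAr.
have -> : Y *m k = t2 *: y + t1 *: y'.
  rewrite -[k](@vsubmxK _ 1 1 1) /Y mul_row_col [usubmx _]mx11_scalar.
  rewrite [dsubmx _]mx11_scalar !mul_mx_scalar !mxE /= scalerN scaleNr opprK //.
move=> e0; apply: (yy' (- (t2 / t1))).
apply: (scalerI t10); rewrite scalerA mulrN mulrC mulfVK // scaleNr.
by apply/eqP; rewrite eq_sym -subr_eq0 -opprD oppr_eq0 e0.
Qed.

End Jump.

(** * Matrices of the generators and nonscalar elements *)

Section Representation.

Let G := RAAG P4.

(** With [X = E13 + E32] one has [X^2 = E12] and [X^3 = 0], and this matrix is [exp (r X)]. It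
    commutes with [1 + X^2], the image of the third generator. *)
Definition dx_mx (r : rat) := mx3 1 (r ^+ 2 / 2) r 0 1 0 0 r 1.

(** The second generator is scalar on the upper block, where the first and the third are elementary
    matrices; this gives the relations other than that of the last two generators. *)
Definition gen_mx (i : 'I_4) (e : bool) : 'M[rat]_3 :=
  let r : rat := if e then 1 else -1 in
  match val i with
  | 0%N => mx3 1 0 0 r 1 0 0 0 1
  | 1%N => be_mx (if e then 2 else 2^-1)
  | 2%N => mx3 1 r 0 0 1 0 0 0 1
  | _ => dx_mx r
  end.

Definition word_mx (w : word 'I_4) : 'M[rat]_3 :=
  \prod_(l <- w) gen_mx l.1 l.2.

Lemma gen_mxK i e : gen_mx i e * gen_mx i (~~ e) = 1.
Proof.
by case: i => -[|[|[|[|//]]]] ?; case: e; rewrite /gen_mx /= /be_mx /dx_mx mx3M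
  -[RHS]/(1%:M) mx3_scalar; congr mx3; field.
Qed.

Lemma gen_mx_comm i j : P4 i j -> gen_mx i true * gen_mx j true =
  gen_mx j true * gen_mx i true.
Proof.
by case: i j => -[|[|[|[|//]]]] ? [] [|[|[|[|//]]]] ? //= _;
  rewrite /gen_mx /= /be_mx /dx_mx !mx3M; congr mx3; ring.
Qed.

Lemma word_mx_eq w1 w2 :
  pres_eq [set r : word 'I_4 | exists u v, P4 u v /\ r = commutator_word u v]
    w1 w2 -> word_mx w1 = word_mx w2.
Proof.
elim=> //.
- by move=> ? ? ? _ -> _ ->.
- by move=> ? ? ? ? _ e1 _ e2; rewrite /word_mx !big_cat; congr (_ * _).
- by move=> v e; rewrite /word_mx !big_cons big_nil mulr1 gen_mxK.
move=> _ [v [w [vw ->]]]; rewrite /word_mx !big_cons big_nil mulr1 /=.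
rewrite mulrA gen_mx_comm // -mulrA [gen_mx v _ * _]mulrA.
by rewrite (gen_mxK v true) mul1r (gen_mxK w true).
Qed.

Definition rep_mx (x : G) : 'M[rat]_3 := word_mx (repr x).

Lemma rep_mx_pi w : rep_mx (\pi_(presented_group _) w) = word_mx w.
Proof. exact/word_mx_eq/pres_reprK. Qed.

Lemma rep_mxM (x y : G) : rep_mx (x * y)%g = rep_mx x * rep_mx y.
Proof. by rewrite rep_mx_pi /word_mx big_cat. Qed.

Lemma rep_mx1 : rep_mx 1%g = 1.
Proof. by rewrite rep_mx_pi /word_mx big_nil. Qed.

Lemma rep_mxX (x : G) n : rep_mx (x ^+ n)%g = rep_mx x ^+ n.
Proof.
elim: n => [|n IH]; first by rewrite expg0 rep_mx1.
by rewrite expgS rep_mxM IH exprS.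
Qed.

Lemma rep_mxVr (x : G) : rep_mx x * rep_mx x^-1%g = 1.
Proof. by rewrite -rep_mxM mulgV rep_mx1. Qed.

Lemma rep_mxVl (x : G) : rep_mx x^-1%g * rep_mx x = 1.
Proof. by rewrite -rep_mxM mulVg rep_mx1. Qed.

Definition raag_gen (i : 'I_4) : G := \pi_(presented_group _) [:: (i, true)].

Lemma rep_gen i : rep_mx (raag_gen i) = gen_mx i true.
Proof. by rewrite rep_mx_pi /word_mx big_cons big_nil mulr1. Qed.

Lemma raag_comm i j : P4 i j ->
  (raag_gen i * raag_gen j = raag_gen j * raag_gen i)%g.
Proof.
have M (w1 w2 : word 'I_4) : ((\pi_(presented_group _) w1 : G) *
    (\pi_(presented_group _) w2 : G) = (\pi_(presented_group _) (w1 ++ w2) : G))%g.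
  exact: pres_mulE.
have V (w : word 'I_4) : (\pi_(presented_group _) w : G)^-1%g =
    (\pi_(presented_group _) (word_inv w) : G) by exact: pres_invE.
move=> ij; apply: (mulIg (raag_gen i)^-1%g); rewrite mulgK.
apply: (mulIg (raag_gen j)^-1%g); rewrite mulgV.
have -> : (raag_gen i * raag_gen j * (raag_gen i)^-1 * (raag_gen j)^-1)%g =
    (\pi_(presented_group _) (commutator_word i j) : G).
  rewrite /raag_gen !V (M [:: (i, true)] [:: (j, true)]).
  rewrite (M [:: (i, true); (j, true)] [:: (i, false)]).
  by rewrite (M [:: (i, true); (j, true); (i, false)] [:: (j, false)]).
apply/pres_piP.
by apply: pres_eq_rel; exists i, j.
Qed.

Definition nonscalar (x : G) : Prop := forall k, rep_mx x <> k%:M.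

(** A scalar commutator [k] means [x y = k y x]. Determinants give [k^3 = 1], and 1 is the only
    rational cube root of 1. *)
Lemma comm_scalar (x y : G) : ~ nonscalar (comm x y) ->
  rep_mx x * rep_mx y = rep_mx y * rep_mx x.
Proof.
move=> /existsNP[k /contrapT]; rewrite /comm !rep_mxM => e.
have {}e : rep_mx x * rep_mx y = k *: (rep_mx y * rep_mx x).
  have := congr1 (fun A => A * rep_mx y * rep_mx x) e.
  rewrite -[_ * rep_mx y^-1%g * rep_mx y]mulrA rep_mxVl mulr1.
  rewrite -[_ * rep_mx x^-1%g * rep_mx x]mulrA rep_mxVl mulr1 => ->.
  by rewrite -scalemx1 -[1%:M]/1 -!scalerAl mul1r.
have du z : \det (rep_mx z) != 0.
  have := congr1 (@determinant _ 3) (rep_mxVr z).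
  rewrite det_mulmx det1 => h; apply/eqP => h0; move: h; rewrite h0 mul0r.
  by move/eqP; rewrite eq_sym oner_eq0.
have := congr1 (@determinant _ 3) e; rewrite detZ !det_mulmx.
rewrite [\det (rep_mx y) * _]mulrC -[LHS]mul1r => /mulIf h.
have k3 : k ^+ 3 = 1 by rewrite h // mulf_neq0.
suff k1 : k = 1 by rewrite e k1 scale1r.
have : (k - 1) * (k ^+ 2 + k + 1) = 0.
  by transitivity (k ^+ 3 - 1); [ring|rewrite k3 subrr].
move/eqP; rewrite mulf_eq0 subr_eq0 => /orP[/eqP//|/eqP h0].
have : 0 < k ^+ 2 + k + 1 by nra.
by rewrite h0 ltxx.
Qed.

Lemma nonscalar_conj (g x : G) : nonscalar x -> nonscalar (g * x * g^-1)%g.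
Proof.
move=> nx k; rewrite !rep_mxM => e; apply: (nx k).
have := congr1 (fun A => rep_mx g^-1%g * A * rep_mx g) e.
rewrite !mulrA rep_mxVl mul1r -mulrA rep_mxVl mulr1 => ->.
by rewrite -scalemx1 -[1%:M]/1 -scalerAr mulr1 -scalerAl rep_mxVl.
Qed.

(** For a list whose images span a subspace of maximal dimension, every further [phi g] lies in that
    span. *)
Lemma commutant_list (S : set G) (phi : G -> 'M[rat]_3) : exists2 s : seq G,
  forall g, g \in s -> S g &
  forall Z, (forall g, g \in s -> Z * phi g = phi g * Z) ->
    forall g, S g -> Z * phi g = phi g * Z.
Proof.
pose P d := `[< exists2 s : seq G, forall g, g \in s -> S g &
  \dim <<[seq phi g | g <- s]>> = d >].
have exP : exists d, P d by exists (\dim <<[seq phi g | g <- [::]]>>);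
  apply/asboolP; exists [::].
have Pmax d : P d -> (d <= dim 'M[rat]_3)%N.
  by move/asboolP => [s _ <-]; rewrite -dimvf dimvS ?subvf.
have [d /asboolP[s sS ds] dmax] := ex_maxnP exP Pmax.
exists s => // Z Zs g Sg.
have gs : phi g \in <<[seq phi g | g <- s]>>%VS.
  have sub : (<<[seq phi g | g <- s]>> <= <<[seq phi h | h <- g :: s]>>)%VS.
    by rewrite /= span_cons addvSr.
  have /eqP e : <<[seq phi g | g <- s]>>%VS == <<[seq phi h | h <- g :: s]>>%VS.
    rewrite eqEdim sub ds; apply: dmax; apply/asboolP; exists (g :: s) => //.
    by move=> h; rewrite inE => /predU1P[->|/sS].
  by rewrite e memv_span //= mem_head.
rewrite (coord_span (X := in_tuple _) gs) mulr_sumr mulr_suml.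
apply: eq_bigr => i _; rewrite -scalerAr -scalerAl; congr (_ *: _).
have /mapP[h hs ->] : (in_tuple [seq phi g | g <- s])`_i \in [seq phi g | g <- s].
  by apply: mem_nth; rewrite /=.
exact: Zs.
Qed.

Lemma aX_mx n : gen_mx 0 true ^+ n = mx3 1 0 0 n%:R 1 0 0 0 1.
Proof.
elim: n => [|n IH].
  by rewrite expr0 -[LHS]/(1%:M) mx3_scalar.
by rewrite exprS IH /gen_mx /= mx3M; congr mx3; rewrite -?natr1; ring.
Qed.

Lemma cX_mx n : gen_mx 2%:R true ^+ n = mx3 1 n%:R 0 0 1 0 0 0 1.
Proof.
elim: n => [|n IH].
  by rewrite expr0 -[LHS]/(1%:M) mx3_scalar.
by rewrite exprS IH /gen_mx /= mx3M; congr mx3; rewrite -?natr1; ring.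
Qed.

Lemma bX_mx n : gen_mx 1 true ^+ n = be_mx (2 ^+ n).
Proof.
elim: n => [|n IH].
  by rewrite !expr0 -[LHS]/(1%:M) mx3_scalar.
by rewrite exprS IH /gen_mx /= /be_mx mx3M; congr mx3; rewrite ?exprS; ring.
Qed.

Lemma dX_mx n : gen_mx 3%:R true ^+ n = dx_mx n%:R.
Proof.
elim: n => [|n IH].
  by rewrite expr0 -[LHS]/(1%:M) mx3_scalar /dx_mx; congr mx3; field.
by rewrite exprS IH /gen_mx /= /dx_mx mx3M; congr mx3; rewrite -?natr1; field.
Qed.

Lemma dx_mxK r : dx_mx r * dx_mx (- r) = 1.
Proof.
by rewrite /dx_mx mx3M -[RHS]/(1%:M) mx3_scalar; congr mx3; field.
Qed.

Lemma be_mxK r : r != 0 -> be_mx r * be_mx r^-1 = 1.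
Proof.
by move=> r0; rewrite /be_mx mx3M -[RHS]/(1%:M) mx3_scalar; congr mx3; field.
Qed.

Lemma rep_mx_inv (x : G) (A B : 'M[rat]_3) : rep_mx x = A -> A * B = 1 ->
  rep_mx x^-1%g = B.
Proof.
move=> xA AB; rewrite -[LHS]mulr1 -AB -xA mulrA rep_mxVl mul1r //.
Qed.

End Representation.

(** * Nontriviality for powers of the generators *)

Section RaagNontriviality.

Let G := RAAG P4.
Variables (i j k N : nat).
Hypotheses (i0 : (0 < i)%N) (j0 : (0 < j)%N) (k0 : (0 < k)%N) (N1 : (1 < N)%N).

Let a : G := (raag_gen 0 ^+ i)%g.
Let b : G := (raag_gen 1%R ^+ j)%g.
Let c : G := (raag_gen 2%:R ^+ k)%g.
Let d : G := (raag_gen 3%:R ^+ N)%g.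

Section Fixed.
Variables (n m l : nat).
Hypotheses (n0 : (0 < n)%N) (m0 : (0 < m)%N) (l0 : (0 < l)%N).
Let al : G := comm (a ^+ n)%g (c ^+ m)%g.
Let be : G := (b ^+ l)%g.
Let n' := (i * n)%N.
Let m' := (k * m)%N.
Let s : rat := 2 ^+ (j * l).
Let u : rat := n'%:R * m'%:R.
Let r : rat := N%:R.

Let n'0 : (0 < n')%N. Proof. by rewrite muln_gt0 i0. Qed.
Let m'0 : (0 < m')%N. Proof. by rewrite muln_gt0 k0. Qed.

Let s1 : 1 < s.
Proof. by rewrite exprn_egt1 // muln_eq0 negb_or -!lt0n j0. Qed.

Let s0 : s != 0. Proof. by rewrite gt_eqF // (lt_trans ltr01). Qed.

Let rep_al : rep_mx al = al_mx n' m'.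
Proof.
have aE : rep_mx (a ^+ n)%g = mx3 1 0 0 n'%:R 1 0 0 0 1.
  by rewrite -expgnA rep_mxX rep_gen aX_mx.
have cE : rep_mx (c ^+ m)%g = mx3 1 m'%:R 0 0 1 0 0 0 1.
  by rewrite -expgnA rep_mxX rep_gen cX_mx.
have aVE : rep_mx (a ^+ n)^-1%g = mx3 1 0 0 (- n'%:R) 1 0 0 0 1.
  apply: (rep_mx_inv aE).
  by rewrite mx3M -[RHS]/(1%:M) mx3_scalar; congr mx3; ring.
have cVE : rep_mx (c ^+ m)^-1%g = mx3 1 (- m'%:R) 0 0 1 0 0 0 1.
  apply: (rep_mx_inv cE).
  by rewrite mx3M -[RHS]/(1%:M) mx3_scalar; congr mx3; ring.
rewrite /al /comm 3!rep_mxM aE cE aVE cVE !mx3M /al_mx.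
by congr mx3; ring.
Qed.

Let rep_ali : rep_mx al^-1%g = ali_mx n' m'.
Proof. exact: rep_mx_inv rep_al (al_mxK n' m'). Qed.

Let rep_be : rep_mx be = be_mx s.
Proof. by rewrite /be -expgnA rep_mxX rep_gen bX_mx. Qed.

Let rep_bei : rep_mx be^-1%g = be_mx s^-1.
Proof. exact: rep_mx_inv rep_be (be_mxK s0). Qed.

Let rep_d : rep_mx d = dx_mx r.
Proof. by rewrite rep_mxX rep_gen dX_mx. Qed.

Let rep_di : rep_mx d^-1%g = dx_mx (- r).
Proof. exact: rep_mx_inv rep_d (dx_mxK r). Qed.

(** The ways in which [T] must mix the upper block with the third basis vector, for
    [commutant_scalar] and for the jump word. *)
Let good (T Ti : 'M[rat]_3) : Prop :=
  [/\ T 0 2%:R != 0 \/ T 1 2%:R != 0, T 2%:R 2%:R != 0,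
      T 2%:R 0 != 0 \/ T 2%:R 1 != 0, Ti 0 2%:R != 0 \/ Ti 1 2%:R != 0 &
      Ti 2%:R 2%:R != 0].

Let r0 : 1 < r. Proof. by rewrite ltr1n. Qed.
Let p0 : 0 < n'%:R :> rat. Proof. by rewrite ltr0n. Qed.
Let q0 : 0 < m'%:R :> rat. Proof. by rewrite ltr0n. Qed.
Let u0 : 0 < u. Proof. by rewrite mulr_gt0. Qed.

Let rep_t (t : G) : t = (d * al * d^-1)%g \/ t = (d * be * d^-1)%g ->
  good (rep_mx t) (rep_mx t^-1%g).
Proof.
have r00 : r != 0 by rewrite gt_eqF // (lt_trans ltr01).
have cE g : rep_mx (d * g * d^-1)%g = dx_mx r * rep_mx g * dx_mx (- r).
  by rewrite !rep_mxM rep_d rep_di.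
have cV g : rep_mx (d * g * d^-1)^-1%g =
    dx_mx r * rep_mx g^-1%g * dx_mx (- r).
  by rewrite 2!invgM invgK mulgA cE.
case=> ->; rewrite cE cV.
  rewrite rep_al rep_ali /dx_mx /al_mx /ali_mx !mx3M /good !mxE /= -/u.
  split.
  - right; rewrite (_ : _ + _ = r * (n'%:R * u)); last by ring.
    by rewrite !mulf_neq0 // gt_eqF.
  - rewrite (_ : _ + _ = 1 + r ^+ 2 * (n'%:R * u)); last by ring.
    by rewrite gt_eqF // addr_gt0 // mulr_gt0 ?exprn_gt0 ?mulr_gt0 // (lt_trans ltr01).
  - left; rewrite (_ : _ + _ = - (r * (n'%:R * u))); last by ring.
    by rewrite oppr_eq0 !mulf_neq0 // gt_eqF.
  - right; rewrite (_ : _ + _ = - (r * (n'%:R * u))); last by ring.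
    by rewrite oppr_eq0 !mulf_neq0 // gt_eqF.
  (* This entry would vanish for [r = n' = m' = 1]; here [1 < N] enters. *)
  rewrite [X in X != 0](_ : _ = 1 - r ^+ 2 * (n'%:R * u)); last by ring.
  rewrite subr_eq0 lt_eqF //.
  have nu : 1 <= n'%:R * u by rewrite /u -!natrM ler1n muln_gt0 n'0 muln_gt0 n'0 m'0.
  have : 1 < r ^+ 2 by rewrite exprn_egt1.
  by move=> h; rewrite (lt_le_trans h) // ler_peMr // ltW // (lt_trans ltr01).
have s1' : 1 - s != 0 by rewrite subr_eq0 lt_eqF.
have s1'' : 1 - s^-1 != 0 by rewrite subr_eq0 eq_sym invr_eq1 gt_eqF.
rewrite rep_be rep_bei /dx_mx /be_mx !mx3M /good !mxE /=.
split.
- left; rewrite (_ : _ + _ = r * (1 - s)); last by ring.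
  by rewrite mulf_neq0.
- by rewrite (_ : _ + _ = 1) ?oner_eq0 //; ring.
- right; rewrite (_ : _ + _ = - (r * (1 - s))); last by ring.
  by rewrite oppr_eq0 mulf_neq0.
- left; rewrite (_ : _ + _ = r * (1 - s^-1)); last by ring.
  by rewrite mulf_neq0.
- by rewrite (_ : _ + _ = 1) ?oner_eq0 //; ring.
Qed.

Lemma raag_nt_al : nonscalar al.
Proof.
move=> x; rewrite rep_al /al_mx mx3_scalar => /mx3_inj[[_ h _] _ _].
by move/eqP: h; rewrite mulf_eq0 !gt_eqF.
Qed.

Lemma raag_nt_be : nonscalar be.
Proof.
move=> x; rewrite rep_be /be_mx mx3_scalar.
by move=> /mx3_inj[[h _ _] _ [_ _ h']]; move: s1; rewrite h -h' ltxx.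
Qed.

(** If the commutators with all conjugates from the list were scalar, [z] would commute with these,
    hence with all conjugates of [x] by elements of [K]. The matrices that do so are stable under
    conjugation by [K], which is the setting of [commutant_scalar]. *)
Lemma raag_nt_list (t : G) :
  t = (d * al * d^-1)%g \/ t = (d * be * d^-1)%g -> forall x, nonscalar x ->
  exists2 S : seq G, forall g, g \in S -> generated_by [:: al; be; t] g &
    forall z, nonscalar z ->
      exists2 g, g \in S & nonscalar (comm z (g * x * g^-1))%g.
Proof.
move=> /rep_t[t1 t2 t3 t4 _] x ntx; pose K := generated_by [:: al; be; t].
have K1 : K 1%g by move=> ? ? _ _ _.
have KM g h : K g -> K h -> K (g * h)%g.
  move=> Kg Kh Q Q1 QM QV Qs.
  by apply: (QM _ _ (Kg Q Q1 QM QV Qs)); exact: Kh.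
have KV g : K g -> K g^-1%g.
  by move=> Kg Q Q1 QM QV Qs; apply: (QV _ (Kg Q Q1 QM QV Qs)).
have Ks g : g \in [:: al; be; t] -> K g by move=> gs Q _ _ _; apply.
have [S SK HS] := commutant_list K (fun g => rep_mx (g * x * g^-1)%g).
exists S => // z ntz; apply: contrapT => Hz.
have {}Hz : forall g, K g ->
    rep_mx z * rep_mx (g * x * g^-1)%g = rep_mx (g * x * g^-1)%g * rep_mx z.
  apply: HS => g gS; apply: comm_scalar => nt.
  by apply: Hz; exists g.
pose V := [set Z : 'M[rat]_3 | forall g, K g ->
  Z * rep_mx (g * x * g^-1)%g = rep_mx (g * x * g^-1)%g * Z].
have VJ h Z : K h -> V Z -> V (rep_mx h * Z * rep_mx h^-1%g).
  move=> Kh VZ g Kg.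
  have := VZ _ (KM _ _ (KV _ Kh) Kg); set M := rep_mx (g * x * g^-1)%g.
  have -> : rep_mx (h^-1 * g * x * (h^-1 * g)^-1)%g =
      rep_mx h^-1%g * M * rep_mx h.
    by rewrite /M -!rep_mxM invgM invgK !mulgA.
  move=> e; transitivity
    (rep_mx h * (Z * (rep_mx h^-1%g * M * rep_mx h)) * rep_mx h^-1%g).
    by rewrite -!mulrA rep_mxVr mulr1.
  by rewrite e !mulrA rep_mxVr mul1r.
have VJi h Z : K h -> V Z -> V (rep_mx h^-1%g * Z * rep_mx h).
  by move=> Kh VZ; have := VJ h^-1%g Z (KV _ Kh) VZ; rewrite invgK.
have Kal : K al by apply: Ks; rewrite !inE eqxx.
have Kbe : K be by apply: Ks; rewrite !inE eqxx orbT.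
have Kt : K t by apply: Ks; rewrite !inE eqxx !orbT.
have [] : exists q, rep_mx z = q%:M; last by move=> q; exact: ntz.
have TK := rep_mxVr t; have TiK := rep_mxVl t.
rewrite (mx3E (rep_mx t)) (mx3E (rep_mx t^-1%g)) in TK TiK.
apply: (commutant_scalar n'0 m'0 s1 TK TiK t1 t2 t3 t4 (V := V)
  (x11 := rep_mx x 0 0) (x12 := rep_mx x 0 1) (x13 := rep_mx x 0 2%:R)
  (x21 := rep_mx x 1 0) (x22 := rep_mx x 1 1) (x23 := rep_mx x 1 2%:R)
  (x31 := rep_mx x 2%:R 0) (x32 := rep_mx x 2%:R 1) (x33 := rep_mx x 2%:R 2%:R));
  rewrite -?mx3E.
- move=> p q Z W VZ VW g Kg; rewrite mulrDl mulrDr -!scalerAl -!scalerAr.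
  by rewrite VZ // VW.
- by move=> Z VZ; rewrite -rep_al -rep_ali; exact: VJ.
- by move=> Z VZ; rewrite -rep_al -rep_ali; exact: VJi.
- by move=> Z VZ; rewrite -rep_be -rep_bei; exact: VJ.
- by move=> Z VZ; rewrite -rep_be -rep_bei; exact: VJi.
- by move=> Z VZ; exact: VJ.
- by move=> Z VZ; exact: VJi.
- by move=> Z /(_ 1%g K1); rewrite mul1g invg1 mulg1.
- exact: ntx.
- exact: Hz.
Qed.

Let e : 'rV[rat]_3 := delta_mx 0 2%:R.
Let f : 'cV[rat]_3 := delta_mx 2%:R 0.

(** Being a scalar plus a rank one matrix passes to the conjugates of [be]. The inner commutator of
    the jump word therefore differs from the identity by rank at most two. *)
Let be_mxE (q : rat) : be_mx q = q%:M + (1 - q) *: (f *m e).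
Proof.
rewrite mul_delta_mx mx3_scalar [in RHS](mx3E (_ *: _)) mx3D.
by congr mx3; rewrite !mxE /=; ring.
Qed.

Let al_colE (v : 'cV[rat]_3) mu : al_mx n' m' *m v = mu *: v ->
  v 0 0 = 0 /\ v 1 0 = 0.
Proof.
move=> E; apply: (@al_eigencol n' m' n'0 m'0 _ _ mu).
  have := congr1 (fun A : 'cV_3 => A 0 0) E.
  rewrite !mxE !big_ord_recl big_ord0 !mxE /= -/u => <-.
  rewrite mul0r !addr0; congr (_ * _ + _ * v _ _); exact/val_inj.
have := congr1 (fun A : 'cV_3 => A 1 0) E.
rewrite !mxE !big_ord_recl big_ord0 !mxE /= -/u => <-.
rewrite mul0r !addr0; congr (_ * _ + _ * v _ _); exact/val_inj.
Qed.

Let al_rowE (v : 'rV[rat]_3) mu : v *m al_mx n' m' = mu *: v ->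
  v 0 0 = 0 /\ v 0 1 = 0.
Proof.
move=> E; apply: (@al_eigenrow n' m' n'0 m'0 _ _ mu).
  have := congr1 (fun A : 'rV_3 => A 0 0) E.
  rewrite !mxE !big_ord_recl big_ord0 !mxE /= -/u => <-.
  rewrite mulr0 !addr0 (_ : lift ord0 ord0 = 1 :> 'I_3); last exact/val_inj.
  by rewrite -[ord0]/(0 : 'I_3); ring.
have := congr1 (fun A : 'rV_3 => A 0 1) E.
rewrite !mxE !big_ord_recl big_ord0 !mxE /= -/u => <-.
rewrite mulr0 !addr0 (_ : lift ord0 ord0 = 1 :> 'I_3); last exact/val_inj.
by rewrite -[ord0]/(0 : 'I_3); ring.
Qed.

Lemma raag_nt_jump (t : G) :
  t = (d * al * d^-1)%g \/ t = (d * be * d^-1)%g ->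
  nonscalar (jump_word al be (t * al * t^-1) (t * be * t^-1))%g.
Proof.
move=> /rep_t[t1 t2 t3 t4 t5]; apply: contrapT => Hscal.
(* [dl] is the conjugate of [be] by [p] and [ga dl ga^-1] its conjugate by [ga p]; each contributes
   one rank one term to [phD] below. *)
pose ga := (t * al * t^-1)%g; pose p := (be * t)%g.
pose dl := (p * be * p^-1)%g; pose ph := (ga * dl * ga^-1 * dl^-1)%g.
have jE : jump_word al be (t * al * t^-1) (t * be * t^-1) = comm ph al.
  rewrite /jump_word /comm -/ga.
  have -> : (be * (t * be * t^-1) * be^-1)%g = dl by rewrite /dl /p invgM !mulgA.
  have -> : (be * (t * be * t^-1)^-1 * be^-1)%g = dl^-1%g.
    by rewrite /dl /p -[(be * t * be)%g]mulgA !invgM !invgK !mulgA.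
  by rewrite /ph; move: (ga) (dl) => g1 g2; rewrite !invgM !invgK !mulgA.
rewrite jE in Hscal; have {Hscal jE} com := comm_scalar Hscal.
set T := rep_mx t in t1 t2 t3 t4 t5; set Ti := rep_mx t^-1%g in t1 t2 t3 t4 t5.
have TK : T *m Ti = 1%:M by exact: rep_mxVr.
have TiK : Ti *m T = 1%:M by exact: rep_mxVl.
have conjE (h : G) : rep_mx (h * be * h^-1)%g =
    s%:M + (1 - s) *: ((rep_mx h *m f) *m (e *m rep_mx h^-1%g)).
  rewrite 2!rep_mxM rep_be be_mxE mulrDr mulrDl -[s%:M]scalemx1.
  rewrite -[1%:M]/1 -scalerAr mulr1 -!scalerAl rep_mxVr -scalerAr -scalerAl.
  by rewrite -!mulmxE !mulmxA.
pose y := rep_mx p *m f; pose rho := e *m rep_mx p^-1%g.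
pose y' := rep_mx (ga * p)%g *m f; pose rho' := e *m rep_mx (ga * p)^-1%g.
have phD : rep_mx ph *m rep_mx dl =
    rep_mx dl + (1 - s) *: (y' *m rho' - y *m rho).
  transitivity (rep_mx (ga * p * be * (ga * p)^-1)%g).
    rewrite mulmxE -rep_mxM; congr rep_mx.
    by rewrite /ph /dl mulgVK !invgM !mulgA.
  by rewrite !conjE scalerBr -/y -/rho -/y' -/rho' -addrA [X in _ = _ + X]addrC subrK.
have tE (h : G) : rep_mx (t * h * t^-1)%g = T *m rep_mx h *m Ti.
  by rewrite !rep_mxM.
have y'E : y' = T *m (al_mx n' m' *m (Ti *m y)).
  by rewrite /y' /y rep_mxM -mulmxE tE rep_al !mulmxA.
have rho'E : rho' = rho *m T *m ali_mx n' m' *m Ti.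
  have gaV : (ga^-1 = t * al^-1 * t^-1)%g by rewrite /ga 2!invgM invgK mulgA.
  by rewrite /rho' /rho invgM rep_mxM gaV -mulmxE tE rep_ali !mulmxA.
have s1' : 1 - s != 0 by rewrite subr_eq0 lt_eqF.
have si1 : 1 - s^-1 != 0 by rewrite subr_eq0 eq_sym invr_eq1 gt_eqF.
have entry (A : 'M[rat]_3) : e *m A *m f = (A 2%:R 2%:R)%:M.
  by rewrite -rowE -colE [LHS]mx11_scalar !mxE.
have TiyE : Ti *m y = s *: f + ((1 - s) * T 2%:R 2%:R) *: (Ti *m f).
  rewrite /y /p rep_mxM -mulmxE rep_be be_mxE mulmxDl mulmxDl mulmxDr.
  congr (_ + _).
    by rewrite mul_scalar_mx -scalemxAl -scalemxAr mulmxA TiK mul1mx.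
  rewrite -!scalemxAl -scalemxAr -scalerA; congr (_ *: _).
  have -> : f *m e *m rep_mx t *m f = f *m (e *m T *m f) by rewrite !mulmxA.
  by rewrite entry mulmxA mul_mx_scalar.
have rhoTE : rho *m T = s^-1 *: e + ((1 - s^-1) * Ti 2%:R 2%:R) *: (e *m T).
  rewrite /rho /p invgM rep_mxM -mulmxE rep_bei be_mxE mulmxDr mulmxDr mulmxDl.
  congr (_ + _).
    by rewrite mul_mx_scalar -scalemxAr -scalemxAl -mulmxA TiK mulmx1.
  rewrite -!scalemxAr -scalemxAl -scalerA; congr (_ *: _).
  have -> : e *m (rep_mx t^-1%g *m (f *m e)) *m T = (e *m Ti *m f) *m (e *m T).
    by rewrite !mulmxA.
  by rewrite entry mul_scalar_mx.
apply: (@rank_two_not_commuting (al_mx n' m') (rep_mx ph) (rep_mx dl) s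
  y y' rho rho' e) => //.
- move=> v mu /al_colE[v0 v1] ek; apply/matrixP => q q'.
  rewrite ord1 !mxE; move: q; apply: I3_cases => //.
  by move: ek; rewrite -rowE => /matrixP/(_ 0 0); rewrite !mxE.
- rewrite -rowE; apply/matrixP => q q'; rewrite ord1 !mxE.
  by move: q'; apply: I3_cases; rewrite /= ?eqxx.
- by case/mulmx1_unit: (rep_mxVr dl).
- by rewrite gt_eqF.
- have ebe : e *m be_mx s = e.
    rewrite -rowE; apply/matrixP => q q'; rewrite ord1 !mxE.
    by move: q'; apply: I3_cases; rewrite /= ?eqxx.
  have -> : e *m y = (T 2%:R 2%:R)%:M.
    by rewrite /y /p rep_mxM -mulmxE rep_be !mulmxA ebe entry.
  by apply: contra t2 => /eqP/matrixP/(_ 0 0); rewrite !mxE mulr1n => ->.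
- move=> mu e1; have : al_mx n' m' *m (Ti *m y) = mu *: (Ti *m y).
    by rewrite -[LHS]mul1mx -TiK -mulmxA -y'E e1 -scalemxAr.
  have colTi q : (Ti *m f) q 0 = Ti q 2%:R by rewrite -colE mxE.
  have yq q : (Ti *m y) q 0 = s * f q 0 + (1 - s) * T 2%:R 2%:R * Ti q 2%:R.
    by rewrite TiyE mxE [X in X + _]mxE [X in _ + X]mxE colTi.
  move/al_colE; rewrite !yq ![f _ _]mxE /= !mulr0 !add0r => -[/eqP h1 /eqP h2].
  by move: h1 h2; rewrite !mulf_eq0 (negbTE s1') (negbTE t2) /=;
    case: t4 => /negbTE ->.
- have rowT q : (e *m T) 0 q = T 2%:R q by rewrite -rowE mxE.
  have w0 : (rho *m T) 0 0 != 0 \/ (rho *m T) 0 1 != 0.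
    have rq q : (rho *m T) 0 q =
        s^-1 * e 0 q + (1 - s^-1) * Ti 2%:R 2%:R * T 2%:R q.
      by rewrite rhoTE mxE [X in X + _]mxE [X in _ + X]mxE rowT.
    rewrite !rq ![e _ _]mxE /= !mulr0 !add0r.
    by rewrite !mulf_eq0 (negbTE si1) (negbTE t5).
  have noeig mu : rho *m T *m al_mx n' m' <> mu *: (rho *m T).
    by move/al_rowE => [h1 h2]; case: w0; rewrite ?h1 ?h2 eqxx.
  move=> v w /(congr1 (fun A => A *m T *m al_mx n' m')).
  rewrite rho'E 2!mulmxDl -!scalemxAl -[_ *m Ti *m T]mulmxA TiK mulmx1.
  rewrite -[_ *m ali_mx n' m' *m _]mulmxA (ali_mxK n' m' : _ *m _ = 1%:M) mulmx1.
  rewrite !mul0mx => E.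
  have [v0|v0] := eqVneq v 0.
    move: E; rewrite v0 scale0r add0r => E; split=> //.
    apply/eqP; apply: contrapT => /negP w0'.
    apply: (noeig 0); rewrite scale0r.
    have -> : rho *m T = 0 by apply: (scalerI w0'); rewrite E scaler0.
    by rewrite mul0mx.
  case: (noeig (- (w / v))); apply: (scalerI v0).
  rewrite scalerA mulrN mulrC mulfVK // scaleNr.
  by apply/eqP; rewrite -subr_eq0 opprK E.
- by rewrite -rep_al !mulmxE.
Qed.

End Fixed.

Lemma raag_nontriviality : nontriviality nonscalar a b c d.
Proof.
split.
- exact: nonscalar_conj.
- by move=> n m n0 m0; exact: raag_nt_al.
- by move=> l l0; exact: raag_nt_be.
- by move=> n m l n0 m0 l0 al be t tE; exact: raag_nt_jump.
- by move=> n m l n0 m0 l0 al be t tE; exact: raag_nt_list.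
Qed.

End RaagNontriviality.

(** * Smooth changes of parameter *)

Section Smooth.
Variable R : realType.
Implicit Types (w u f g : R -> R) (a b x y : R).

(** These are diffeomorphisms of the whole line. Maps given on an interval are replaced by such
    extensions, so that composition and inversion carry no domains. *)
Definition sm w w' := [/\ forall x, der_at setT w x (w' x),
  forall x, cont_at setT w' x, forall x, 0 < w' x,
  forall y, exists x, w x = y & forall a b, dmono a b (@ln R \o w')].

Lemma dmono_eq a b (f g : R -> R) : (forall x, a <= x <= b -> f x = g x) ->
  dmono a b f -> dmono a b g.
Proof.
by move=> fg [P [N [Pm Nm H]]]; exists P, N; split=> // x xab; rewrite -fg // H.
Qed.

Lemma dmono_add a b (f g : R -> R) : dmono a b f -> dmono a b g ->
  dmono a b (fun x => f x + g x).
Proof.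
move=> [P [N [Pm Nm H]]] [P1 [N1 [P1m N1m H1]]].
exists (fun x => P x + P1 x), (fun x => N x + N1 x); split.
- by move=> x y xy; rewrite lerD ?Pm ?P1m.
- by move=> x y xy; rewrite lerD ?Nm ?N1m.
- by move=> x xab; rewrite H // H1 //; ring.
Qed.

Lemma dmono_opp a b (f : R -> R) : dmono a b f -> dmono a b (fun x => - f x).
Proof.
move=> [P [N [Pm Nm H]]]; exists N, P; split=> // x xab; rewrite H //; ring.
Qed.

Lemma dmono_mono a b (f : R -> R) : {homo f : x y / x <= y} -> dmono a b f.
Proof. by move=> fm; exists f, (fun=> 0); split=> // x _; rewrite subr0. Qed.

Lemma dmono_comp a b (f g : R -> R) : {homo g : x y / x <= y} ->
  dmono (g a) (g b) f -> dmono a b (f \o g).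
Proof.
move=> gm [P [N [Pm Nm H]]]; exists (P \o g), (N \o g); split=> [x y h|x y h|x h].
- by apply: Pm; exact: gm.
- by apply: Nm; exact: gm.
- by rewrite /= H // !gm //; lra.
Qed.

Lemma dmono_sub a b c d (f : R -> R) : a <= c -> d <= b -> dmono a b f ->
  dmono c d f.
Proof.
move=> ac db [P [N [Pm Nm H]]]; exists P, N; split=> // x xcd; apply: H; lra.
Qed.

Lemma dmono_glue a b c (f : R -> R) : a <= b -> b <= c ->
  dmono a b f -> dmono b c f -> dmono a c f.
Proof.
move=> ab bc [P [N [Pm Nm H]]] [P1 [N1 [P1m N1m H1]]].
(* On the other side of [b] each decomposition is frozen at its value in [b]; the constant [f b]
   corrects for the value there being counted twice. *)
exists (fun x => P (Num.min x b) + P1 (Num.max x b)),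
  (fun x => N (Num.min x b) + N1 (Num.max x b) + f b); split.
- move=> x y xy; rewrite lerD ?Pm ?P1m //.
    by rewrite le_min ge_min xy /= ge_min lexx orbT.
  by rewrite ge_max le_max xy /= le_max lexx orbT.
- move=> x y xy; rewrite lerD2r lerD ?Nm ?N1m //.
    by rewrite le_min ge_min xy /= ge_min lexx orbT.
  by rewrite ge_max le_max xy /= le_max lexx orbT.
- move=> x xac; case: (lerP x b) => xb.
    by rewrite (H x) 1?(H1 b) ?lexx //; [ring|lra].
  by rewrite (H1 x) 1?(H b) ?lexx ?ab //; [ring|lra].
Qed.

Lemma cont_cst I (k x : R) : cont_at I (fun=> k) x.
Proof. by move=> e e0; exists 1 => // y _ _; rewrite subrr normr0. Qed.

Lemma sm_affine k l : 0 < k -> sm (fun x => k * x + l) (fun=> k).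
Proof.
move=> k0; split=> // [x|x|y|a b].
- exact: der_affine.
- exact: cont_cst.
- by exists ((y - l) / k); field; lra.
- exact: dmono_mono.
Qed.

Lemma sm_id : sm id (fun=> 1).
Proof.
have [d c p s dm] := sm_affine 0 (ltr01 : 0 < 1 :> R); split=> // [x|y].
  exact: der_id.
by exists y.
Qed.

Section One.
Variables (w w' : R -> R).
Hypothesis W : sm w w'.

Lemma sm_lt : {mono w : x y / x < y}.
Proof.
apply: leW_mono; apply: le_mono => x y xy; have [wd _ w0 _ _] := W.
have [|c _ e] := @mvt R w w' x y xy.
  by move=> z _; apply: der_atW (wd z) => //; exact: subsetT.
by rewrite -subr_gt0 e mulr_gt0 // subr_gt0.
Qed.

Lemma sm_le : {mono w : x y / x <= y}.
Proof. by move=> x y; rewrite !leNgt sm_lt. Qed.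

Lemma sm_inj : injective w.
Proof. by move=> x y e; apply/eqP; rewrite eq_le -sm_le e lexx -sm_le e lexx. Qed.

Lemma sm_cont x : cont_at setT w x.
Proof. by have [wd _ _ _ _] := W; exact: der_cont (wd x). Qed.

End One.

Lemma sm_comp w w' u u' : sm w w' -> sm u u' ->
  sm (w \o u) (fun x => w' (u x) * u' x).
Proof.
move=> W U; have [wd wc w0 ws wv] := W; have [ud uc u0 us uv] := U; split.
- by move=> x; apply: (@der_comp _ _ setT).
- move=> x; apply/cont_atP; apply: continuousM; last exact/cont_atP.
  by apply/cont_atP; apply: (@cont_comp _ _ setT) => //; exact: sm_cont U _.
- by move=> x; rewrite mulr_gt0.
- by move=> y; have [z <-] := ws y; have [x <-] := us z; exists x.
- move=> a b; apply: (@dmono_eq _ _ (fun x => (@ln R \o w') (u x) + (@ln R \o u') x)).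
    by move=> x _ /=; rewrite lnM ?posrE.
  apply: dmono_add => //; apply: (@dmono_comp _ _ (@ln R \o w') u) => //.
  by move=> x y; rewrite (sm_le U).
Qed.

Lemma cont_inv I f x : cont_at I f x -> 0 < f x -> cont_at I (fun y => (f y)^-1) x.
Proof.
move=> fx f0 e e0; pose k := Num.min (f x / 2) (e * f x ^+ 2 / 2).
have k0 : 0 < k by rewrite lt_min !divr_gt0 // mulr_gt0 // exprn_gt0.
have [d d0 H] := fx _ k0; exists d => // y Iy yx.
have := H y Iy yx; rewrite lt_min => /andP[h1 h2].
have fy : f x / 2 < f y by move: h1; rewrite ltr_norml => /andP[]; lra.
have fy0 : 0 < f y by lra.
have -> : (f y)^-1 - (f x)^-1 = - (f y - f x) / (f y * f x) by field; lra.
rewrite normrM normrN normfV (gtr0_norm (mulr_gt0 fy0 f0)).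
rewrite ltr_pdivrMr ?mulr_gt0 //; apply: lt_trans h2 _.
rewrite -mulrA ltr_pM2l // expr2 mulrAC ltr_pM2r //.
Qed.

Lemma sm_inv w w' : sm w w' -> exists g g',
  [/\ sm g g', cancel w g & cancel g w].
Proof.
move=> W; have [wd wc w0 ws wv] := W; have [g gK] := choice ws.
have wK : cancel w g by move=> x; apply: (sm_inj W).
have gm : {mono g : x y / x <= y} by move=> x y; rewrite -(sm_le W) !gK.
have gc x : cont_at setT g x.
  move=> e e0.
  exists (Num.min (x - w (g x - e)) (w (g x + e) - x)).
    by rewrite lt_min !subr_gt0 -{2 3}(gK x) !(sm_lt W); apply/andP; split; lra.
  move=> y _; rewrite lt_min !ltr_norml => /andP[/andP[h1 _] /andP[_ h2]].
  have : w (g x - e) < w (g y) by rewrite gK; lra.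
  have : w (g y) < w (g x + e) by rewrite gK; lra.
  by rewrite !(sm_lt W); lra.
exists g, (fun y => (w' (g y))^-1); split=> //; split.
- move=> x e e0; have m0 := w0 (g x); set m := w' (g x) in m0 *.
  pose k := Num.min (m / 2) (e * m ^+ 2 / 2).
  have k0 : 0 < k by rewrite lt_min !divr_gt0 // mulr_gt0 // exprn_gt0.
  have [d d0 Hd] := wd (g x) _ k0; have [d1 d10 Hd1] := gc x _ d0.
  exists d1 => // y _ yx; have := Hd (g y) I (Hd1 _ I yx); rewrite !gK -/m.
  set h := g y - g x; set r := y - x - m * h => Hr.
  have hk : `|r| <= m / 2 * `|h|.
    by apply: le_trans Hr _; rewrite ler_wpM2r // ge_min lexx.
  have hk2 : `|r| <= e * m ^+ 2 / 2 * `|h|.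
    by apply: le_trans Hr _; rewrite ler_wpM2r // ge_min lexx orbT.
  have hb : m / 2 * `|h| <= `|y - x|.
    have e1 : m * `|h| = `|(y - x) - r|.
      by rewrite (_ : y - x - r = m * h) ?normrM ?(gtr0_norm m0) // /r; ring.
    have := ler_normB (y - x) r; rewrite -e1; lra.
  have -> : h - m^-1 * (y - x) = - r / m by rewrite /r; field; lra.
  rewrite normrM normrN normfV (gtr0_norm m0) ler_pdivrMr //.
  apply: le_trans hk2 _.
  have -> : e * m ^+ 2 / 2 * `|h| = (e * m) * (m / 2 * `|h|) by field.
  have -> : e * `|y - x| * m = (e * m) * `|y - x| by ring.
  by rewrite ler_pM2l // mulr_gt0.
- by move=> x; apply: cont_inv => //; apply: (@cont_comp _ _ setT) => //.
- by move=> x; rewrite invr_gt0.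
- by move=> y; exists (w y).
- move=> a b; apply: (@dmono_eq _ _ (fun x => - (@ln R \o w') (g x))).
    by move=> x _ /=; rewrite lnV ?posrE.
  apply: dmono_opp; apply: (@dmono_comp _ _ (@ln R \o w') g) => //.
  by move=> x y; rewrite gm.
Qed.

Lemma sm_reflect w w' : sm w w' -> sm (fun x => - w (- x)) (fun x => w' (- x)).
Proof.
move=> W; have [wd wc w0 ws wv] := W.
have aff x : der_at setT (fun y => - y) x (-1 : R).
  move=> e e0; exists 1 => // y _ _.
  by rewrite (_ : _ - _ - _ = 0) ?normr0 ?mulr_ge0 // ?(ltW e0) //; ring.
split=> [x|x|x|y|a b].
- have := der_comp (fun _ _ => I) (aff x) (wd (- x)) => H.
  have := der_comp (fun _ _ => I) H (aff _).
  by rewrite mulrN1 mulN1r opprK.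
- by apply: (@cont_comp _ _ setT) => //; exact: der_cont (aff x).
- exact: w0.
- by have [z zy] := ws (- y); exists (- z); rewrite opprK zy opprK.
- have [P [N [Pm Nm H]]] := wv (- b) (- a).
  exists (fun x => - N (- x)), (fun x => - P (- x)); split=> [x y xy|x y xy|x xab].
  + by rewrite lerN2 Nm // lerN2.
  + by rewrite lerN2 Pm // lerN2.
  + by rewrite /= in H *; rewrite H; [ring|lra].
Qed.

Definition glue b f g x := if x <= b then f x else g x.

Lemma glue_r b f g x : f b = g b -> b <= x -> glue b f g x = g x.
Proof.
by rewrite /glue => e bx; case: ifP => // xb; rewrite (_ : x = b) //; apply/eqP; rewrite eq_le xb.
Qed.

Lemma glue_cont I b f g : f b = g b ->
  (forall x, I x -> x <= b -> cont_at (I `&` [set y | y <= b]) f x) ->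
  (forall x, I x -> b <= x -> cont_at (I `&` [set y | b <= y]) g x) ->
  forall x, I x -> cont_at I (glue b f g) x.
Proof.
move=> e fc gc x Ix k k0; have [xb|bx|xb] := ltgtP x b.
- have [d d0 H] := fc x Ix (ltW xb) k k0.
  exists (Num.min d (b - x)); first by rewrite lt_min d0 subr_gt0.
  move=> y Iy; rewrite lt_min => /andP[yd]; rewrite ltr_norml => /andP[_ h].
  have yb : y <= b by lra.
  by rewrite /glue yb (ltW xb); exact: H.
- have [d d0 H] := gc x Ix (ltW bx) k k0.
  exists (Num.min d (x - b)); first by rewrite lt_min d0 subr_gt0.
  move=> y Iy; rewrite lt_min => /andP[yd]; rewrite ltr_norml => /andP[h _].
  have yb : b <= y by lra.
  by rewrite !glue_r ?(ltW bx) //; exact: H.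
- have xb1 : x <= b by rewrite xb. have xb2 : b <= x by rewrite xb.
  have [d d0 H] := fc x Ix xb1 k k0; have [d' d'0 H'] := gc x Ix xb2 k k0.
  exists (Num.min d d'); first by rewrite lt_min d0.
  move=> y Iy; rewrite lt_min => /andP[yd yd']; have [yb|yb] := leP y b.
    by rewrite /glue yb xb1; exact: H.
  by rewrite !glue_r ?(ltW yb) //; apply: H' => //; split=> //; exact: ltW.
Qed.

Lemma glue_der I b f g f' g' : f b = g b -> f' b = g' b ->
  (forall x, I x -> x <= b -> der_at (I `&` [set y | y <= b]) f x (f' x)) ->
  (forall x, I x -> b <= x -> der_at (I `&` [set y | b <= y]) g x (g' x)) ->
  forall x, I x -> der_at I (glue b f g) x (glue b f' g' x).
Proof.
move=> e e' fc gc x Ix k k0; have [xb|bx|xb] := ltgtP x b.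
- have [d d0 H] := fc x Ix (ltW xb) k k0.
  exists (Num.min d (b - x)); first by rewrite lt_min d0 subr_gt0.
  move=> y Iy; rewrite lt_min => /andP[yd]; rewrite ltr_norml => /andP[_ h].
  have yb : y <= b by lra.
  by rewrite /glue yb (ltW xb); exact: H.
- have [d d0 H] := gc x Ix (ltW bx) k k0.
  exists (Num.min d (x - b)); first by rewrite lt_min d0 subr_gt0.
  move=> y Iy; rewrite lt_min => /andP[yd]; rewrite ltr_norml => /andP[h _].
  have yb : b <= y by lra.
  by rewrite !glue_r ?(ltW bx) //; exact: H.
- have xb1 : x <= b by rewrite xb. have xb2 : b <= x by rewrite xb.
  have [d d0 H] := fc x Ix xb1 k k0; have [d' d'0 H'] := gc x Ix xb2 k k0.
  exists (Num.min d d'); first by rewrite lt_min d0.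
  move=> y Iy; rewrite lt_min => /andP[yd yd']; have [yb|yb] := leP y b.
    by rewrite /glue yb xb1; exact: H.
  by rewrite !glue_r ?(ltW yb) //; apply: H' => //; split=> //; exact: ltW.
Qed.

Lemma sm_glue b w w' u u' : w b = u b -> w' b = u' b -> sm w w' -> sm u u' ->
  sm (glue b w u) (glue b w' u').
Proof.
move=> e e' W U; have [wd wc w0 ws wv] := W; have [ud uc u0 us uv] := U.
split=> [x|x|x|y|p q].
- apply: glue_der => // z _ _.
    by apply: der_atW (wd z); exact: subsetT.
  by apply: der_atW (ud z); exact: subsetT.
- apply: glue_cont => // z _ _.
    by apply: cont_atW (wc z); exact: subsetT.
  by apply: cont_atW (uc z); exact: subsetT.
- by rewrite /glue; case: ifP.
- have [yb|yb] := leP y (w b).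
    have [x xy] := ws y; exists x; rewrite /glue ifT //.
    by rewrite -(sm_le W) xy.
  have [x xy] := us y; exists x; rewrite glue_r //.
  by rewrite -(sm_le U) xy -e ltW.
- have l c d : d <= b -> dmono c d (@ln R \o glue b w' u').
    move=> db; apply: (@dmono_eq _ _ (@ln R \o w')) => // x xcd /=; rewrite /glue ifT //; lra.
  have r c d : b <= c -> dmono c d (@ln R \o glue b w' u').
    move=> bc; apply: (@dmono_eq _ _ (@ln R \o u')) => // x xcd /=; rewrite glue_r //; lra.
  have [qb|bq] := leP q b; first exact: l.
  have [bp|pb] := leP b p; first exact: r.
  by apply: (@dmono_glue p b q); rewrite ?(ltW pb) ?(ltW bq) //; [exact: l|exact: r].
Qed.

(** The model may change from point to point, but derivatives are unique, so [u' t t] agrees with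
    the derivative of every nearby model. The variation is controlled by [interval_induction]. *)
Lemma sm_loc w : (forall y, exists x, w x = y) ->
  (forall t, exists u u', sm u u' /\ exists2 d, 0 < d &
     forall s, `|s - t| < d -> w s = u s) ->
  exists w', sm w w'.
Proof.
move=> ws H; have [u Hu] := choice H; have [u' {}Hu] := choice Hu.
pose w' t := u' t t; exists w'.
have Hw' t : exists2 d, 0 < d &
    forall s, `|s - t| < d -> w s = u t s /\ w' s = u' t s.
  have [[ud _ _ _ _] [d d0 Hd]] := Hu t.
  exists d => // s sd; rewrite Hd //; split=> //.
  have [[vd _ _ _ _] [r r0 Hr]] := Hu s.
  apply: (@der_unique _ (u s) s) => //.
  have m0 : 0 < Num.min r (d - `|s - t|) by rewrite lt_min r0 subr_gt0.
  apply: (der_local m0) (ud s).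
    move=> y _; rewrite lt_min => /andP[yr yd]; rewrite -Hr // -Hd //.
    by have := ler_distD s y t; lra.
  by rewrite -Hd // -Hr // subrr normr0.
have z t : `|t - t| = 0 :> R by rewrite subrr normr0.
split=> // [x|x|x|a b].
- have [d d0 Hd] := Hw' x; have [[ud _ _ _ _] _] := Hu x.
  apply: (der_local d0) (ud x); last by rewrite (Hd x _).1 // z.
  by move=> y _ /Hd[->].
- have [d d0 Hd] := Hw' x; have [[_ uc _ _ _] _] := Hu x.
  apply: (cont_local d0) (uc x); last by rewrite (Hd x _).2 // z.
  by move=> y _ /Hd[_ ->].
- by have [[_ _ u0 _ _] _] := Hu x; exact: u0.
- have [ab|ba] := leP a b; last first.
    by exists (fun=> 0), (fun=> 0); split=> // x xab; lra.
  apply: (@interval_induction R (fun p q => dmono p q (@ln R \o w'))) => //.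
    by move=> p q r _ pq qr _; exact: dmono_glue.
  move=> t _; have [d d0 Hd] := Hw' t; have [[_ _ _ _ uv] _] := Hu t.
  exists d => // p q _ h1 h2 h3 h4 _; apply: (@dmono_eq _ _ (@ln R \o u' t)) => // x xpq /=.
  by rewrite (Hd x _).2 // ltr_norml; lra.
Qed.

(** Outside [[a, b]] the map follows its tangent lines at the end points, which keeps the derivative
    continuous and positive. *)
Lemma sm_ext a b h h' : a < b ->
  (forall x, a <= x <= b -> der_at `[a, b] h x (h' x)) ->
  (forall x, a <= x <= b -> cont_at `[a, b] h' x) ->
  (forall x, a <= x <= b -> 0 < h' x) ->
  dmono a b (@ln R \o h') ->
  exists w w', sm w w' /\ forall x, a <= x <= b -> w x = h x /\ w' x = h' x.
Proof.
move=> ab hd hc h0 hv.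
pose A x := h' a * x + (h a - h' a * a); pose B x := h' b * x + (h b - h' b * b).
have eA : A a = h a by rewrite /A; ring.
have eB : h b = B b by rewrite /B; ring.
pose w1 := glue b h B; pose w1' := glue b h' (fun=> h' b).
have sub : [set y | a <= y] `&` [set y | y <= b] `<=` `[a, b].
  by move=> y [/= h1 h2]; rewrite in_itv /= h1.
have w1d x : a <= x -> der_at [set y | a <= y] w1 x (w1' x).
  move=> ax; apply: (@glue_der [set y | a <= y]) => // z /= az zb.
    by apply: der_atW sub _; apply: hd; rewrite az.
  exact: der_affine.
have w1c x : a <= x -> cont_at [set y | a <= y] w1' x.
  move=> ax; apply: (@glue_cont [set y | a <= y]) => // z /= az zb.
    by apply: cont_atW sub _; apply: hc; rewrite az.
  exact: cont_cst.
have w1b : w1 a = h a by rewrite /w1 /glue ltW.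
have w1b' : w1' a = h' a by rewrite /w1' /glue ltW.
pose w := glue a A w1; pose w' := glue a (fun=> h' a) w1'; exists w, w'.
have eqw x : a <= x <= b -> w x = h x /\ w' x = h' x.
  move=> /andP[ax xb]; rewrite /w /w' !glue_r ?w1b ?w1b' //.
  by rewrite /w1 /w1' /glue xb.
have ha : 0 < h' a by apply: h0; lra.
have hb : 0 < h' b by apply: h0; lra.
have le1 : a <= a <= b by lra.
have le2 : a <= b <= b by lra.
have w'l x : x <= a -> w' x = h' a by rewrite /w' /glue => ->.
have w'r x : b <= x -> w' x = h' b.
  move=> bx; rewrite /w' glue_r ?w1b' //; last lra.
  by rewrite /w1' glue_r.
have wr x : b <= x -> w x = B x.
  move=> bx; rewrite /w glue_r ?w1b //; last lra.
  by rewrite /w1 glue_r.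
split=> //; split=> [x|x|x|y|p q].
- apply: (@glue_der setT) => // [|z _ za|z _ az]; rewrite ?w1b ?eA ?w1b' //.
    exact: der_affine.
  by apply: der_atW (w1d _ az) => ? [].
- apply: (@glue_cont setT) => // z _ az.
    exact: cont_cst.
  by apply: cont_atW (w1c _ az) => ? [].
- have [xa|ax] := leP x a; first by rewrite w'l.
  have [bx|xb] := leP b x; first by rewrite w'r.
  by rewrite (eqw x _).2 ?h0 //; lra.
- have [ya|ay] := leP y (h a).
    have xa : (y - h a) / h' a + a <= a.
      by rewrite gerDr pmulr_lle0 ?invr_gt0 // subr_le0.
    exists ((y - h a) / h' a + a); rewrite /w /glue xa /A; field; lra.
  have [yb|yb] := leP (h b) y.
    have xb : b <= (y - h b) / h' b + b.
      by rewrite lerDr mulr_ge0 ?invr_ge0 ?subr_ge0 // ltW.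
    exists ((y - h b) / h' b + b); rewrite wr // /B; field; lra.
  have [||c cab hy] := @ivt R h a b y (ltW ab).
  + by move=> x xab; exact: der_cont (hd x xab).
  + by rewrite !ltW.
  by exists c; rewrite (eqw c cab).1.
- have l c d : d <= a -> dmono c d (@ln R \o w').
    move=> da; apply: (@dmono_eq _ _ (fun=> ln (h' a))); last exact: dmono_mono.
    by move=> x xcd /=; rewrite w'l //; lra.
  have r c d : b <= c -> dmono c d (@ln R \o w').
    move=> bc; apply: (@dmono_eq _ _ (fun=> ln (h' b))); last exact: dmono_mono.
    by move=> x xcd /=; rewrite w'r //; lra.
  have m : dmono a b (@ln R \o w').
    by apply: (@dmono_eq _ _ (@ln R \o h')) => // x xab /=; rewrite (eqw x xab).2.
  apply: (@dmono_sub (Num.min p a) (Num.max q b)).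
  + by rewrite ge_min lexx.
  + by rewrite le_max lexx.
  apply: (@dmono_glue _ a).
  + by rewrite ge_min lexx orbT.
  + by rewrite le_max (ltW ab) orbT.
  + by apply: l.
  apply: (@dmono_glue _ b); rewrite ?(ltW ab) //.
  + by rewrite le_max lexx orbT.
  + exact: r.
Qed.

End Smooth.

(** * Charts *)

Section Charts.
Variables (R : realType).

(** [ln] is Lipschitz with constant [1 / m] on the values of [g], so [(P + N) / m] dominates its
    variation. The clamp [k] makes functions that are monotone on [[a, b]] monotone on the line. *)
Lemma bv_ln (a b m : R) g : bounded_variation a b g -> 0 < m ->
  (forall x, a <= x <= b -> m <= g x) -> dmono a b (@ln R \o g).
Proof.
move=> bg m0 mg.
have bNg := bounded_variationN bg.
pose N := fine \o neg_tv a g; pose P := fine \o pos_tv a g.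
have gE x : a <= x <= b -> g x = P x - N x.
  by move=> xab; rewrite (bounded_variation_pos_neg_tvE bg) // in_itv.
have Nm x y : a <= x <= b -> a <= y <= b -> x <= y -> N x <= N y.
  by move=> xab yab; apply: (fine_neg_tv_nondecreasing bg); rewrite in_itv.
have Pm x y : a <= x <= b -> a <= y <= b -> x <= y -> P x <= P y.
  by move=> xab yab; apply: (fine_neg_tv_nondecreasing bNg); rewrite in_itv.
have [ab|ba] := leP a b; last first.
  by exists (fun=> 0), (fun=> 0); split=> // x xab; lra.
pose k (x : R) := Num.max a (Num.min x b).
have kab x : a <= k x <= b.
  by rewrite /k le_max lexx /= ge_max ab ge_min lexx orbT.
have km x y : x <= y -> k x <= k y.
  move=> xy; rewrite /k ge_max le_max lexx /= le_max.
  by apply/orP; right; rewrite le_min !ge_min xy lexx orbT.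
have kE x : a <= x <= b -> k x = x.
  by move=> /andP[ax xb]; rewrite /k (min_idPl xb) (max_idPr ax).
pose Q (x : R) := (P (k x) + N (k x)) / m.
have Qm x y : x <= y -> Q x <= Q y.
  by move=> xy; rewrite ler_pM2r ?invr_gt0 // lerD ?Pm ?Nm ?kab ?km.
exists (fun x => ln (g (k x)) + Q x), Q; split=> // [x y xy|x xab]; last first.
  by rewrite /= kE //; ring.
have gx := mg _ (kab x); have gy := mg _ (kab y).
have P1 := Pm _ _ (kab x) (kab y) (km _ _ xy).
have N1 := Nm _ _ (kab x) (kab y) (km _ _ xy).
have h : ln (g (k x)) - ln (g (k y)) <= (g (k x) - g (k y)) / g (k y).
  rewrite -ln_div ?posrE; try lra.
  have -> : g (k x) / g (k y) = 1 + (g (k x) - g (k y)) / g (k y) by field; lra.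
  apply: le_ln1Dx; rewrite mulrBl mulfV; last lra.
  have : 0 < g (k x) / g (k y) by rewrite divr_gt0 //; lra.
  lra.
have h2 : (g (k x) - g (k y)) / g (k y) <= Q y - Q x.
  have -> : Q y - Q x = ((P (k y) - P (k x)) + (N (k y) - N (k x))) / m.
    by rewrite /Q; ring.
  have ex := gE _ (kab x); have ey := gE _ (kab y).
  rewrite ler_pdivrMr; last lra.
  apply: (@le_trans _ _ ((P (k y) - P (k x) + (N (k y) - N (k x))) / m * m)).
    by rewrite mulfVK ?gt_eqF //; lra.
  by rewrite ler_wpM2l // divr_ge0; lra.
lra.
Qed.

Lemma derivable_within_der (A : set R) f t : derivable_within A f t ->
  der_at A f t (derive_within A f t).
Proof.
move=> H e e0.
have H' : diff_quotient f t s @[s --> within A t^'] --> derive_within A f t := H.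
have /cvgrPdist_lt/(_ e e0) := H'; rewrite near_withinE => /nbhs_ballP[d /= d0 Hd].
exists d => // y Ay yt; have [->|yt'] := eqVneq y t.
  by rewrite !subrr mulr0 subr0 normr0 mulr0.
have := Hd y; rewrite /ball /= distrC => /(_ yt yt' Ay).
rewrite -normrN opprB /diff_quotient => h.
have n0 : y - t != 0 by rewrite subr_eq0.
have -> : f y - f t - derive_within A f t * (y - t) =
  ((f y - f t) / (y - t) - derive_within A f t) * (y - t) by field.
by rewrite normrM ler_wpM2r // ltW.
Qed.

Lemma within_cont_at (T : topologicalType) (A : set R) (f : R -> T) t U :
  {within A, continuous f} -> A t -> open U -> U (f t) ->
  exists2 d, 0 < d & forall y, A y -> `|y - t| < d -> U (f y).
Proof.
move=> /subspace_continuousP fc At oU Uf.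
have /nbhs_ballP[d /= d0 Hd] := fc t At _ (open_nbhs_nbhs (conj oU Uf)).
by exists d => // y Ay yt; apply: Hd => //; rewrite /ball /= distrC.
Qed.

Lemma within_continuous_at (A : set R) (f : R -> R) t :
  {within A, continuous f} -> A t -> cont_at A f t.
Proof.
move=> /subspace_continuousP fc At e e0.
have /cvgrPdist_lt/(_ e e0)/nbhs_ballP[d /= d0 Hd] := fc t At.
by exists d => // y Ay yt; rewrite distrC; apply: Hd => //; rewrite /ball /= distrC.
Qed.

Variable M : topologicalType.
Implicit Types (c : chart R M) (x : M).

Lemma chart_img_inv c v : is_chart c -> chart_img c v ->
  chart_dom c (chart_inv c v) /\ chart_map c (chart_inv c v) = v.
Proof. by move=> [_ _ cK _ _] [y yc <-]; rewrite cK. Qed.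

Lemma chart_inv_near c x U : is_chart c -> chart_dom c x -> open U -> U x ->
  exists2 d, 0 < d & forall y, chart_dom c y ->
    `|chart_map c y - chart_map c x| < d -> U y.
Proof.
move=> [_ _ cK _ ci] cx oU Ux.
have cx' : chart_img c (chart_map c x) by exists x.
have [|d d0 H] := within_cont_at ci cx' oU; first by rewrite cK.
exists d => // y cy yx; rewrite -(cK y) //; apply: H => //; by exists y.
Qed.

Lemma chart_near c x d : is_chart c -> chart_dom c x -> 0 < d ->
  \forall y \near x, chart_dom c y /\ `|chart_map c y - chart_map c x| < d.
Proof.
move=> [co _ _ cc _] cx d0.
have : \forall y \near x, chart_dom c y by exact: open_nbhs_nbhs.
have /subspace_continuousP/(_ x cx)/cvgrPdist_lt/(_ d d0) := cc.
rewrite near_withinE => h1 h2.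
by apply: filterS2 h2 h1 => y cy /(_ cy); rewrite distrC.
Qed.

(** The last two cases are boundary points: the coordinate is 0, and the half-line opens to the
    right or to the left. *)
Lemma chart_shape c x : is_chart c -> chart_dom c x ->
  let m := chart_map c x in
  exists2 d, 0 < d & [\/ forall v, `|v - m| < d -> chart_img c v,
    (forall v, m <= v < m + d -> chart_img c v) /\
      (forall y, chart_dom c y -> m <= chart_map c y) |
    (forall v, m - d < v <= m -> chart_img c v) /\
      (forall y, chart_dom c y -> chart_map c y <= m)].
Proof.
move=> [_ [L [W [Lh oW cE]]] _ _ _] cx m.
have [Wm Lm] : (W `&` L) m by rewrite -cE; exists x.
have /nbhs_ballP[d /= d0 Hd] := open_nbhs_nbhs (conj oW Wm).
have {}Hd v : `|v - m| < d -> W v by move=> h; apply: Hd; rewrite /ball /= distrC.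
have img y : chart_dom c y -> L (chart_map c y).
  by move=> cy; have : chart_img c (chart_map c y) by [exists y]; rewrite cE => -[].
have imgI v : W v -> L v -> chart_img c v by move=> Wv Lv; rewrite cE.
case: Lh => LE; rewrite {}LE /= in Lm imgI img.
  have [m0|m0] := eqVneq m 0.
    exists d => //; apply: Or32; split=> [v vm|y /img]; last by rewrite m0.
    by apply: imgI; [apply: Hd; rewrite ltr_norml; lra|lra].
  have {}m0 : 0 < m by rewrite lt_def m0.
  exists (Num.min d m); first by rewrite lt_min d0.
  apply: Or31 => v; rewrite lt_min => /andP[vd vm].
  by apply: imgI; [exact: Hd|move: vm; rewrite ltr_norml; lra].
have [m0|m0] := eqVneq m 0.
  exists d => //; apply: Or33; split=> [v vm|y /img]; last by rewrite m0.
  by apply: imgI; [apply: Hd; rewrite ltr_norml; lra|lra].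
have {}m0 : m < 0 by rewrite lt_def eq_sym m0.
exists (Num.min d (- m)); first by rewrite lt_min d0 oppr_gt0.
apply: Or31 => v; rewrite lt_min => /andP[vd vm].
by apply: imgI; [exact: Hd|move: vm; rewrite ltr_norml; lra].
Qed.

(** Also at boundary points [w] lives on the whole line. For [f := id] this is a condition on the
    chart changes. *)
Definition local_smooth (atlas : set (chart R M)) (f : M -> M) := forall c d x,
  atlas c -> atlas d -> chart_dom c x -> chart_dom d (f x) ->
  exists w w', sm w w' /\ exists2 r, 0 < r & forall y, chart_dom c y ->
    `|chart_map c y - chart_map c x| < r ->
    chart_dom d (f y) /\ chart_map d (f y) = w (chart_map c y).

(** On a small compact interval of coordinates, one-sided at the boundary, the derivative has a
    positive minimum; so its logarithm has bounded variation and [sm_ext] applies. *)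
Lemma diff_local_smooth atlas f : (forall c, atlas c -> is_chart c) ->
  Diff1bv atlas f -> local_smooth atlas f.
Proof.
move=> isc [[[fc f1] _] fo fv] c d x ac ad cx dfx.
have cc := isc c ac; have [cop _ cK _ _] := cc.
have [dop _ _ _ _] := isc d ad.
set D := local_dom c d f; set g := local_rep c d f.
pose U := chart_dom c `&` f @^-1` chart_dom d.
have oU : open U.
  by apply: openI => //; apply: open_comp => // y _; exact: fc.
have [r1 r10 H1] := chart_inv_near cc cx oU (conj cx dfx).
have [r2 r20 H2] := chart_shape cc cx; set m := chart_map c x in H1 H2.
pose r := Num.min r1 r2 / 2.
have r0 : 0 < r by rewrite divr_gt0 // lt_min r10.
have rr1 : r < r1.
  have : Num.min r1 r2 <= r1 by rewrite ge_min lexx.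
  rewrite /r; lra.
have rr2 : r < r2.
  have : Num.min r1 r2 <= r2 by rewrite ge_min lexx orbT.
  rewrite /r; lra.
have [a [b [ab rab abi near]]] : exists a b, [/\ a < b, m - r <= a /\ b <= m + r,
    forall v, a <= v <= b -> chart_img c v &
    forall y, chart_dom c y -> `|chart_map c y - m| < r ->
      a <= chart_map c y <= b].
  case: H2 => [H|[H K]|[H K]].
  - exists (m - r), (m + r); split=> [||v vab|y cy]; try lra.
      by apply: H; rewrite ltr_norml; lra.
    by rewrite ltr_norml; lra.
  - exists m, (m + r); split=> [||v vab|y cy]; try lra.
      by apply: H; lra.
    by have := K y cy; rewrite ltr_norml; lra.
  - exists (m - r), m; split=> [||v vab|y cy]; try lra.
      by apply: H; lra.
    by have := K y cy; rewrite ltr_norml; lra.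
have abD v : a <= v <= b -> D v.
  move=> vab; have [cv vE] := chart_img_inv cc (abi v vab).
  exists (chart_inv c v) => //; apply: H1 => //.
  by rewrite vE ltr_norml; lra.
have sab : `[a, b] `<=` D by move=> v; rewrite /= in_itv /=; exact: abD.
have [gd gc] := f1 c d ac ad.
pose g' := derive_within D g.
have g'c v : a <= v <= b -> cont_at `[a, b] g' v.
  by move=> vab; apply: cont_atW sab _; apply: within_continuous_at gc _; exact: abD.
have g'0 v : a <= v <= b -> 0 < g' v by move=> vab; apply: fo => //; exact: abD.
have [k k0 Hk] := cont_bounded_gt0 (ltW ab) g'c g'0.
have g'd v : a <= v <= b -> der_at `[a, b] g v (g' v).
  move=> vab; apply: der_atW sab _; apply: derivable_within_der.
  by apply: gd; exact: abD.
have [|w [w' [W Hw]]] := sm_ext ab g'd g'c g'0.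
  by apply: (bv_ln _ k0 Hk); apply: fv => //; exact: ltW.
exists w, w'; split=> //; exists r => // y cy yr.
have [_ dfy] := H1 y cy (lt_trans yr rr1).
by split=> //; rewrite (Hw _ (near y cy yr)).1 /g /local_rep /= cK.
Qed.

End Charts.

(** * Arcs *)

Section Paths.
Variables (R : realType) (M : topologicalType).
Implicit Types (c d : chart R M) (x y : M) (A : set (chart R M)).
Implicit Types (gam : R -> M) (p q t s l : R).

(** Consequences of [is_chart] in a form that passes easily to [neg_chart], since arcs are run in
    both directions. *)
Record nice_chart c : Prop := {
  nice_open : open (chart_dom c) ;
  nice_invK : forall x, chart_dom c x -> chart_inv c (chart_map c x) = x ;
  nice_inv_near : forall x U, chart_dom c x -> open U -> U x ->
    exists2 r, 0 < r & forall y, chart_dom c y ->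
      `|chart_map c y - chart_map c x| < r -> U y ;
  nice_near : forall x r, chart_dom c x -> 0 < r ->
    \forall y \near x, chart_dom c y /\ `|chart_map c y - chart_map c x| < r ;
  nice_shape : forall x, chart_dom c x ->
    let m := chart_map c x in
    exists2 r, 0 < r & [\/ forall v, `|v - m| < r -> chart_img c v,
      (forall v, m <= v < m + r -> chart_img c v) /\
        (forall y, chart_dom c y -> m <= chart_map c y) |
      (forall v, m - r < v <= m -> chart_img c v) /\
        (forall y, chart_dom c y -> chart_map c y <= m)] }.

Lemma is_chart_nice c : is_chart c -> nice_chart c.
Proof.
move=> cc; have [co _ cK _ _] := cc; split=> // [x U|x r|x].
- exact: chart_inv_near.
- exact: chart_near.
- exact: chart_shape.
Qed.

Lemma nice_img c v : nice_chart c -> chart_img c v ->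
  chart_dom c (chart_inv c v) /\ chart_map c (chart_inv c v) = v.
Proof. by move=> nc [y yc <-]; rewrite (nice_invK nc). Qed.

Lemma nice_inj c x y : nice_chart c -> chart_dom c x -> chart_dom c y ->
  chart_map c x = chart_map c y -> x = y.
Proof. by move=> nc cx cy e; rewrite -(nice_invK nc cx) e (nice_invK nc). Qed.

Record good_atlas A : Prop := {
  ga_compact : compact [set: M] ;
  ga_hausdorff : hausdorff_space M ;
  ga_chart : forall c, A c -> nice_chart c ;
  ga_cover : forall x, exists2 c, A c & chart_dom c x ;
  ga_trans : local_smooth A id }.

Definition neg_chart c : chart R M :=
  Chart (chart_dom c) (fun x => - chart_map c x) (fun v => chart_inv c (- v)).

Definition neg_atlas A : set (chart R M) := neg_chart @` A.

Let negB (u v : R) : `|- u - - v| = `|u - v|.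
Proof. by rewrite -opprD normrN. Qed.

Lemma nice_neg c : nice_chart c -> nice_chart (neg_chart c).
Proof.
move=> nc; split=> /= [|x cx|x U cx oU Ux|x r cx r0|x cx].
- exact: nice_open.
- by rewrite opprK nice_invK.
- have [r r0 H] := nice_inv_near nc cx oU Ux; exists r => // y cy.
  by rewrite negB; exact: H.
- have := nice_near nc cx r0; apply: filterS => y.
  by rewrite negB.
have img v : chart_img c v -> chart_img (neg_chart c) (- v).
  by move=> [y cy <-]; exists y.
have [r r0 H] := nice_shape nc cx; exists r => //; case: H => [H|[H K]|[H K]].
- apply: Or31 => v vr; rewrite -(opprK v); apply: img; apply: H.
  by rewrite -negB opprK.
- apply: Or33; split=> [v vr|y /K]; last by rewrite lerN2.
  by rewrite -(opprK v); apply: img; apply: H; lra.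
- apply: Or32; split=> [v vr|y /K]; last by rewrite lerN2.
  by rewrite -(opprK v); apply: img; apply: H; lra.
Qed.

Lemma good_neg A : good_atlas A -> good_atlas (neg_atlas A).
Proof.
move=> [cM hM cA cov tr]; split=> // [_ [c Ac <-]|x|].
- exact/nice_neg/cA.
- by have [c Ac cx] := cov x; exists (neg_chart c) => //; exists c.
move=> _ _ x [c Ac <-] [d Ad <-] /= cx dx.
have [w [w' [W [r r0 H]]]] := tr c d x Ac Ad cx dx.
exists (fun v => - w (- v)), (fun v => w' (- v)); split; first exact: sm_reflect.
exists r => // y cy; rewrite negB => /(H y cy)[dy ->]; by rewrite opprK.
Qed.

(** Positively oriented immersed arcs: near each parameter, the ends included, a chart turns [gam]
    into the restriction of an increasing diffeomorphism. *)
Definition reg A gam p q := forall t, p <= t <= q -> exists c u u',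
  [/\ A c, sm u u' & exists2 r, 0 < r & forall s, p <= s <= q -> `|s - t| < r ->
    chart_dom c (gam s) /\ chart_map c (gam s) = u s].

(** A boundary point at which a positively oriented arc has to stop. *)
Definition rterm A x := exists c, [/\ A c, chart_dom c x &
  forall y, chart_dom c y -> chart_map c y <= chart_map c x].

Section Atlas.
Variable A : set (chart R M).
Hypothesis GA : good_atlas A.

Lemma reg_image gam p q f d t : local_smooth A f -> reg A gam p q ->
  p <= t <= q -> A d -> chart_dom d (f (gam t)) -> exists u u', sm u u' /\
  exists2 r, 0 < r & forall s, p <= s <= q -> `|s - t| < r ->
    chart_dom d (f (gam s)) /\ chart_map d (f (gam s)) = u s.
Proof.
move=> fs gr tpq Ad dt; have [c [u [u' [Ac U [r r0 H]]]]] := gr t tpq.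
have [|ct tE] := H t tpq; first by rewrite subrr normr0.
have [w [w' [W [r1 r10 H1]]]] := fs c d _ Ac Ad ct dt.
have [r2 r20 H2] := sm_cont U t r10.
exists (w \o u), (fun v => w' (u v) * u' v); split; first exact: sm_comp.
exists (Num.min r r2); first by rewrite lt_min r0.
move=> s spq; rewrite lt_min => /andP[/(H s spq)[cs sE] /(H2 s I)].
by rewrite -sE -tE => /(H1 _ cs)[ds ->]; rewrite /= -sE.
Qed.

Lemma reg_chart gam p q c t : reg A gam p q -> p <= t <= q -> A c ->
  chart_dom c (gam t) -> exists u u', sm u u' /\
  exists2 r, 0 < r & forall s, p <= s <= q -> `|s - t| < r ->
    chart_dom c (gam s) /\ chart_map c (gam s) = u s.
Proof. by move=> gr tpq Ac ct; exact: (reg_image (ga_trans GA) gr tpq). Qed.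

Lemma reg_sub gam p q p' q' : p <= p' -> q' <= q -> reg A gam p q ->
  reg A gam p' q'.
Proof.
move=> pp qq gr t tpq; have [|c [u [u' [Ac U [r r0 H]]]]] := gr t; first lra.
exists c, u, u'; split=> //; exists r => // s spq; apply: H; lra.
Qed.

Lemma reg_near gam p q t U : reg A gam p q -> p <= t <= q -> open U ->
  U (gam t) -> exists2 r, 0 < r & forall s, p <= s <= q -> `|s - t| < r -> U (gam s).
Proof.
move=> gr tpq oU Ut; have [c [u [u' [Ac W [r r0 H]]]]] := gr t tpq.
have [|ct tE] := H t tpq; first by rewrite subrr normr0.
have [r1 r10 H1] := nice_inv_near (ga_chart GA Ac) ct oU Ut.
have [r2 r20 H2] := sm_cont W t r10.
exists (Num.min r r2); first by rewrite lt_min r0.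
move=> s spq; rewrite lt_min => /andP[/(H s spq)[cs sE] /(H2 s I)].
by rewrite -sE -tE; exact: H1.
Qed.

Lemma reg_continuous gam p q : reg A gam p q ->
  {within `[p, q], continuous gam}.
Proof.
move=> gr; apply/subspace_continuousP => t; rewrite /= in_itv /= => tpq U.
rewrite nbhsE => -[V [oV Vt] VU].
have [r r0 H] := reg_near gr tpq oV Vt.
suff : \forall s \near within `[p, q] (nbhs t), U (gam s) by [].
rewrite near_withinE; apply/nbhs_ballP; exists r => //= s.
by rewrite /ball /= distrC in_itv /= => sr spq; apply: VU; exact: H.
Qed.

Lemma reg_inj_near gam p q t : reg A gam p q -> p <= t <= q ->
  exists2 r, 0 < r & forall s s', p <= s <= q -> p <= s' <= q ->
    `|s - t| < r -> `|s' - t| < r -> gam s = gam s' -> s = s'.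
Proof.
move=> gr tpq; have [c [u [u' [Ac W [r r0 H]]]]] := gr t tpq.
exists r => // s s' spq s'pq sr s'r e; apply: (sm_inj W).
by have [_ <-] := H s spq sr; have [_ <-] := H s' s'pq s'r; rewrite e.
Qed.

Lemma reg_closed gam p q : p <= q -> reg A gam p q -> closed (gam @` `[p, q]).
Proof.
move=> pq gr; apply: compact_closed; first exact: (ga_hausdorff GA).
by apply: continuous_compact; [exact: reg_continuous|exact: segment_compact].
Qed.

(** Past [l] the arc follows the chart at the constant speed [u' l], which glues differentiably,
    until the coordinate reaches [v]. *)
Lemma reg_extend gam l c v : 0 <= l -> reg A gam 0 l -> A c ->
  chart_dom c (gam l) -> chart_map c (gam l) < v ->
  (forall s, chart_map c (gam l) <= s <= v -> chart_img c s) ->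
  exists l' gam', [/\ l < l', reg A gam' 0 l',
    forall t, t <= l -> gam' t = gam t & gam' l' = chart_inv c v].
Proof.
move=> l0 gr Ac cl lv Hv; have nc := ga_chart GA Ac.
have [|u [u' [U [r r0 H]]]] := reg_chart gr _ Ac cl; first lra.
have [||_ lE] := H l; rewrite ?subrr ?normr0 ?l0 ?lexx //.
have [ud uc u0 us uv] := U; have k0 := u0 l; set k := u' l in k0.
pose B s := k * s + (u l - k * l); have BS : sm B (fun=> k) by exact: sm_affine.
have Bl : u l = B l by rewrite /B; ring.
pose w := glue l u B.
have W : sm w (glue l u' (fun=> k)) by apply: sm_glue.
pose l' := l + (v - u l) / k.
have ll' : l < l' by rewrite ltrDl divr_gt0 // subr_gt0 -lE.
have Bl' : B l' = v by rewrite /B /l'; field; lra.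
pose gam' s := if s <= l then gam s else chart_inv c (B s).
have img s : l <= s <= l' -> chart_img c (B s).
  move=> /andP[ls sl]; apply: Hv; rewrite lE.
  by rewrite Bl -Bl' !(sm_le BS) ls sl.
have gE s : l < s -> s <= l' -> chart_dom c (gam' s) /\ chart_map c (gam' s) = w s.
  move=> ls sl; rewrite /gam' /w /glue leNgt ls /=.
  by apply: (nice_img nc); apply: img; rewrite sl ltW.
exists l', gam'; split=> //; last 1 first.
- by rewrite /gam' leNgt ll' /= Bl'.
- move=> t tl; have [tl0|lt|->] := ltgtP t l.
  + have [|d [z [z' [Ad Z [r1 r10 H1]]]]] := gr t; first lra.
    exists d, z, z'; split=> //; exists (Num.min r1 (l - t)).
      by rewrite lt_min r10 subr_gt0.
    move=> s sl; rewrite lt_min => /andP[sr]; rewrite ltr_norml => h.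
    have sl0 : s <= l by lra.
    by rewrite /gam' sl0; apply: H1 => //; lra.
  + exists c, w, (glue l u' (fun=> k)); split=> //.
    exists (t - l); first by rewrite subr_gt0.
    move=> s sl; rewrite ltr_norml => /andP[h _].
    by apply: gE; lra.
  + exists c, w, (glue l u' (fun=> k)); split=> //; exists r => // s sl sr.
    have [sl0|ls] := leP s l; last by apply: gE => //; lra.
    by rewrite /gam' /w /glue sl0; apply: H => //; lra.
- by move=> t tl; rewrite /gam' tl.
Qed.

Lemma inf_witness (P : R -> Prop) a : (exists t, P t) -> (forall t, P t -> a <= t) ->
  exists2 m, a <= m & (forall t, P t -> m <= t) /\
    forall r, 0 < r -> exists2 t, P t & t < m + r.
Proof.
move=> [t0 P0] Pa; have hi : has_inf [set t | P t].
  by split; [exists t0|exists a].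
exists (inf [set t | P t]); first by apply: lb_le_inf; [exists t0|].
split=> [t Pt|r r0]; first by apply: ge_inf => //; exists a.
by have [t Pt h] := inf_adherent r0 hi; exists t.
Qed.

(* The values just before [p] are also attained just before [q]. *)
Lemma reg_coincidence gam l p q : reg A gam 0 l -> 0 < p -> p < q -> q <= l ->
  gam p = gam q -> exists t s, [/\ 0 <= t, t < p, t < s, s <= l & gam t = gam s].
Proof.
move=> gr p0 pq ql e.
have pI : 0 <= p <= l by lra.
have qI : 0 <= q <= l by lra.
have [c Ac cx] := ga_cover GA (gam p); have nc := ga_chart GA Ac.
have [u [u' [U [r1 r10 H1]]]] := reg_chart gr pI Ac cx.
have [|v [v' [V [r2 r20 H2]]]] := reg_chart gr qI Ac; first by rewrite -e.
have [ui [ui' [UI uK uiK]]] := sm_inv U.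
have uv : u p = v q.
  have [|_ <-] := H1 p pI; first by rewrite subrr normr0.
  by have [|_ <-] := H2 q qI; rewrite ?subrr ?normr0 // e.
have m0 : 0 < Num.min r1 p by rewrite lt_min r10.
have [r3 r30 H3] := sm_cont (sm_comp UI V) q m0.
pose h := Num.min (Num.min r2 r3) (q - p).
have h0 : 0 < h by rewrite !lt_min r20 r30 subr_gt0.
have [hr2 hr3 hq] : [/\ h <= r2, h <= r3 & h <= q - p].
  by rewrite /h !ge_min !lexx !orbT.
pose s := q - h / 2; pose t := ui (v s).
have sq : s < q by rewrite /s; lra.
have ps : p < s by rewrite /s; lra.
have sqh : `|s - q| < h by rewrite /s ltr_norml; lra.
have tp : t < p by rewrite -(sm_lt U) /t uiK uv (sm_lt V).
have := H3 s I (lt_le_trans sqh hr3); rewrite /= -uv uK -/t lt_min => /andP[t1 t2].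
have t0 : 0 <= t by move: t2; rewrite ltr_norml; lra.
exists t, s; split=> //; [lra|lra|].
have [|ct tE] := H1 t _ t1; first lra.
have [|cs sE] := H2 s _ (lt_le_trans sqh hr2); first lra.
by apply: (nice_inj nc) => //; rewrite tE sE uiK.
Qed.

(** Take the least parameter [p0] whose point is visited again later. If [p0 > 0], [reg_coincidence]
    yields a smaller one. *)
Lemma reg_return gam l t1 t2 : reg A gam 0 l -> 0 <= t1 -> t1 < t2 ->
  t2 <= l -> gam t1 = gam t2 -> exists2 t, 0 < t <= t2 & gam t = gam 0.
Proof.
move=> gr0 t10 t12 t2l e12.
have gr : reg A gam 0 t2 by apply: reg_sub gr0.
move: l gr0 t2l => _ _ _.
pose S p := 0 <= p <= t2 /\ exists2 q, p < q <= t2 & gam p = gam q.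
have [||p0 p00 [lb ad]] := @inf_witness S 0.
- by exists t1; split; [lra|exists t2; [lra|]].
- by move=> t []; lra.
have p0t : p0 <= t1 by apply: lb; split; [lra|exists t2; [lra|]].
have p0I : 0 <= p0 <= t2 by lra.
have [r r0 inj] := reg_inj_near gr p0I.
(* The infimum is attained: by local injectivity, the second visits for parameters near [p0] happen
   no earlier than [p0 + r], on a piece of the arc whose image is closed. *)
have [q0 q0I e0] : exists2 q, p0 < q <= t2 & gam p0 = gam q.
  apply: contrapT => no.
  have r20 : 0 < r / 2 by lra.
  have [p1 [p1I [q1 q1I e1]] p1r] := ad _ r20.
  have q1r : p0 + r <= q1.
    rewrite leNgt; apply/negP => q1r.
    suff : p1 = q1 by lra.
    have lb1 : p0 <= p1 by apply: lb; split=> //; exists q1.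
    by apply: inj; rewrite ?ltr_norml //; lra.
  have gr' : reg A gam (p0 + r) t2 by apply: reg_sub gr; lra.
  have r1t : p0 + r <= t2 by lra.
  have cl := reg_closed r1t gr'.
  have oU : open (~` (gam @` `[p0 + r, t2])) by exact: closed_openC.
  have [|r3 r30 H3] := reg_near gr p0I oU.
    move=> [q /=]; rewrite in_itv /= => qI eq; apply: no; exists q => //; lra.
  have m0 : 0 < Num.min (r / 2) r3 by rewrite lt_min r30 r20.
  have [p2 Sp2 p2r] := ad _ m0; have lb2 := lb _ Sp2.
  move: Sp2 => [p2I [q2 q2I e2]].
  have : Num.min (r / 2) r3 <= r3 by rewrite ge_min lexx orbT.
  have : Num.min (r / 2) r3 <= r / 2 by rewrite ge_min lexx.
  move=> h1 h2; apply: (H3 p2) => //; first by rewrite ltr_norml; lra.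
  exists q2; last by [].
  rewrite /= in_itv /= leNgt; apply/andP; split; last lra.
  apply/negP => q2r; suff : p2 = q2 by lra.
  by apply: inj; rewrite ?ltr_norml //; lra.
have [p0E|p0E] := eqVneq p0 0; first by exists q0; [lra|rewrite -e0 p0E].
have p0E' : 0 < p0 by rewrite lt_def p0E.
have [pq qt] := andP q0I.
have [t [s [t0 tp ts st e]]] := reg_coincidence gr p0E' pq qt e0.
have : p0 <= t by apply: lb; split; [lra|exists s; [rewrite ts|]].
lra.
Qed.

End Atlas.
End Paths.

(** Lists directed by inclusion supply the filter for the near-covering form of compactness. *)
Lemma compact_finite_nbhs (T : topologicalType) (U : T -> set T) :
  compact [set: T] -> (forall x, nbhs x (U x)) ->
  exists s : seq T, forall y, exists2 x, x \in s & U x y.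
Proof.
move=> /compact_near_coveringP cT Ux.
pose F := filter_from [set: seq T] (fun s0 => [set s : seq T | {subset s0 <= s}]).
have FF : Filter F.
  apply: filter_from_filter; first by exists [::].
  move=> s1 s2 _ _; exists (s1 ++ s2) => // s /= h.
  by split=> x xs; apply: h; rewrite mem_cat xs ?orbT.
have [|s0 _ H] := cT _ F (fun s y => exists2 x, x \in s & U x y) FF.
  move=> x _; exists (U x, [set s : seq T | x \in s]) => /=.
    by split; [exact: Ux|exists [:: x] => // s /=; apply; rewrite mem_head].
  by move=> [y s] /= [Uy xs]; exists x.
by exists s0 => y; apply: (H s0).
Qed.

(** * Continuing an arc until it ends or meets itself *)

Section Runs.
Variables (R : realType) (M : topologicalType) (A : set (chart R M)).
Hypothesis GA : good_atlas A.
Implicit Types (c d : chart R M) (x y : M) (gam : R -> M) (p q t s l : R).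

(** Around each point a single target serves all nearby starting points: a point slightly to the
    right in the chart, or the boundary point itself. Compactness leaves finitely many targets. *)
Lemma finite_ends : exists E : seq M, forall x, rterm A x \/ exists c v,
  [/\ A c, chart_dom c x, chart_map c x < v,
    forall s, chart_map c x <= s <= v -> chart_img c s & chart_inv c v \in E].
Proof.
have loc x : exists e, nbhs x [set y | rterm A y \/ exists c v,
    [/\ A c, chart_dom c y, chart_map c y < v,
    forall s, chart_map c y <= s <= v -> chart_img c s & chart_inv c v = e]].
  have [c Ac cx] := ga_cover GA x; have nc := ga_chart GA Ac.
  have [r r0 H] := nice_shape nc cx; set m := chart_map c x in H.
  case: H => [H|[H K]|[H K]].
  - exists (chart_inv c (m + r / 2)).
    have r20 : 0 < r / 2 by lra.
    have := nice_near nc cx r20; apply: filterS => y [cy].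
    rewrite ltr_norml -/m => yr; right; exists c, (m + r / 2); split=> //; first lra.
    by move=> s sr; apply: H; rewrite ltr_norml; lra.
  - exists (chart_inv c (m + r / 2)).
    have r20 : 0 < r / 2 by lra.
    have := nice_near nc cx r20; apply: filterS => y [cy].
    rewrite ltr_norml -/m => yr; right; exists c, (m + r / 2); split=> //; first lra.
    by move=> s sr; have := K y cy => h; apply: H; lra.
  - exists (chart_inv c m).
    have := nice_near nc cx r0; apply: filterS => y [cy].
    rewrite ltr_norml -/m => yr; have := K y cy; rewrite le_eqVlt => /predU1P[e|h].
      by left; exists c; split=> //; rewrite e.
    right; exists c, m; split=> // s sr; apply: H; lra.
have [e He] := choice loc.
have [s Hs] := compact_finite_nbhs (ga_compact GA) He.
exists [seq e x | x <- s] => y; have [x xs [yt|[c [v [Ac cy yv img ve]]]]] := Hs y.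
  by left.
by right; exists c, v; split=> //; rewrite ve; exact: map_f.
Qed.

(** Every continuation ends in the finite set [E]. After one more continuation than [E] has members,
    two arrivals agree unless a boundary point has stopped the arc. *)
Lemma run gam0 l0 : 0 <= l0 -> reg A gam0 0 l0 -> exists l gam,
  [/\ l0 <= l, reg A gam 0 l, gam 0 = gam0 0 & rterm A (gam l) \/
    exists t1 t2, [/\ 0 <= t1, t1 < t2, t2 <= l & gam t1 = gam t2]].
Proof.
move=> l00 gr0; have [E HE] := finite_ends.
have [l [gam [ll gr g0 H]]] : exists l gam,
  [/\ l0 <= l, reg A gam 0 l, gam 0 = gam0 0 & rterm A (gam l) \/
    exists ts : seq R, [/\ size ts = (size E).+1, uniq ts &
      forall t, t \in ts -> 0 <= t <= l /\ gam t \in E]].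
  elim: _.+1 => [|n [l [gam [ll gr g0 H]]]].
    by exists l0, gam0; split=> //; right; exists [::].
  case: H => [H|[ts [tsn tsu tsE]]]; first by exists l, gam; split=> //; left.
  have [lt|[c [v [Ac cx xv img vE]]]] := HE (gam l).
    by exists l, gam; split=> //; left.
  have l0' : 0 <= l by lra.
  have [l' [gam' [ll' gr' gE ge]]] := reg_extend GA l0' gr Ac cx xv img.
  exists l', gam'; split=> //; [lra|by rewrite gE|right].
  exists (l' :: ts); split=> [||t] /=.
  - by rewrite tsn.
  - rewrite tsu andbT; apply/negP => /tsE[]; lra.
  - rewrite inE => /predU1P[->|/tsE[tl tE]]; first by split; [lra|rewrite ge].
    by split; [lra|rewrite gE //; lra].
exists l, gam; split=> //; case: H => [|[ts [tsn tsu tsE]]]; first by left.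
right; apply: contrapT => no.
have inj : {in ts &, injective gam}.
  move=> s t /tsE[sl _] /tsE[tl _] e; have [h|h|//] := ltgtP s t; exfalso; apply: no.
    by exists s, t; split; [lra|done|lra|].
  by exists t, s; split; [lra|done|lra|].
have : (size [seq gam t | t <- ts] <= size E)%N.
  apply: uniq_leq_size; first by rewrite map_inj_in_uniq.
  by move=> _ /mapP[t /tsE[_ tE] ->].
by rewrite size_map tsn ltnn.
Qed.

Definition lterm x := exists c, [/\ A c, chart_dom c x &
  forall y, chart_dom c y -> chart_map c x <= chart_map c y].

(** At an end of [[p, q]] the side that the arc does not reach is absent from the chart, by the
    boundary condition. *)
Lemma reg_nbhs gam p q t : reg A gam p q -> p < q -> p <= t <= q ->
  p < t \/ lterm (gam t) -> t < q \/ rterm A (gam t) ->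
  nbhs (gam t) (gam @` `[p, q]).
Proof.
move=> gr pq tpq tp tq.
have [c [Ac ct cl cr]] : exists c, [/\ A c, chart_dom c (gam t),
    p < t \/ forall y, chart_dom c y -> chart_map c (gam t) <= chart_map c y &
    t < q \/ forall y, chart_dom c y -> chart_map c y <= chart_map c (gam t)].
  case: tp => [tp|[c [Ac ct H]]].
    case: tq => [tq|[c [Ac ct H]]]; last by exists c; split=> //; [left|right].
    have [c Ac ct] := ga_cover GA (gam t); exists c; split=> //; by left.
  case: tq => [tq|tq]; first by exists c; split=> //; [right|left].
  have [pt|tp] := ltP p t; last by exists c; split=> //; [right|left; lra].
  by case: tq => d [Ad dt K]; exists d; split=> //; [left|right].
have nc := ga_chart GA Ac.
have [u [u' [U [r r0 H]]]] := reg_chart GA gr tpq Ac ct.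
have [|_ tE] := H t tpq; first by rewrite subrr normr0.
have [ui [ui' [UI uK uiK]]] := sm_inv U.
have r20 : 0 < r / 2 by lra.
pose p1 := Num.max p (t - r / 2); pose q1 := Num.min q (t + r / 2).
have [p1a p1b] : p <= p1 /\ t - r / 2 <= p1 by rewrite /p1 !le_max !lexx orbT.
have [q1a q1b] : q1 <= q /\ q1 <= t + r / 2 by rewrite /q1 !ge_min !lexx orbT.
have [n1 n10 N1] : exists2 n, 0 < n & forall y, chart_dom c y ->
    `|chart_map c y - chart_map c (gam t)| < n -> u p1 <= chart_map c y.
  have [h|h] := ltP p1 t.
    exists (u t - u p1); first by rewrite subr_gt0 (sm_lt U).
    by move=> y cy; rewrite tE ltr_norml; lra.
  exists 1 => // y cy _; case: cl => [cl|cl].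
    by move: h; rewrite /p1 le_max; case/orP; lra.
  apply: le_trans (cl y cy); rewrite tE (sm_le U) /p1 ge_max; lra.
have [n2 n20 N2] : exists2 n, 0 < n & forall y, chart_dom c y ->
    `|chart_map c y - chart_map c (gam t)| < n -> chart_map c y <= u q1.
  have [h|h] := ltP t q1.
    exists (u q1 - u t); first by rewrite subr_gt0 (sm_lt U).
    by move=> y cy; rewrite tE ltr_norml; lra.
  exists 1 => // y cy _; case: cr => [cr|cr].
    by move: h; rewrite /q1 ge_min; case/orP; lra.
  apply: le_trans (cr y cy) _; rewrite tE (sm_le U) /q1 le_min; lra.
have n0 : 0 < Num.min n1 n2 by rewrite lt_min n10.
have := nice_near nc ct n0; apply: filterS => y [cy].
rewrite lt_min => /andP[/(N1 y cy) h1 /(N2 y cy) h2].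
have s1 : p1 <= ui (chart_map c y) by rewrite -(sm_le U) uiK.
have s2 : ui (chart_map c y) <= q1 by rewrite -(sm_le U) uiK.
exists (ui (chart_map c y)); first by rewrite /= in_itv /=; lra.
have [||cs sE] := H (ui (chart_map c y)); first lra.
  by rewrite ltr_norml; lra.
by apply: (nice_inj nc) => //; rewrite sE uiK.
Qed.

Lemma reg_reparam gam p q p' q' h h' : sm h h' -> h p' = p -> h q' = q ->
  reg A gam p q -> reg A (gam \o h) p' q'.
Proof.
move=> HS hp hq gr t tpq.
have hpq s : p' <= s <= q' -> p <= h s <= q by rewrite -hp -hq !(sm_le HS).
have [c [u [u' [Ac U [r r0 H]]]]] := gr (h t) (hpq t tpq).
have [r1 r10 H1] := sm_cont HS t r0.
exists c, (u \o h), (fun s => u' (h s) * h' s); split=> //; first exact: sm_comp.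
by exists r1 => // s spq sr; apply: H; [exact: hpq|exact: H1].
Qed.

End Runs.

(** * Circles and intervals *)

Section Components.
Variables (R : realType) (M : topologicalType) (A : set (chart R M)).
Hypothesis GA : good_atlas A.
Implicit Types (c d : chart R M) (x y : M) (gam Gam : R -> M) (p q t s l : R).

(* [Gam] is a 1-periodic parametrization of a circle component, or runs back and
   forth along an interval component, in which case [Gam (- t) = Gam t]. *)
Record component_param Gam : Prop := {
  param_inj : forall s t, Gam s = Gam t ->
    exists k : int, s - t = k%:~R \/ s + t = k%:~R ;
  param_periodic : forall t (k : int), Gam (t + k%:~R) = Gam t ;
  param_open : open (range Gam) ;
  param_closed : closed (range Gam) ;
  param_connected : forall (B : set M) s t, open B -> closed B ->
    B (Gam s) -> B (Gam t) ;
  param_lift : forall f g, local_smooth A f -> local_smooth A g ->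
    cancel f g -> cancel g f -> (forall t, range Gam (f (Gam t))) ->
    (forall t, range Gam (g (Gam t))) -> exists F F',
    [/\ sm F F', forall t, F (t + 1) = F t + 1 & forall t, Gam (F t) = f (Gam t)] }.

Lemma reg_connected gam p q s t (B : set M) : reg A gam p q ->
  p <= s <= q -> p <= t <= q -> open B -> closed B -> B (gam s) -> B (gam t).
Proof.
move=> gr spq tpq oB cB Bs.
have cn : connected (gam @` `[p, q]).
  apply: connected_continuous_connected; first exact: segment_connected.
  exact: (reg_continuous GA gr).
have sI : (gam @` `[p, q]) (gam s) by exists s => //=; rewrite in_itv.
have e : gam @` `[p, q] `&` B = gam @` `[p, q].
  by apply: cn; [exists (gam s)|exists B|exists B].
suff : (gam @` `[p, q] `&` B) (gam t) by case.
by rewrite e; exists t => //=; rewrite in_itv.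
Qed.

(** The first return time is positive by local injectivity. Before it the arc is injective, because
    by [reg_return] a coincidence forces a return to the start. *)
Lemma first_return gam t0 : 0 < t0 -> reg A gam 0 t0 -> gam t0 = gam 0 ->
  exists2 l, 0 < l <= t0 & gam l = gam 0 /\
    forall s t, 0 <= s -> s < t -> t < l -> gam s <> gam t.
Proof.
move=> t00 gr e0.
have [||l l0 [lb ad]] := @inf_witness R (fun t => 0 < t <= t0 /\ gam t = gam 0) 0.
- by exists t0; split=> //; lra.
- by move=> t [? _]; lra.
have lt0 : l <= t0 by apply: lb; split=> //; lra.
have I0 : 0 <= (0 : R) <= t0 by rewrite lexx ltW.
have [r r0 inj] := reg_inj_near gr I0.
have lr : r <= l.
  rewrite leNgt; apply/negP => lr; have rl : 0 < r - l by lra.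
  have [t [tI te] tl] := ad _ rl.
  suff : t = 0 by lra.
  by apply: inj => //; rewrite ?ltr_norml; lra.
have Il : 0 <= l <= t0 by lra.
exists l; first lra; split.
  apply: contrapT => ne.
  have oU : open (~` [set gam 0]).
    apply: closed_openC; apply: accessible_closed_set1.
    exact: hausdorff_accessible (ga_hausdorff GA).
  have [r1 r10 H] := reg_near GA gr Il oU ne.
  have [t [tI te] tl] := ad _ r10.
  have lt : l <= t by apply: lb.
  by apply: (H t) => //; [lra|rewrite ltr_norml; lra].
move=> s t s0 st tl e; have tt0 : t <= t0 by lra.
have [t1 t1I t1e] := reg_return GA gr s0 st tt0 e.
have : l <= t1 by apply: lb; split=> //; lra.
lra.
Qed.

Lemma greg_reg Gam : (forall t, reg A Gam (t - 1) (t + 1)) ->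
  forall p q, reg A Gam p q.
Proof.
move=> gr p q t tpq; have [|c [u [u' [Ac U [r r0 H]]]]] := gr t t; first lra.
exists c, u, u'; split=> //; exists (Num.min r 1); first by rewrite lt_min r0 ltr01.
by move=> s _; rewrite lt_min ltr_norml => /andP[h1 h2]; apply: H; rewrite ?ltr_norml; move: h2; rewrite ltr_norml; lra.
Qed.

Lemma local_lift Gam f t p : (forall p q, reg A Gam p q) -> local_smooth A f ->
  Gam p = f (Gam t) -> exists r r', [/\ sm r r', r t = p &
    exists2 e, 0 < e & forall s, `|s - t| < e -> Gam (r s) = f (Gam s)].
Proof.
move=> gr fs e; have [d Ad dp] := ga_cover GA (Gam p).
have z (v : R) : `|v - v| = 0 :> R by rewrite subrr normr0.
have I1 (v : R) : v - 1 <= v <= v + 1 by lra.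
have [u [u' [U [r1 r10 H1]]]] := reg_chart GA (gr (p - 1) (p + 1)) (I1 p) Ad dp.
have dt : chart_dom d (f (Gam t)) by rewrite -e.
have [w [w' [W [r2 r20 H2]]]] := reg_image fs (gr (t - 1) (t + 1)) (I1 t) Ad dt.
have [ui [ui' [UI uK uiK]]] := sm_inv U.
have S := sm_comp UI W.
have rt : (ui \o w) t = p.
  have [||_ h1] := H1 p; rewrite ?z ?I1 //; have [||_ h2] := H2 t; rewrite ?z ?I1 //.
  by rewrite /= -h2 -e h1 uK.
exists (ui \o w), (fun v => ui' (w v) * w' v); split=> //.
have m0 : 0 < Num.min r1 1 by rewrite lt_min r10 ltr01.
have [r3 r30 H3] := sm_cont S t m0.
exists (Num.min (Num.min r2 r3) 1); first by rewrite !lt_min r20 r30 ltr01.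
move=> s; rewrite !lt_min => /andP[/andP[s2 s3] s1].
have := H3 s I s3; rewrite rt lt_min => /andP[h1 h2].
have [||a1 b1] := H1 ((ui \o w) s) => //; first by move: h2; rewrite ltr_norml; lra.
have [||a2 b2] := H2 s => //; first by move: s1; rewrite ltr_norml; lra.
by apply: (nice_inj (ga_chart GA Ad)) => //; rewrite b1 b2 /= uiK.
Qed.

(* The derivative [l (1 + th - 2 th t)] is chosen so that its values at the end
   points are in the ratio [m1 / m0]. *)
Lemma quadratic_reparam l m0 m1 : 0 < l -> 0 < m0 -> 0 < m1 -> exists h h',
  [/\ sm h h', h 0 = 0, h 1 = l & m0 * h' 0 = m1 * h' 1].
Proof.
move=> l0 m00 m10; pose th := (m1 - m0) / (m1 + m0).
have [tha thb] : -1 < th /\ th < 1.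
  by rewrite /th ltr_pdivlMr ?ltr_pdivrMr; lra.
pose h t := l * t * (1 + th * (1 - t)); pose h' t := l * (1 + th - 2 * th * t).
have h'0 t : 0 <= t <= 1 -> 0 < h' t.
  move=> tI; rewrite /h' mulr_gt0 //.
  have -> : 1 + th - 2 * th * t = (1 + th) * (1 - t) + (1 - th) * t by ring.
  have p1 : 0 <= (1 + th) * (1 - t) by rewrite mulr_ge0; lra.
  have p2 : 0 <= (1 - th) * t by rewrite mulr_ge0; lra.
  have [th2|th2] := ltP t 1; last by rewrite (_ : t = 1); lra.
  have : 0 < (1 + th) * (1 - t) by rewrite mulr_gt0; lra.
  lra.
have hd t : 0 <= t <= 1 -> der_at `[0, 1] h t (h' t).
  move=> _ e e0; exists (e / (l * `|th| + 1)).
    by rewrite divr_gt0 // ltr_wpDl // mulr_ge0 // ltW.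
  move=> y _; rewrite ltr_pdivlMr; last by rewrite ltr_wpDl // mulr_ge0 // ltW.
  move=> yt; have -> : h y - h t - h' t * (y - t) = - (l * th * (y - t)) * (y - t).
    by rewrite /h /h'; ring.
  rewrite normrM normrN ler_wpM2r // (normrM (l * th)) (normrM l) (gtr0_norm l0).
  by apply: le_trans (ltW yt); rewrite mulrDr mulr1 mulrC lerDl.
have hc t : 0 <= t <= 1 -> cont_at `[0, 1] h' t.
  move=> _; apply: (@der_cont _ _ _ _ (- (2 * l * th))).
  move=> e e0; exists 1 => // y _ _.
  by rewrite (_ : _ - _ - _ = 0) ?normr0 ?mulr_ge0 // ?(ltW e0) // /h'; ring.
have hv : dmono 0 1 (@ln R \o h').
  pose k (s : R) := Num.max 0 (Num.min s 1).
  have kab s : 0 <= k s <= 1.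
    by rewrite /k le_max lexx /= ge_max ler01 ge_min lexx orbT.
  have km s t : s <= t -> k s <= k t.
    move=> st; rewrite /k ge_max le_max lexx /= le_max.
    by apply/orP; right; rewrite le_min !ge_min st lexx orbT.
  have kE s : 0 <= s <= 1 -> k s = s.
    by move=> /andP[as_ sb]; rewrite /k (min_idPl sb) (max_idPr as_).
  have lnm s t : h' (k s) <= h' (k t) -> ln (h' (k s)) <= ln (h' (k t)).
    by move=> st; rewrite ler_ln ?posrE ?h'0.
  have [t0|t0] := leP 0 th.
    exists (fun=> 0), (fun t => - ln (h' (k t))); split=> // [s t st|s sI].
      rewrite lerN2; apply: lnm; rewrite /h' ler_pM2l //.
      have := ler_wpM2l t0 (km _ _ st); lra.
    by rewrite /= kE //; ring.
  exists (fun t => ln (h' (k t))), (fun=> 0); split=> // [s t st|s sI].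
    apply: lnm; rewrite /h' ler_pM2l //.
    have := ler_wnM2l (ltW t0) (km _ _ st); lra.
  by rewrite /= kE //; ring.
have [w [w' [W Hw]]] := sm_ext ltr01 hd hc h'0 hv.
have [|w0 w'0] := Hw 0; first by rewrite lexx ler01.
have [|w1 w'1] := Hw 1; first by rewrite lexx ler01.
exists w, w'; split=> //; rewrite ?w0 ?w1 ?w'0 ?w'1 /h /h' /th; first ring.
  ring.
by field; lra.
Qed.

End Components.

Lemma sm_shift (R : realType) (w w' : R -> R) k : sm w w' ->
  sm (fun s => w (s + k)) (fun s => w' (s + k)).
Proof.
move=> W; have := sm_comp W (sm_affine k (ltr01 : 0 < 1 :> R)).
have -> : w \o (fun s => 1 * s + k) = (fun s => w (s + k)).
  by apply/funext => s /=; rewrite mul1r.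
suff -> : (fun s => w' (1 * s + k) * 1) = (fun s => w' (s + k)) by [].
by apply/funext => s /=; rewrite mul1r mulr1.
Qed.

Lemma sm_translate (R : realType) (w w' : R -> R) a b : sm w w' ->
  sm (fun s => w (s + a) + b) (fun s => w' (s + a)).
Proof.
move=> W; have := sm_comp (sm_affine b (ltr01 : 0 < 1 :> R)) (sm_shift a W).
have -> : (fun s => 1 * s + b) \o (fun s => w (s + a)) = (fun s => w (s + a) + b).
  by apply/funext => s /=; rewrite mul1r.
suff -> : (fun s => 1 * w' (s + a)) = (fun s => w' (s + a)) by [].
by apply/funext => s; rewrite mul1r.
Qed.

(** * Circle components *)

Section Circle.
Variables (R : realType) (M : topologicalType) (A : set (chart R M)).
Hypothesis GA : good_atlas A.
Implicit Types (c d : chart R M) (x y : M) (gam Gam : R -> M) (p q t s l : R).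

Section Closed.
Variables (g : R -> M) (c : chart R M) (u u' v v' : R -> R) (r : R).
Hypotheses (gr : reg A g 0 1) (g1 : g 1 = g 0) (Ac : A c) (U : sm u u')
  (V : sm v v') (r0 : 0 < r) (uv : u' 0 = v' 1).
Hypothesis ginj : forall s t, 0 <= s -> s < t -> t < 1 -> g s <> g t.
Hypothesis gu : forall s, 0 <= s <= 1 -> s < r ->
  chart_dom c (g s) /\ chart_map c (g s) = u s.
Hypothesis gv : forall s, 0 <= s <= 1 -> 1 - r < s ->
  chart_dom c (g s) /\ chart_map c (g s) = v s.

Let Gam t := g (t - (Num.floor t)%:~R).

Let GamE (k : int) t : k%:~R <= t < k%:~R + 1 -> Gam t = g (t - k%:~R).
Proof.
move=> tk; rewrite /Gam; congr (g (_ - _%:~R)); apply: floor_def.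
by rewrite intrD.
Qed.

Let Gam_per t (k : int) : Gam (t + k%:~R) = Gam t.
Proof.
have [n tn] := int_part t; rewrite (GamE tn) (@GamE (n + k)) rmorphD /=; last lra.
by congr g; ring.
Qed.

Let Gam_inj s t : Gam s = Gam t -> exists k : int, s - t = k%:~R.
Proof.
have [m sm] := int_part s; have [n tn] := int_part t.
rewrite (GamE sm) (GamE tn) => e; exists (m - n); rewrite rmorphB /=.
have [h|h|h] := ltgtP (s - m%:~R) (t - n%:~R); last by lra.
- by exfalso; apply: ginj e; lra.
- by exfalso; apply: ginj (esym e); lra.
Qed.

Let Gam_reg p q : reg A Gam p q.
Proof.
apply: greg_reg => {p q} t' t _; have [k tk] := int_part t.
have [tk0|tk0] := eqVneq t k%:~R.
  have uv0 : v (0 + 1) = u 0.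
    have I0 : 0 <= (0 : R) <= 1 by rewrite lexx ler01.
    have I1 : 0 <= (1 : R) <= 1 by rewrite lexx ler01.
    have [_ <-] := gu I0 r0; have [|_] := gv I1; first by rewrite ltrBlDr ltrDl.
    by rewrite g1 add0r => ->.
  have uv0' : v' (0 + 1) = u' 0 by rewrite add0r.
  have W := sm_shift (- k%:~R) (sm_glue uv0 uv0' (sm_shift 1 V) U).
  do 3 eexists; split; [exact: Ac|exact: W|].
  exists (Num.min r 1); first by rewrite lt_min r0 ltr01.
  move=> s _; rewrite lt_min !ltr_norml => /andP[s1 s2].
  have [sk|ks] := leP s k%:~R.
    have [->|sk'] := eqVneq s k%:~R.
      rewrite subrr (@GamE k); last lra.
      by rewrite subrr /glue lexx uv0; apply: gu; rewrite ?lexx ?ler01.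
    have {}sk' : s < k%:~R by rewrite lt_neqAle sk'.
    have -> : Gam s = g (s - k%:~R + 1).
      by rewrite (@GamE (k - 1)) rmorphB /=; [congr g; ring|lra].
    by rewrite /glue subr_le0 sk; apply: gv; lra.
  rewrite (@GamE k); last lra.
  by rewrite /glue subr_le0 leNgt ks /=; apply: gu; lra.
have {}tk0 : k%:~R < t by rewrite lt_def tk0 /=; lra.
have [|d [w [w' [Ad W [r1 r10 H]]]]] := gr (t := t - k%:~R); first lra.
exists d, (fun s => w (s - k%:~R)), (fun s => w' (s - k%:~R)); split=> //.
  exact: sm_shift.
exists (Num.min r1 (Num.min (t - k%:~R) (k%:~R + 1 - t))).
  by rewrite !lt_min r10; apply/andP; split=> //; apply/andP; lra.
move=> s _; rewrite !lt_min => /andP[h]; rewrite !ltr_norml => /andP[h1 h2].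
rewrite (@GamE k); last lra.
apply: H; first lra.
by rewrite (_ : _ - _ - _ = s - t) //; ring.
Qed.

(** Over one period the lift takes its values in [[p0, p0 + 1)], where it is unique, and it is
    extended by [F (t + 1) = F t + 1]. Uniqueness identifies it near each point with the increasing
    lift from [local_lift]. *)
Let Gam_lift f g' : local_smooth A f -> local_smooth A g' ->
  cancel f g' -> cancel g' f -> (forall t, range Gam (f (Gam t))) ->
  (forall t, range Gam (g' (Gam t))) -> exists F F',
  [/\ sm F F', forall t, F (t + 1) = F t + 1 & forall t, Gam (F t) = f (Gam t)].
Proof.
move=> fs gs fK gK fR gR; have [p0 _ ep0] := fR 0.
have ex t : exists p, p0 <= p < p0 + 1 /\ Gam p = f (Gam t).
  have [q _ eq] := fR t; have [k qk] := int_part (q - p0).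
  exists (q + (- k)%:~R); split; last by rewrite Gam_per.
  by rewrite rmorphN /=; lra.
have [phi Hphi] := choice ex.
have uniq p q : p0 <= p < p0 + 1 -> p0 <= q < p0 + 1 -> Gam p = Gam q -> p = q.
  move=> pI qI /Gam_inj[k kE]; have : k = 0 by apply: (@int_lt1 R); lra.
  by move=> k0; rewrite k0 in kE; move: kE => /= ; lra.
pose F t := phi (t - (Num.floor t)%:~R) + (Num.floor t)%:~R.
have FE (k : int) t : k%:~R <= t < k%:~R + 1 -> F t = phi (t - k%:~R) + k%:~R.
  move=> tk; rewrite /F (_ : Num.floor t = k) //; apply: floor_def.
  by rewrite intrD.
have GF t : Gam (F t) = f (Gam t).
  have [k tk] := int_part t; rewrite (FE k) // Gam_per.
  rewrite (Hphi _).2 -[in RHS](subrK k%:~R t) Gam_per //.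
have Fper t (k : int) : F (t + k%:~R) = F t + k%:~R.
  have [n tn] := int_part t; rewrite (FE n t) // (FE (n + k) (t + _)) rmorphD /=; last lra.
  by rewrite addrA; congr (phi _ + _ + _); ring.
have FI t : 0 <= t < 1 -> p0 <= F t < p0 + 1.
  by move=> tI; rewrite (FE 0) ?add0r // subr0 addr0; have [] := Hphi t.
have F0 : F 0 = p0.
  by apply: uniq; [apply: FI; lra|lra|rewrite GF].
have Fsurj (b : R) : exists t, F t = b.
  have [t _ te] := gR b.
  have [k kE] : exists k : int, b - F t = k%:~R.
    by apply: Gam_inj; rewrite GF te gK.
  by exists (t + k%:~R); rewrite Fper; lra.
have Floc01 t : 0 <= t < 1 -> exists w w', sm w w' /\ exists2 e, 0 < e &
    forall s, `|s - t| < e -> F s = w s.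
  move=> tI; have [w [w' [W wt [e e0 H]]]] := local_lift GA Gam_reg fs (GF t).
  exists w, w'; split=> //.
  (* To the left of 0 the local lift drops below [p0], so there it is compared with [F] one period
     later. *)
  have [t0|t0] := eqVneq t 0.
    have [e1 e10 H1] := sm_cont W t ltr01.
    exists (Num.min (Num.min e e1) 1); first by rewrite !lt_min e0 e10 ltr01.
    move=> s; rewrite !lt_min t0 => /andP[/andP[h1 h2] h3].
    have := H1 s I; rewrite t0 => /(_ h2); rewrite -t0 wt t0 F0 ltr_norml => h4.
    have := H s; rewrite t0 => /(_ h1) h5.
    move: h3; rewrite subr0 ltr_norml => h3.
    have [s0|s0] := leP 0 s.
      have ws : p0 <= w s by rewrite -F0 -t0 -wt (sm_le W) t0.
      by apply: uniq; [apply: FI; lra|lra|rewrite GF].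
    have ws : w s < p0 by rewrite -F0 -t0 -wt (sm_lt W) t0.
    have : F (s + 1) = w s + 1.
      apply: uniq; [apply: FI; lra|lra|].
      by rewrite GF (Gam_per s 1) (Gam_per (w s) 1).
    by have := Fper s 1 => /= ->; lra.
  have {}t0 : 0 < t by rewrite lt_def t0 /=; lra.
  have := FI t tI; rewrite le_eqVlt => /andP[/predU1P[Ft|Ft1] Ft2].
    exfalso; have : t = 0; last lra.
    have : Gam t = Gam 0 by apply: (can_inj fK); rewrite -!GF F0 Ft.
    move=> /Gam_inj[k]; rewrite subr0 => kE; have k0 : k = 0 by apply: (@int_lt1 R); lra.
    by rewrite kE k0.
  have m0 : 0 < Num.min (F t - p0) (p0 + 1 - F t) by rewrite lt_min; lra.
  have [e1 e10 H1] := sm_cont W t m0.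
  exists (Num.min (Num.min e e1) (Num.min t (1 - t))).
    by rewrite !lt_min e0 e10; lra.
  move=> s; rewrite !lt_min => /andP[/andP[h1 h2] /andP[h3 h4]].
  have := H1 s I h2; rewrite wt lt_min !ltr_norml => h5.
  move: h3 h4; rewrite !ltr_norml => h3 h4.
  by apply: uniq; [apply: FI; lra|lra|rewrite GF H].
have [t|F' FS] := sm_loc Fsurj.
  have [k tk] := int_part t.
  have [|w [w' [W [e e0 H]]]] := Floc01 (t - k%:~R); first lra.
  do 2 eexists; split; first exact: sm_translate (- k%:~R) k%:~R W.
  exists e => // s st.
  rewrite -H; last by rewrite (_ : _ - _ - _ = s - t) //; ring.
  by rewrite -Fper subrK.
by exists F, F'; split=> // t; exact: (Fper t 1).
Qed.

Lemma closed_component : component_param A Gam /\ Gam 0 = g 0.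
Proof.
have rE : range Gam = Gam @` `[0, 1].
  apply/seteqP; split=> _ [t _ <-]; last by exists t.
  have [k tk] := int_part t; exists (t - k%:~R); first by rewrite /= in_itv /=; lra.
  by rewrite -[in RHS](subrK k%:~R t) Gam_per.
have nb (t : R) : nbhs (Gam t) (range Gam).
  have t1 : t - 1 < t + 1 by lra.
  have t2 : t - 1 < t by lra.
  have t3 : t < t + 1 by lra.
  have t4 : t - 1 <= t <= t + 1 by lra.
  have := reg_nbhs GA (@Gam_reg (t - 1) (t + 1)) t1 t4 (or_introl t2) (or_introl t3).
  by apply: filterS => _ [s _ <-]; exists s.
split; last by rewrite (@GamE 0) ?subr0 //; rewrite add0r lexx ltr01.
split=> [s t /Gam_inj[k kE]||||B s t oB cB|f g' ] //.
- by exists k; left.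
- by rewrite openE => _ [t _ <-]; exact: nb.
- by rewrite rE; apply: (reg_closed GA) => //; exact: Gam_reg.
- apply: (reg_connected GA (@Gam_reg (Num.min s t) (Num.max s t))) => //.
    by rewrite ge_min lexx le_max lexx.
  by rewrite ge_min lexx le_max lexx !orbT.
- exact: Gam_lift.
Qed.

End Closed.

(** The chart velocities at the two ends of [[0, l]] may differ. [quadratic_reparam] makes them
    agree, so that the periodic extension is differentiable where it closes up. *)
Lemma circle_component gam l : 0 < l -> reg A gam 0 l -> gam l = gam 0 ->
  (forall s t, 0 <= s -> s < t -> t < l -> gam s <> gam t) ->
  exists Gam, component_param A Gam /\ Gam 0 = gam 0.
Proof.
move=> l0 gr ge ginj.
have [c Ac c0] := ga_cover GA (gam 0); have cl : chart_dom c (gam l) by rewrite ge.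
have I0 : 0 <= (0 : R) <= l by rewrite lexx ltW.
have Il : 0 <= l <= l by rewrite lexx ltW.
have [u [u' [U [r1 r10 H1]]]] := reg_chart GA gr I0 Ac c0.
have [v [v' [V [r2 r20 H2]]]] := reg_chart GA gr Il Ac cl.
have u0 : 0 < u' 0 by case: U.
have v0 : 0 < v' l by case: V.
have [h [h' [HS h0 h1 hh]]] := quadratic_reparam l0 u0 v0.
have hI s : 0 <= s <= 1 -> 0 <= h s <= l.
  by move=> /andP[s0 s1]; rewrite -{1}h0 -h1 !(sm_le HS) s0.
have [r3 r30 H3] := sm_cont HS 0 r10; have [r4 r40 H4] := sm_cont HS 1 r20.
have r0 : 0 < Num.min r3 r4 by rewrite lt_min r30.
have gr' := reg_reparam HS h0 h1 gr.
have uv : u' (h 0) * h' 0 = v' (h 1) * h' 1 by rewrite h0 h1.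
have ge' : (gam \o h) 1 = (gam \o h) 0 by rewrite /= h0 h1.
have [] := @closed_component (gam \o h) c (u \o h) (fun t => u' (h t) * h' t)
  (v \o h) (fun t => v' (h t) * h' t) _ gr' ge' Ac (sm_comp U HS)
  (sm_comp V HS) r0 uv.
- move=> s t s0 st t1; apply: ginj.
  + by rewrite -[leLHS]h0 (sm_le HS).
  + by rewrite (sm_lt HS).
  + by rewrite -[ltRHS]h1 (sm_lt HS).
- move=> s sI; rewrite lt_min => /andP[s3 _]; apply: H1; first exact: hI.
  by rewrite -[in X in _ - X]h0; apply: H3 => //; rewrite ltr_norml; lra.
- move=> s sI sr; apply: H2; first exact: hI.
  rewrite -[in X in _ - X]h1; apply: H4 => //.
  have : Num.min r3 r4 <= r4 by rewrite ge_min lexx orbT.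
  by rewrite ltr_norml; lra.
move=> C e; eexists; split; first exact: C.
by apply: (etrans e); rewrite /= h0.
Qed.

End Circle.

Lemma nearest_int (R : realType) (t : R) :
  exists k : int, k%:~R - 2^-1 <= t < k%:~R + 2^-1.
Proof. by have [k kt] := int_part (t + 2^-1); exists k; lra. Qed.

(* An increasing map of [0, 1/2] onto itself extends to an odd map commuting with
   [t + 1]. *)
Section OddExtension.
Variables (R : realType) (G : R -> R).
Implicit Types (s t z : R).
Hypothesis G0 : G 0 = 0.
Hypothesis G1 : G 2^-1 = 2^-1.
Hypothesis GI : forall t, 0 <= t <= 2^-1 -> 0 <= G t <= 2^-1.
Hypothesis Gonto : forall z, 0 <= z <= 2^-1 -> exists2 t, 0 <= t <= 2^-1 & G t = z.
Hypothesis Gloc : forall t, 0 <= t <= 2^-1 -> exists r r', [/\ sm r r', r t = G t &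
  exists2 e, 0 < e & forall s, 0 <= s <= 2^-1 -> `|s - t| < e -> G s = r s].

Let Gh := glue 0 (fun s => - G (- s)) G.

Let GhN s : s <= 0 -> Gh s = - G (- s).
Proof. by rewrite /Gh /glue => ->. Qed.

Let GhP s : 0 <= s -> Gh s = G s.
Proof. by move=> s0; rewrite /Gh glue_r // oppr0 G0 oppr0. Qed.

Let Ghabs s : - 2^-1 <= s <= 2^-1 -> `|Gh s| = G `|s|.
Proof.
move=> sI; have [s0|s0] := leP 0 s.
  rewrite GhP // (ger0_norm s0) ger0_norm //.
  by have /andP[] : 0 <= G s <= 2^-1 by apply: GI; lra.
rewrite GhN ?ltW // normrN (ltr0_norm s0) ger0_norm //.
by have /andP[] : 0 <= G (- s) <= 2^-1 by apply: GI; lra.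
Qed.

Let Ghloc t : - 2^-1 < t < 2^-1 -> exists w w', sm w w' /\ exists2 e, 0 < e &
  forall s, - 2^-1 <= s <= 2^-1 -> `|s - t| < e -> Gh s = w s.
Proof.
move=> tI; have [t0|t0|t0] := ltgtP t 0.
- have [|r [r' [RS _ [e e0 H]]]] := @Gloc (- t); first lra.
  exists (fun s => - r (- s)), (fun s => r' (- s)); split; first exact: sm_reflect.
  exists (Num.min e (- t)); first by rewrite lt_min e0 oppr_gt0.
  move=> s sI; rewrite lt_min => /andP[se]; rewrite ltr_norml => st.
  rewrite GhN; last lra.
  by rewrite H; [|lra|rewrite -opprD normrN].
- have [|r [r' [RS _ [e e0 H]]]] := @Gloc t; first lra.
  exists r, r'; split=> //.
  exists (Num.min e t); first by rewrite lt_min e0.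
  move=> s sI; rewrite lt_min => /andP[se]; rewrite ltr_norml => st.
  rewrite GhP; last lra.
  by apply: H => //; lra.
- have I0 : 0 <= (0 : R) <= 2^-1 by lra.
  have [r [r' [RS rz [e e0 H]]]] := Gloc I0.
  have W : sm (glue 0 (fun s => - r (- s)) r) (glue 0 (fun s => r' (- s)) r').
    by apply: sm_glue (sm_reflect RS) RS; rewrite oppr0 // rz G0 oppr0.
  do 2 eexists; split; [exact: W|exists e => // s sI].
  rewrite t0 subr0 => se; rewrite /Gh /glue; case: (leP s 0) => s0.
    by rewrite H // ?subr0 ?normrN //; lra.
  by rewrite H // ?subr0 //; lra.
Qed.

Let F t := Gh (t - (Num.floor (t + 2^-1))%:~R) + (Num.floor (t + 2^-1))%:~R.

Let FE (k : int) t : k%:~R - 2^-1 <= t <= k%:~R + 2^-1 ->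
  F t = Gh (t - k%:~R) + k%:~R.
Proof.
move=> tk; rewrite /F; have [h|h] := ltP t (k%:~R + 2^-1).
  rewrite (_ : Num.floor (t + 2^-1) = k) //; apply: floor_def.
  by rewrite intrD /=; lra.
rewrite (_ : Num.floor (t + 2^-1) = k + 1); last first.
  by apply: floor_def; rewrite !intrD /=; lra.
have -> : t - (k + 1)%:~R = - 2^-1 by rewrite intrD /=; lra.
have -> : t - k%:~R = 2^-1 by lra.
rewrite (GhP (s := 2^-1)) ?(GhN (s := - 2^-1)) ?opprK ?G1 ?intrD /=; lra.
Qed.

Let Fsurj z : exists t, F t = z.
Proof.
have [k zk] := nearest_int z.
have zI : 0 <= `|z - k%:~R| <= 2^-1 by rewrite normr_ge0 ler_norml; lra.
have [y yI yE] := Gonto zI; have [z0|z0] := leP 0 (z - k%:~R).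
  exists (y + k%:~R); rewrite (FE (k := k)); last lra.
  by rewrite addrK GhP ?yE ?ger0_norm ?subrK //; case/andP: yI.
exists (- y + k%:~R); rewrite (FE (k := k)); last lra.
by rewrite addrK GhN ?opprK ?yE ?(ltr0_norm z0) ?opprK ?subrK //; lra.
Qed.

Let Floc t : exists w w', sm w w' /\ exists2 e, 0 < e &
  forall s, `|s - t| < e -> F s = w s.
Proof.
have [k kt] := nearest_int t; have [tk|tk] := ltP (k%:~R - 2^-1) t.
  have [|w [w' [W [e e0 H]]]] := @Ghloc (t - k%:~R); first lra.
  do 2 eexists; split; first exact: sm_translate (- k%:~R) k%:~R W.
  exists (Num.min e (Num.min (t - (k%:~R - 2^-1)) (k%:~R + 2^-1 - t))).
    by rewrite !lt_min e0; lra.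
  move=> s; rewrite !lt_min => /andP[se]; rewrite !ltr_norml => h.
  rewrite (FE (k := k)) ?H //; try lra.
  by rewrite (_ : _ - _ - _ = s - t) //; ring.
have tE : t = k%:~R - 2^-1 by lra.
have I1 : 0 <= (2^-1 : R) <= 2^-1 by lra.
have [r [r' [RS rz [e e0 H]]]] := Gloc I1.
have W1 := sm_translate (1 - k%:~R) (k%:~R - 1) RS.
have W2 := sm_translate (- k%:~R) k%:~R (sm_reflect RS).
have e1 : t + (1 - k%:~R) = 2^-1 by lra.
have e2 : - (t + - k%:~R) = 2^-1 by lra.
have W := sm_glue (b := t) _ _ W1 W2.
do 2 eexists; split; first by apply: W; rewrite e1 e2 // rz G1; lra.
exists (Num.min e 2^-1); first by rewrite lt_min e0 /= invr_gt0 ltr0n.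
move=> s; rewrite lt_min => /andP[se]; rewrite ltr_norml /glue => h.
case: (leP s t) => st.
  rewrite (FE (k := k - 1)) rmorphB /=; last lra.
  rewrite GhP; last lra.
  have -> : s - (k%:~R - 1) = s + (1 - k%:~R) by ring.
  rewrite H //; first lra.
  by rewrite -e1 (_ : _ - _ = s - t) //; ring.
rewrite (FE (k := k)) ?GhN ?H //; try lra.
by rewrite (_ : _ - 2^-1 = - (s - t)) ?normrN // tE; ring.
Qed.

Lemma odd_extension : exists F F', [/\ sm F F', forall t, F (t + 1) = F t + 1 &
  forall (k : int) t, k%:~R - 2^-1 <= t <= k%:~R + 2^-1 ->
    k%:~R - 2^-1 <= F t <= k%:~R + 2^-1 /\ `|F t - k%:~R| = G `|t - k%:~R|].
Proof.
have [F' FS] := sm_loc Fsurj Floc; exists F, F'; split=> // [t|k t tk].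
  have [k kt] := nearest_int t; rewrite (FE (k := k) (t := t)); last lra.
  rewrite (FE (k := k + 1)) intrD /=; last lra.
  by rewrite addrA; congr (Gh _ + _ + _); ring.
have tI : - 2^-1 <= t - k%:~R <= 2^-1 by lra.
rewrite (FE tk) addrK Ghabs //; split=> //.
suff : `|Gh (t - k%:~R)| <= 2^-1 by rewrite ler_norml; lra.
rewrite Ghabs //; have /andP[] // : 0 <= G `|t - k%:~R| <= 2^-1.
by apply: GI; rewrite normr_ge0 ler_norml.
Qed.

End OddExtension.

(** * Interval components *)

Section Interval.
Variables (R : realType) (M : topologicalType) (A : set (chart R M)).
Hypothesis GA : good_atlas A.
Implicit Types (c d : chart R M) (x y : M) (p q t s l : R).

Variable g : R -> M.
Hypotheses (gr : reg A g 0 2^-1)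
  (gl : lterm A (g 0)) (gR : rterm A (g 2^-1)).
Hypothesis ginj : forall s t, 0 <= s -> s < t -> t <= 2^-1 -> g s <> g t.

Let Gam t := g `|t - (Num.floor (t + 2^-1))%:~R|.

Let GamE (k : int) t : k%:~R - 2^-1 <= t <= k%:~R + 2^-1 ->
  Gam t = g `|t - k%:~R|.
Proof.
move=> tk; rewrite /Gam; have [h|h] := ltP t (k%:~R + 2^-1).
  rewrite (_ : Num.floor (t + 2^-1) = k) //; apply: floor_def.
  by rewrite intrD /=; lra.
rewrite (_ : Num.floor (t + 2^-1) = k + 1); last first.
  by apply: floor_def; rewrite !intrD /=; lra.
by congr g; rewrite intrD ler0_norm ?ger0_norm /=; lra.
Qed.

Let Gam_g t : 0 <= t <= 2^-1 -> Gam t = g t.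
Proof.
move=> tI; have := @GamE 0 t; rewrite add0r subr0 ger0_norm; last by case/andP: tI.
by apply; lra.
Qed.

Let fold_int t : exists k : int, [/\ k%:~R - 2^-1 <= t < k%:~R + 2^-1,
  Gam t = g `|t - k%:~R| & 0 <= `|t - k%:~R| <= 2^-1].
Proof.
have [k kt] := nearest_int t; exists k; split=> //; first by apply: GamE; lra.
by rewrite normr_ge0 /= ler_norml; lra.
Qed.

Let guniq s t : 0 <= s <= 2^-1 -> 0 <= t <= 2^-1 -> g s = g t -> s = t.
Proof.
move=> sI tI e; have [h|h|//] := ltgtP s t; exfalso.
  by apply: ginj h _ e; lra.
by apply: ginj h _ (esym e); lra.
Qed.

Let Gam_inj s t : Gam s = Gam t ->
  exists k : int, s - t = k%:~R \/ s + t = k%:~R.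
Proof.
have [m [_ -> mI]] := fold_int s; have [n [_ -> nI]] := fold_int t.
move=> /(guniq mI nI); have [h|h] := leP 0 (s - m%:~R);
  have [h'|h'] := leP 0 (t - n%:~R) => e; rewrite ?(ger0_norm h) ?(ltr0_norm h)
  ?(ger0_norm h') ?(ltr0_norm h') in e.
- by exists (m - n); left; rewrite rmorphB /=; lra.
- by exists (m + n); right; rewrite rmorphD /=; lra.
- by exists (m + n); right; rewrite rmorphD /=; lra.
- by exists (m - n); left; rewrite rmorphB /=; lra.
Qed.

Let Gam_per t (k : int) : Gam (t + k%:~R) = Gam t.
Proof.
have [n [tn -> _]] := fold_int t; rewrite (@GamE (n + k)) rmorphD /=; last lra.
by congr (g `|_|); ring.
Qed.

(** For [z > 0] the image arc has points of smaller coordinate than [f (g z)], while [g 0] has the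
    least coordinate in its chart. *)
Let end_left f z : local_smooth A f -> 0 <= z <= 2^-1 -> f (g z) = g 0 -> z = 0.
Proof.
move=> fs zI e; apply/eqP; apply: contraT => z0; exfalso.
have {}z0 : 0 < z by rewrite lt_def z0; case/andP: zI.
have [c [Ac c0 H]] := gl; have cz : chart_dom c (f (g z)) by rewrite e.
have [u [u' [U [r r0 H1]]]] := reg_image fs gr zI Ac cz.
pose s := Num.max 0 (z - r / 2).
have sz : s < z by rewrite /s gt_max z0; lra.
have sz' : z - r / 2 <= s by rewrite /s le_max lexx orbT.
have s0 : 0 <= s by rewrite /s le_max lexx.
have [||cs sE] := H1 s; [lra|by rewrite ltr_norml; lra|].
have [|_ zE] := H1 z zI; first by rewrite subrr normr0.
have := H _ cs; rewrite sE -e zE (sm_le U); lra.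
Qed.

Let end_right f z : local_smooth A f -> 0 <= z <= 2^-1 ->
  f (g z) = g 2^-1 -> z = 2^-1.
Proof.
move=> fs zI e; apply/eqP; apply: contraT => z0; exfalso.
have {}z0 : z < 2^-1 by rewrite lt_neqAle z0; case/andP: zI.
have [c [Ac c0 H]] := gR; have cz : chart_dom c (f (g z)) by rewrite e.
have [u [u' [U [r r0 H1]]]] := reg_image fs gr zI Ac cz.
pose s := Num.min 2^-1 (z + r / 2).
have sz : z < s by rewrite /s lt_min z0; lra.
have sz' : s <= z + r / 2 by rewrite /s ge_min lexx orbT.
have s0 : s <= 2^-1 by rewrite /s ge_min lexx.
have [||cs sE] := H1 s; [lra|by rewrite ltr_norml; lra|].
have [|_ zE] := H1 z zI; first by rewrite subrr normr0.
have := H _ cs; rewrite sE -e zE (sm_le U); lra.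
Qed.

Let Gam_lift f g' : local_smooth A f -> local_smooth A g' ->
  cancel f g' -> cancel g' f -> (forall t, range Gam (f (Gam t))) ->
  (forall t, range Gam (g' (Gam t))) -> exists F F',
  [/\ sm F F', forall t, F (t + 1) = F t + 1 & forall t, Gam (F t) = f (Gam t)].
Proof.
move=> fs gs fK gK fR gR'.
have half0 : (0 : R) < 2^-1 by lra.
have I0 : 0 <= (0 : R) <= 2^-1 by rewrite lexx ltW.
have I1 : 0 <= (2^-1 : R) <= 2^-1 by rewrite lexx ltW.
have ex t : exists z, 0 <= t <= 2^-1 -> 0 <= z <= 2^-1 /\ g z = f (g t).
  have [tI|tI] := boolP (0 <= t <= 2^-1); last by exists 0.
  have [q _ eq] := fR t; have [k [_ qE qI]] := fold_int q.
  by exists `|q - k%:~R| => _; rewrite -qE eq Gam_g.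
have [G HG] := choice ex.
have GI t : 0 <= t <= 2^-1 -> 0 <= G t <= 2^-1 by move=> /HG[].
have GE t : 0 <= t <= 2^-1 -> g (G t) = f (g t) by move=> /HG[].
have Guniq z t : 0 <= t <= 2^-1 -> 0 <= z <= 2^-1 -> g z = f (g t) -> G t = z.
  by move=> tI zI e; apply: guniq; rewrite ?GI // GE.
have G0 : G 0 = 0 by apply: (end_left gs) => //; rewrite ?GI // GE // fK.
have G1 : G 2^-1 = 2^-1 by apply: (end_right gs) => //; rewrite ?GI // GE // fK.
have Gloc t : 0 <= t <= 2^-1 -> exists r r', [/\ sm r r', r t = G t &
    exists2 e, 0 < e & forall s, 0 <= s <= 2^-1 -> `|s - t| < e -> G s = r s].
  move=> tI; have zI := GI t tI; have [d Ad dz] := ga_cover GA (g (G t)).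
  have dt : chart_dom d (f (g t)) by rewrite -GE.
  have [u [u' [U [r1 r10 H1]]]] := reg_chart GA gr zI Ad dz.
  have [w [w' [W [r2 r20 H2]]]] := reg_image fs gr tI Ad dt.
  have [ui [ui' [UI uK uiK]]] := sm_inv U.
  have S := sm_comp UI W.
  have [|_ h1] := H1 _ zI; first by rewrite subrr normr0.
  have [|_ h2] := H2 _ tI; first by rewrite subrr normr0.
  have rt : (ui \o w) t = G t by rewrite /= -h2 -GE // h1 uK.
  do 2 eexists; split; [exact: S|exact: rt|].
  (* The local model must stay in [[0, 2^-1]]. If it takes an end as value at [t], then [t] is the
     same end by [end_left] or [end_right] and monotonicity suffices; otherwise continuity does. *)
  have [e1 e10 K1] : exists2 e, 0 < e & forall s, 0 <= s <= 2^-1 ->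
      `|s - t| < e -> 0 <= (ui \o w) s.
    have [z0|z0] := eqVneq (G t) 0.
      exists 1 => // s sI _; have t0 : t = 0.
        by apply: (end_left fs) => //; rewrite -GE // z0.
      by rewrite -[leLHS]z0 -rt (sm_le S) t0; case/andP: sI.
    have {}z0 : 0 < G t by rewrite lt_def z0; case/andP: zI.
    have [e e0 H] := sm_cont S t z0; exists e => // s _ /(H s I).
    by rewrite rt ltr_norml; lra.
  have [e2 e20 K2] : exists2 e, 0 < e & forall s, 0 <= s <= 2^-1 ->
      `|s - t| < e -> (ui \o w) s <= 2^-1.
    have [z0|z0] := eqVneq (G t) 2^-1.
      exists 1 => // s sI _; have t0 : t = 2^-1.
        by apply: (end_right fs) => //; rewrite -GE // z0.
      by rewrite -[leRHS]z0 -rt (sm_le S) t0; case/andP: sI.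
    have {}z0 : 0 < 2^-1 - G t by rewrite subr_gt0 lt_neqAle z0; case/andP: zI.
    have [e e0 H] := sm_cont S t z0; exists e => // s _ /(H s I).
    by rewrite rt ltr_norml; lra.
  have [e3 e30 K3] := sm_cont S t r10.
  exists (Num.min (Num.min e1 e2) (Num.min e3 r2)).
    by rewrite !lt_min e10 e20 e30.
  move=> s sI; rewrite !lt_min => /andP[/andP[s1 s2] /andP[s3 s4]].
  have wI : 0 <= (ui \o w) s <= 2^-1 by rewrite K1 // K2.
  apply: Guniq => //.
  have [|a1 b1] := H1 _ wI; first by rewrite -rt; exact: K3.
  have [a2 b2] := H2 s sI s4.
  by apply: (nice_inj (ga_chart GA Ad)) => //; rewrite b1 b2 /= uiK.
have Gonto z : 0 <= z <= 2^-1 -> exists2 t, 0 <= t <= 2^-1 & G t = z.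
  move=> zI; have [q _ eq] := gR' z; have [n [_ qE qI]] := fold_int q.
  exists `|q - n%:~R| => //.
  by apply: Guniq => //; rewrite -qE eq gK Gam_g.
have [F [F' [FS F1 FG]]] := odd_extension G0 G1 GI Gonto Gloc.
exists F, F'; split=> // t; have [k [tk -> tI]] := fold_int t.
have [|FI FA] := FG k t; first lra.
by rewrite (@GamE k) // FA GE.
Qed.

Lemma interval_component :
  exists Gam, component_param A Gam /\ Gam 2^-1 = g 2^-1.
Proof.
exists Gam; split; last by apply: Gam_g; lra.
have rE : range Gam = g @` `[0, 2^-1].
  apply/seteqP; split=> [_ [t _ <-]|_ [t tI <-]]; last first.
    by move: tI; rewrite /= in_itv /= => tI; exists t => //; rewrite Gam_g.
  have [k [_ -> tI]] := fold_int t.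
  by exists `|t - k%:~R|; rewrite //= in_itv.
split=> [s t /Gam_inj//|t k|||B s t oB cB|f g'].
- exact: Gam_per.
- rewrite rE openE => _ [t tI <-]; move: tI; rewrite /= in_itv /= => tI.
  apply: (reg_nbhs GA gr) => //.
  + have [->|t0] := eqVneq t 0; first by right.
    by left; rewrite lt_def t0; case/andP: tI.
  + have [->|t0] := eqVneq t 2^-1; first by right.
    by left; rewrite lt_neqAle t0; case/andP: tI.
- by rewrite rE; apply: (reg_closed GA) => //; rewrite invr_ge0.
- have [m [_ -> mI]] := fold_int s; have [n [_ -> nI]] := fold_int t.
  exact: (reg_connected GA gr).
- exact: Gam_lift.
Qed.

End Interval.

(** * Every point lies on a circle or an interval *)

Section Classification.
Variables (R : realType) (M : topologicalType).
Implicit Types (A : set (chart R M)) (c d : chart R M) (x y : M).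
Implicit Types (p q t s l : R).

Lemma reg_cst A x : good_atlas A -> reg A (fun=> x) 0 0.
Proof.
move=> GA t t0; have [c Ac cx] := ga_cover GA x.
exists c, (fun s => 1 * s + chart_map c x), (fun=> 1); split=> //.
  exact: sm_affine.
by exists 1 => // s s0 _; split=> //; rewrite (_ : s = 0) ?mulr0 ?add0r //; lra.
Qed.

Lemma reg_reverse A gam l : 0 < l -> reg (neg_atlas A) gam 0 l ->
  reg A (fun t => gam (l - l * 2 * t)) 0 2^-1.
Proof.
move=> l0 gr t tI; have l2 : 0 < l * 2 by lra.
have tl : l * 2 * t <= l by have /andP[_ h] := tI; have := ler_wpM2l (ltW l2) h; lra.
have tl0 : 0 <= l * 2 * t by rewrite mulr_ge0 ?(ltW l2) //; case/andP: tI.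
have [|_ [u [u' [[c Ac <-] U [r r0 H]]]]] := gr (l - l * 2 * t); first lra.
do 3 eexists; split.
- exact: Ac.
- exact: (sm_comp (sm_reflect U) (sm_affine (- l) l2)).
exists (r / (l * 2)); first by rewrite divr_gt0.
move=> s sI; rewrite ltr_pdivlMr // => st.
have sl : l * 2 * s <= l by have /andP[_ h] := sI; have := ler_wpM2l (ltW l2) h; lra.
have sl0 : 0 <= l * 2 * s by rewrite mulr_ge0 ?(ltW l2) //; case/andP: sI.
have [||/= cs sE] := H (l - l * 2 * s); first lra.
  rewrite (_ : _ - _ = - ((s - t) * (l * 2))); last ring.
  by rewrite normrN normrM (gtr0_norm l2).
split=> //; rewrite -[LHS]opprK sE; congr (- u _); ring.
Qed.

Lemma rterm_left A c x : good_atlas A -> A c -> chart_dom c x ->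
  (forall y, chart_dom c y -> chart_map c y <= chart_map c x) ->
  exists2 r, 0 < r & forall v, chart_map c x - r < v <= chart_map c x ->
    chart_img c v.
Proof.
move=> GA Ac cx H; have [r r0 K] := nice_shape (ga_chart GA Ac) cx.
have no v : chart_img c v -> v <= chart_map c x by move=> [y cy <-]; exact: H.
exists r => //; case: K => [K|[K _]|[K _]] //.
  have /no : chart_img c (chart_map c x + r / 2); last lra.
  by apply: K; rewrite ltr_norml; lra.
have /no : chart_img c (chart_map c x + r / 2); last lra.
by apply: K; lra.
Qed.

(** By [reg_return] the backward arc would come back to [x], and just before its coordinate would
    exceed the maximum [chart_map c x]. *)
Lemma terminal_no_return A gam l x : good_atlas A -> rterm A x ->
  reg (neg_atlas A) gam 0 l -> gam 0 = x ->
  ~ exists t1 t2, [/\ 0 <= t1, t1 < t2, t2 <= l & gam t1 = gam t2].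
Proof.
move=> GA [c [Ac cx H]] gr g0 [t1 [t2 [t10 t12 t2l e]]].
have GN := good_neg GA.
have [t tI te] := reg_return GN gr t10 t12 t2l e.
have tI' : 0 <= t <= l by lra.
have Nc : neg_atlas A (neg_chart c) by exists c.
have ct : chart_dom (neg_chart c) (gam t) by rewrite te g0.
have [u [u' [U [r r0 K]]]] := reg_chart GN gr tI' Nc ct.
pose s := Num.max 0 (t - r / 2).
have sz : s < t by rewrite /s gt_max; lra.
have sz' : t - r / 2 <= s by rewrite /s le_max lexx orbT.
have s0 : 0 <= s by rewrite /s le_max lexx.
have [||/= cs sE] := K s; [lra|by rewrite ltr_norml; lra|].
have [|/= _ zE] := K t tI'; first by rewrite subrr normr0.
have := H _ cs; have : u s < u t by rewrite (sm_lt U).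
by rewrite -sE -zE te g0; lra.
Qed.

(** Run forwards from [x]. A self-intersection gives a circle through [x]. Otherwise a right
    boundary point is reached, and the backward run from there cannot meet itself, so it ends at a
    left boundary point and traces an interval. This interval is open and closed, hence contains the
    forward arc and [x]. *)
Lemma component_at A x : good_atlas A ->
  exists2 Gam, component_param A Gam & range Gam x.
Proof.
move=> GA; have GN := good_neg GA.
have [l [gam [l0 gr g0 H]]] := run GA (lexx 0) (reg_cst x GA).
case: H => [et|[t1 [t2 [t10 t12 t2l e]]]]; last first.
  have [t /andP[t0 tt2] te] := reg_return GA gr t10 t12 t2l e.
  have tl : t <= l by lra.
  have gr' := reg_sub (lexx 0) tl gr.
  have [l' /andP[l'0 l't] [l'E inj]] := first_return GA t0 gr' te.
  have [Gam [GP G0]] := circle_component GA l'0 (reg_sub (lexx 0) l't gr') l'E inj.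
  by exists Gam => //; exists 0 => //; rewrite G0 g0.
have [c [Ac cl Hc]] := et.
have [r r0 Hr] := rterm_left GA Ac cl Hc.
(* A first backward step of positive length ensures [0 < l2], so that the interval is not a
   point. *)
have [l1 [eta0 [l10 er0 e0 _]]] : exists l' gam',
    [/\ 0 < l', reg (neg_atlas A) gam' 0 l', forall t, t <= 0 -> gam' t = gam l &
      gam' l' = chart_inv (neg_chart c) (- chart_map c (gam l) + r / 2)].
  apply: (reg_extend GN (lexx 0) (reg_cst (gam l) GN)) => /=.
  - by exists c.
  - exact: cl.
  - lra.
  - move=> s sI; have [|y cy yE] := Hr (- s); first lra.
    by exists y => //=; rewrite yE opprK.
have [l2 [eta [l12 er e0' H]]] := run GN (ltW l10) er0.
have e0l : eta 0 = gam l by rewrite e0' e0.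
have no := terminal_no_return GA et er e0l.
have {H} lt : rterm (neg_atlas A) (eta l2) by case: H.
have l20 : 0 < l2 by lra.
pose g t := eta (l2 - l2 * 2 * t).
have gE : g 2^-1 = gam l by rewrite /g (_ : _ - _ = 0) //; field.
have [|||Gam [GP GE]] := interval_component GA (reg_reverse l20 er).
- rewrite mulr0 subr0; have [_ [[d Ad <-] /= dx K]] := lt.
  by exists d; split=> // y dy; have := K y dy; rewrite lerN2.
- by rewrite -/(g 2^-1) gE.
- move=> s t s0 st t1 e; apply: no.
  have l22 : 0 < l2 * 2 by lra.
  have h1 : l2 * 2 * s < l2 * 2 * t by rewrite ltr_pM2l.
  have h2 : l2 * 2 * t <= l2 * 2 * 2^-1 by rewrite ler_pM2l.
  have h3 : 0 <= l2 * 2 * s by rewrite mulr_ge0 // ltW.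
  by exists (l2 - l2 * 2 * t), (l2 - l2 * 2 * s); split=> //; lra.
exists Gam => //; rewrite -g0.
have I0 : 0 <= (0 : R) <= l by rewrite lexx.
have Il : 0 <= l <= l by rewrite l0 lexx.
apply: (reg_connected GA gr Il I0 (param_open GP) (param_closed GP)).
by exists 2^-1 => //; rewrite GE -/(g 2^-1) gE.
Qed.

End Classification.

(** * The action on the components *)

Lemma pigeonhole (T : Type) (S : set T) (f : nat -> T) : finite_set S ->
  (forall n, S (f n)) -> exists i j, (i < j)%N /\ f i = f j.
Proof.
move=> fS Sf; apply: contrapT => no; apply: infinite_nat.
have -> : [set: nat] = f @^-1` S by apply/seteqP; split=> // n _; exact: Sf.
apply: finite_preimage fS => i j _ _ e.
have [ij|ji|//] := ltngtP i j; exfalso; apply: no.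
  by exists i, j.
by exists j, i.
Qed.

(** Two of the cosets of [H] represented by powers of [g] coincide. *)
Lemma finite_index_power (gT : groupType) (H : {pred gT}) g :
  group_closed H -> finite_index H -> exists2 n, (0 < n)%N & (g ^+ n)%g \in H.
Proof.
move=> [H1 _] fH.
have [|i [j [ij e]]] := @pigeonhole _ _
  (fun n => [set (g ^+ n * h)%g | h in [set` H]]) fH; first by move=> n; exists (g ^+ n)%g.
exists (j - i)%N; first by rewrite subn_gt0.
have : [set (g ^+ i * h)%g | h in [set` H]] (g ^+ j)%g.
  by rewrite e; exists 1%g; rewrite ?mulg1.
move=> [h hH]; rewrite -{1}(subnKC (ltnW ij)) expgnDr => /mulgI <-.
exact: hH.
Qed.

Section Action.
Variables (R : realType) (M : topologicalType) (atlas : set (chart R M)).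
Variables (gT : groupType) (H : {pred gT}) (rho : gT -> M -> M).
Hypothesis Hone : 1%g \in H.
Hypothesis HM : forall g h, g \in H -> h \in H -> (g * h)%g \in H.
Hypothesis HV : forall g, g \in H -> g^-1%g \in H.
Hypothesis rho1 : forall x, rho 1%g x = x.
Hypothesis rhoM : forall g h x, g \in H -> h \in H ->
  rho (g * h)%g x = rho g (rho h x).
Hypothesis rho_cont : forall g, g \in H -> continuous (rho g).
Hypothesis rho_smooth : forall g, g \in H -> local_smooth atlas (rho g).
Implicit Types (g h : gT) (x y : M) (Gam : R -> M) (t : R).

Variables (C : M -> R -> M) (s : seq M).
Hypothesis CP : forall x, component_param atlas (C x).
Hypothesis Ccov : forall y, exists2 x, x \in s & range (C x) y.

Let HX h n : h \in H -> (h ^+ n)%g \in H.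
Proof. by move=> hH; elim: n => // n IH; rewrite expgS HM. Qed.

Let rhoK h x : h \in H -> rho h^-1%g (rho h x) = x.
Proof. by move=> hH; rewrite -rhoM ?HV // mulVg rho1. Qed.

Let rhoKV h x : h \in H -> rho h (rho h^-1%g x) = x.
Proof. by move=> hH; rewrite -rhoM ?HV // mulgV rho1. Qed.

Definition preserves h : Prop := h \in H /\ forall x, x \in s -> forall t,
  range (C x) (rho h (C x t)) /\ range (C x) (rho h^-1%g (C x t)).

Lemma preserves_one : preserves 1%g.
Proof. by split=> // x _ t; rewrite invg1 rho1; split; exists t. Qed.

Lemma preserves_inv h : preserves h -> preserves h^-1%g.
Proof.
move=> [hH hC]; split=> [|x xs t]; first exact: HV.
by rewrite invgK; have [] := hC x xs t.
Qed.

Lemma preserves_mul g h : preserves g -> preserves h -> preserves (g * h)%g.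
Proof.
move=> [gH gC] [hH hC]; split=> [|x xs t]; first exact: HM.
rewrite invgM !rhoM ?HV //; split.
  by have [[t' _ <-] _] := hC x xs t; have [] := gC x xs t'.
by have [_ [t' _ <-]] := gC x xs t; have [] := hC x xs t'.
Qed.

(** The preimage of the component of [y] is open and closed, hence contains all of the component of
    [x]. *)
Let transport h x y t0 : h \in H -> range (C y) (rho h (C x t0)) ->
  forall t, range (C y) (rho h (C x t)).
Proof.
move=> hH h0 t; have hc := rho_cont hH.
apply: (@param_connected _ _ _ _ (CP x) (rho h @^-1` range (C y)) t0 t) => //.
- by apply: open_comp => [z _|]; [exact: hc|exact: param_open (CP y)].
- by apply: preimage_closed => [z _|]; [exact: hc|exact: param_closed (CP y)].
Qed.

Lemma power_preserves h : h \in H -> exists2 n, (0 < n)%N & preserves (h ^+ n)%g.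
Proof.
move=> hH.
(* Two powers of [h] send [C x 0] into the same component. The multiples of [n] are carried along so
   that the exponents found for the several components can be multiplied. *)
have one x : exists2 n, (0 < n)%N & forall k t,
    range (C x) (rho (h ^+ (n * k))%g (C x t)) /\
    range (C x) (rho (h ^+ (n * k))^-1%g (C x t)).
  have ex n : exists y, y \in s /\ range (C y) (rho (h ^+ n)%g (C x 0)).
    by have [y ys yR] := Ccov (rho (h ^+ n)%g (C x 0)); exists y.
  have [f Hf] := choice ex.
  have [|m [n [mn e]]] := @pigeonhole _ [set` s] f (finite_seq s).
    by move=> n; have [] := Hf n.
  have [_ Hm] := Hf m; have [_ Hn] := Hf n; rewrite -e in Hn.
  have back k : range (C (f m)) (rho (h ^+ k)%g (C x 0)) ->
      forall t, range (C x) (rho (h ^+ k)^-1%g (C (f m) t)).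
    move=> [t0 _ te]; apply: (@transport _ _ _ t0); first by rewrite HV ?HX.
    by rewrite te rhoK ?HX //; exists 0.
  have d1 : (h ^+ (n - m) = (h ^+ m)^-1 * h ^+ n)%g.
    by rewrite -{2}(subnKC (ltnW mn)) expgnDr mulKg.
  have d2 : ((h ^+ (n - m))^-1 = (h ^+ n)^-1 * h ^+ m)%g.
    by rewrite d1 invgM invgK.
  have step t : range (C x) (rho (h ^+ (n - m))%g (C x t)) /\
      range (C x) (rho (h ^+ (n - m))^-1%g (C x t)).
    rewrite d2 d1 !rhoM ?HV ?HX //; split.
      have [t' _ <-] := transport (HX n hH) Hn t; exact: back Hm t'.
    have [t' _ <-] := transport (HX m hH) Hm t; exact: back Hn t'.
  exists (n - m)%N; first by rewrite subn_gt0.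
  elim=> [|k IH] t; first by rewrite muln0 expg0 invg1 rho1; split; exists t.
  rewrite mulnS; split.
    rewrite expgnDr rhoM ?HX //; have [[t' _ <-] _] := IH t.
    by have [] := step t'.
  rewrite addnC expgnDr invgM rhoM ?HV ?HX //; have [_ [t' _ <-]] := IH t.
  by have [] := step t'.
have [n n0 Hn] : exists2 n, (0 < n)%N & forall x, x \in s -> forall k t,
    range (C x) (rho (h ^+ (n * k))%g (C x t)) /\
    range (C x) (rho (h ^+ (n * k))^-1%g (C x t)).
  elim: (s) => [|x r [n n0 Hn]]; first by exists 1%N.
  have [m m0 Hm] := one x; exists (m * n)%N; first by rewrite muln_gt0 m0.
  move=> y; rewrite inE => /predU1P[->|yr] k t; first by rewrite -mulnA.
  by rewrite [(m * n)%N]mulnC -mulnA; exact: Hn.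
exists n => //; split; first exact: HX.
by move=> x xs t; have := Hn x xs 1%N t; rewrite muln1.
Qed.

Definition lifts x h (F : R -> R) : Prop := [/\ preserves h,
  exists F', sm F F', forall t, F (t + 1) = F t + 1 &
  forall t, C x (F t) = rho h (C x t)].

Lemma lift_exists x h : x \in s -> preserves h -> exists F, lifts x h F.
Proof.
move=> xs hP; have [hH hC] := hP.
have hK : cancel (rho h) (rho h^-1%g) by move=> z; exact: rhoK.
have hKV : cancel (rho h^-1%g) (rho h) by move=> z; exact: rhoKV.
have [t|t|F [F' [FS F1 FE]]] := param_lift (CP x) (rho_smooth hH)
  (rho_smooth (HV hH)) hK hKV.
- by have [] := hC x xs t.
- by have [] := hC x xs t.
by exists F; split=> //; exists F'.
Qed.

(* [G + F] is strictly increasing, hence [G - F] takes integer values on a dense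
   set. *)
Lemma lifts_int (F F' G G' : R -> R) : sm F F' -> sm G G' ->
  (forall t, exists k : int, G t - F t = k%:~R \/ G t + F t = k%:~R) ->
  exists k : int, forall t, G t = F t + k%:~R.
Proof.
move=> FS GS FG; pose D t := G t - F t.
have Dc t e : 0 < e -> exists2 r, 0 < r & forall u, `|u - t| < r ->
    `|D u - D t| < e /\ `|G u + F u - (G t + F t)| < e.
  move=> e0; have e20 : 0 < e / 2 by lra.
  have [r1 r10 H1] := sm_cont FS t e20; have [r2 r20 H2] := sm_cont GS t e20.
  exists (Num.min r1 r2); first by rewrite lt_min r10.
  move=> u; rewrite lt_min => /andP[/(H1 u I) + /(H2 u I)].
  by rewrite /D !ltr_norml; lra.
have Dint t : exists k : int, D t = k%:~R.
  apply: contrapT => no; have [k kt] := int_part (D t).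
  have k1 : k%:~R < D t.
    by rewrite lt_def; case/andP: kt => -> _; rewrite andbT; apply/eqP => e; apply: no; exists k.
  have m0 : 0 < Num.min (D t - k%:~R) (k%:~R + 1 - D t) by rewrite lt_min; lra.
  have [r r0 Hr] := Dc t _ m0.
  have Sint u : `|u - t| < r -> exists n : int, G u + F u = n%:~R.
    move=> ut; have [n [e|e]] := FG u; last by exists n.
    have [+ _] := Hr u ut; rewrite lt_min /D e !ltr_norml => h.
    have h1 : - 1 < (n - k)%:~R :> R by rewrite rmorphB /=; rewrite /D in h kt k1; lra.
    have h2 : (n - k)%:~R < 1 :> R by rewrite rmorphB /=; rewrite /D in h kt k1; lra.
    have nk : n - k = 0 := @int_lt1 R (n - k) h1 h2; have nk' : n = k by exact: subr0_eq.
    by rewrite nk' /D in h; lra.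
  have tt : `|t - t| < r by rewrite subrr normr0.
  have ur : `|t + r / 2 - t| < r by rewrite ltr_norml; lra.
  have [n ne] := Sint _ tt; have [n' ne'] := Sint _ ur.
  have [_ +] := Hr _ ur; rewrite lt_min !ltr_norml => h.
  have lt1 : F t < F (t + r / 2) by rewrite (sm_lt FS); lra.
  have lt2 : G t < G (t + r / 2) by rewrite (sm_lt GS); lra.
  have h1 : - 1 < (n' - n)%:~R :> R by rewrite rmorphB /= -ne -ne'; lra.
  have h2 : (n' - n)%:~R < 1 :> R by rewrite rmorphB /= -ne -ne'; lra.
  have nn : n' - n = 0 := @int_lt1 R (n' - n) h1 h2; have nn' : n' = n by exact: subr0_eq.
  by rewrite nn' -ne in ne'; lra.
have const a b : a <= b -> D a = D b.
  move=> ab; apply: (@interval_induction R (fun u v => D u = D v) a b ab).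
    by move=> u v w _ _ _ _ -> ->.
  move=> t _; have [r r0 Hr] := Dc t (2^-1) ltac:(by rewrite invr_gt0).
  have near u : `|u - t| < r -> D u = D t.
    move=> ut; have [h _] := Hr u ut; have [k ke] := Dint t; have [n ne] := Dint u.
    move: h; rewrite ke ne ltr_norml => h.
    have h1 : - 1 < (n - k)%:~R :> R by rewrite rmorphB /=; lra.
    have h2 : (n - k)%:~R < 1 :> R by rewrite rmorphB /=; lra.
    have nk : n - k = 0 := @int_lt1 R (n - k) h1 h2; by have -> : n = k by exact: subr0_eq.
  by exists r => // u v *; rewrite !near // ltr_norml; lra.
have [k ke] := Dint 0; exists k => t.
suff : D t = k%:~R by rewrite /D; lra.
by rewrite -ke; have [h|h] := leP t 0; [exact: const|exact/esym/const/ltW].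
Qed.

Lemma lifts_action x : x \in s -> lifted_action (lifts x).
Proof.
move=> xs; split.
- move=> h F [_ [F' FS] F1 _]; have [Fd Fc F0 _ Fv] := FS.
  by exists F'; [split|exact: Fv].
- split=> //; [exact: preserves_one|by exists (fun=> 1); exact: sm_id].
- move=> g h F G [gP [F' FS] F1 FE] [hP [G' GS] G1 GE].
  split=> [||t|t /=]; first exact: preserves_mul.
  + by eexists; exact: sm_comp FS GS.
  + by rewrite /= G1 F1.
  + by rewrite FE GE rhoM //; [case: gP|case: hP].
- move=> h F [hP [F' FS] F1 FE]; have [G [G' [GS FK GK]]] := sm_inv FS.
  have hH : h \in H by case: hP.
  exists G; split=> //; split=> [||t|t]; first exact: preserves_inv.
  + by exists G'.
  + by apply: (can_inj FK); rewrite F1 !GK.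
  + by rewrite -{2}(GK t) FE rhoK.
- move=> h F k [hP [F' FS] F1 FE]; split=> // [|t|t].
  + by exists (fun t => F' (t + 0)); have := sm_translate 0 k%:~R FS;
       rewrite (_ : (fun _ => _) = (fun t => F t + k%:~R)) //; apply/funext => t; rewrite addr0.
  + by rewrite F1; ring.
  + by rewrite (param_periodic (CP x)) FE.
- move=> h F G [hP [F' FS] F1 FE] [_ [G' GS] G1 GE].
  apply: (lifts_int FS GS) => t.
  by apply: (param_inj (CP x)); rewrite GE FE.
Qed.

Definition fixes h x := forall t, rho h (C x t) = C x t.

Lemma fixes_inv h x : h \in H -> fixes h x -> fixes h^-1%g x.
Proof. by move=> hH hx t; rewrite -{1}(hx t) rhoK. Qed.

Lemma fixes_conj g h x : x \in s -> preserves g -> h \in H -> fixes h x ->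
  fixes (g * h * g^-1)%g x.
Proof.
move=> xs [gH gC] hH hx t; rewrite !rhoM ?HM ?HV //.
by have [_ [t' _ e]] := gC x xs t; rewrite -e hx e rhoKV.
Qed.

Lemma fixes_comml g h x : x \in s -> preserves h -> g \in H -> fixes g x ->
  fixes (comm g h) x.
Proof.
move=> xs [hH hC] gH gx t; rewrite /comm !rhoM ?HM ?HV //.
have [_ [t' _ e]] := hC x xs t.
by rewrite -e (fixes_inv gH gx) e rhoKV // gx.
Qed.

Lemma fixes_commr g h x : x \in s -> preserves g -> h \in H -> fixes h x ->
  fixes (comm g h) x.
Proof.
move=> xs [gH gC] hH hx t; rewrite /comm !rhoM ?HM ?HV //.
rewrite (fixes_inv hH hx); have [_ [t' _ e]] := gC x xs t.
by rewrite -e hx e rhoKV.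
Qed.

Section Kernel.
Variables (nt : gT -> Prop) (a b c d : gT).
Hypotheses (ab : (a * b = b * a)%g) (cb : (c * b = b * c)%g).
Hypothesis NT : nontriviality nt a b c d.
Hypotheses (aP : preserves a) (bP : preserves b) (cP : preserves c)
  (dP : preserves d).

Let generated_preserves r g : (forall h, h \in r -> preserves h) ->
  generated_by r g -> preserves g.
Proof.
move=> rP; apply=> //; [exact: preserves_one|exact: preserves_mul|].
exact: preserves_inv.
Qed.

Lemma trivial_on_component x : x \in s ->
  exists h, [/\ nt h, preserves h & fixes h x].
Proof.
move=> xs; have [F aF] := lift_exists xs aP; have [G bG] := lift_exists xs bP.
have [K cK] := lift_exists xs cP; have [N dN] := lift_exists xs dP.
have [h [hn [hP _ _ hE]]] := nontrivial_kernel (lifts_action xs) aF bG cK dN ab cb NT.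
by exists h; split=> // t; rewrite -hE.
Qed.

(** A commutator of elements preserving the components is trivial on each component where one of its
    entries is. So the components are treated one at a time, [nt_list] supplying a conjugator that
    keeps the commutator nontrivial. *)
Lemma trivial_element : exists h, [/\ nt h, preserves h & forall y, rho h y = y].
Proof.
suff [h [hn hP hx]] : exists h, [/\ nt h, preserves h & forall x, x \in s -> fixes h x].
  by exists h; split=> // y; have [x xs [t _ <-]] := Ccov y; exact: hx.
suff key (r : seq M) : {subset r <= s} ->
    exists h, [/\ nt h, preserves h & forall x, x \in r -> fixes h x] by exact: key.
elim: r => [|x r IH] rs.
  by exists (b ^+ 1)%g; split=> //; exact: (nt_be NT).
have [|y [yn yP yx]] := IH; first by move=> z zr; apply: rs; rewrite inE zr orbT.
have xs : x \in s by apply: rs; rewrite mem_head.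
have [h [hn hP hx]] := trivial_on_component xs.
pose al := comm (a ^+ 1)%g (c ^+ 1)%g; pose be := (b ^+ 1)%g.
pose t := (d * al * d^-1)%g.
have [l lgen lnt] := nt_list NT (ltn0Sn 0) (ltn0Sn 0) (ltn0Sn 0) (or_introl (erefl t)) hn.
have alP : preserves al by rewrite /al /comm !expg1; repeat first [apply: preserves_mul|apply: preserves_inv].
have [g gl gn] := lnt y yn.
have gP : preserves g.
  apply: generated_preserves (lgen g gl) => k; rewrite !inE.
  case/or3P => /eqP-> //.
  by rewrite /t; repeat first [apply: preserves_mul|apply: preserves_inv].
have hH : h \in H by case: hP.
have yH : y \in H by case: yP.
have wP : preserves (g * h * g^-1)%g by repeat first [apply: preserves_mul|apply: preserves_inv].
have wH : (g * h * g^-1)%g \in H by case: wP.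
exists (comm y (g * h * g^-1)%g); split=> //.
  by rewrite /comm; repeat first [apply: preserves_mul|apply: preserves_inv].
move=> z; rewrite inE => /predU1P[->|zr].
  by apply: fixes_commr => //; exact: fixes_conj.
by apply: fixes_comml => //; [apply: rs; rewrite inE zr orbT|exact: yx].
Qed.

End Kernel.
End Action.

Lemma compact_one_manifold_good (R : realType) (M : topologicalType)
    (atlas : set (chart R M)) :
  compact_one_manifold atlas -> Diff1bv atlas id -> good_atlas atlas.
Proof.
move=> CM idD; split.
- exact: manifold_compact CM.
- exact: manifold_hausdorff CM.
- by move=> c /(atlas_chart CM); exact: is_chart_nice.
- exact: atlas_cover CM.
- exact: (diff_local_smooth (atlas_chart CM)).
Qed.

Theorem theorem1p4 (R : realType) (M : topologicalType)
    (atlas : set (chart R M)) (H : {pred RAAG P4}) :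
  compact_one_manifold atlas ->
  group_closed H -> finite_index H ->
  ~ exists rho : RAAG P4 -> M -> M, embedding H (Diff1bv atlas) rho.
Proof.
move=> CM HG fH [rho [rhoD rhoM rho_inj]]; have [H1 HB] := HG.
have HV g : g \in H -> g^-1%g \in H by move=> gH; rewrite -div1g HB.
have HM g h : g \in H -> h \in H -> (g * h)%g \in H.
  by move=> gH hH; rewrite -(invgK h) HB // HV.
have rho1 x : rho 1%g x = x.
  have [[_ [k [_ rK _]]] _ _] := rhoD _ H1; apply: (can_inj rK).
  by have := rhoM _ _ H1 H1; rewrite mulg1 => /(congr1 (@^~ x)) /= <-.
(* The identity is [rho 1], hence in [Diff1bv]; read in pairs of charts, this controls the variation
   of the derivatives of the chart changes. *)
have idD : Diff1bv atlas id.
  have -> : id = rho 1%g by apply/funext => x; rewrite rho1.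
  exact: rhoD.
have GA := compact_one_manifold_good CM idD.
have rhoM' g h x : g \in H -> h \in H -> rho (g * h)%g x = rho g (rho h x).
  by move=> gH hH; rewrite rhoM.
have rho_cont g : g \in H -> continuous (rho g).
  by move=> /rhoD[[[]]].
have rho_smooth g : g \in H -> local_smooth atlas (rho g).
  by move=> /rhoD; exact: diff_local_smooth (atlas_chart CM).
have ex x : exists C, component_param atlas C /\ range C x.
  by have [C CP Cx] := component_at x GA; exists C.
have [C HC] := choice ex; have CP x : component_param atlas (C x) by have [] := HC x.
have [|s Ccov] := @compact_finite_nbhs _ (fun x => range (C x)) (ga_compact GA).
  by move=> x; apply: open_nbhs_nbhs; split; [exact: param_open|have [] := HC x].
pose pres := preserves H rho C s.
have power g : exists2 n, (0 < n)%N & pres (g ^+ n)%g.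
  have [n n0 gn] := finite_index_power g HG fH.
  have [m m0 P] := power_preserves H1 HM HV rho1 rhoM' rho_cont CP Ccov gn.
  by exists (n * m)%N; rewrite ?muln_gt0 ?n0 // expgnA.
have [i i0 aP] := power (raag_gen 0); have [j j0 bP] := power (raag_gen 1%R).
have [k k0 cP] := power (raag_gen 2%:R); have [n n0 dP] := power (raag_gen 3%:R).
(* Doubling makes the exponent of the last generator exceed 1, as [raag_nontriviality] requires. *)
have {}dP : pres (raag_gen 3%:R ^+ (n * 2))%g.
  by rewrite expgnA expg2; exact: (preserves_mul HM HV rhoM').
have n1 : (1 < n * 2)%N by rewrite muln2 -addnn; lia.
have ab : (raag_gen 0 ^+ i * raag_gen 1%R ^+ j = raag_gen 1%R ^+ j * raag_gen 0 ^+ i)%g.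
  by apply: commuteX2; exact: raag_comm.
have cb : (raag_gen 2%:R ^+ k * raag_gen 1%R ^+ j =
    raag_gen 1%R ^+ j * raag_gen 2%:R ^+ k)%g.
  by apply: commuteX2; exact: raag_comm.
have [h [hn [hH _] hid]] := trivial_element H1 HM HV rho1 rhoM'
  rho_smooth CP Ccov ab cb (raag_nontriviality i0 j0 k0 n1) aP bP cP dP.
apply: (hn 1); rewrite (rho_inj h 1%g) ?rep_mx1 //.
by apply/funext => x; rewrite hid rho1.
Qed.
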